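(* Let $0<\underline x<\overline x<1/2$. Let $u_0\in W_2^1(\underline x,\overline x)$, $v_0,w_0\in\mathbb R$ satisfy $u_0\ge 0$, $u_0\not\equiv 0$, $v_0\ge 0$, $|w_0|\le 1/2$, let $r_0:[\underline x,\overline x]\to\{-1,1\}$ be an initial configuration such that the initial state $A(0)$ is simple and satisfies the compatibility condition, and let $(u,v,w)$ be the solution of problem (P) described in the context, on the time interval $[0,\infty)$. Put $U_0=\int_{\underline x}^{\overline x}u_0(x)\,dx$. Then, as $t\to\infty$, $$v(t)\to 0,\qquad u(\cdot,t)\to\frac{U_0+v_0}{\overline x-\underline x}\quad\text{in } C[\underline x,\overline x].$$
   Context: Fix $0<\underline x<\overline x$. For $T>0$ put $Q_T=(\underline x,\overline x)\times(0,T)$; $L_q=L_q(\underline x,\overline x)$ and $W_q^k=W_q^k(\underline x,\overline x)$ are the usual Lebesgue and Sobolev spaces; $W_2^{2,1}(Q_T)$ is the anisotropic Sobolev space with norm $\left(\int_0^T\|u(\cdot,t)\|_{W_2^2}^2dt+\int_0^T\|u_t(\cdot,t)\|_{L_2}^2dt\right)^{1/2}$ (its elements have representatives continuous on $\overline{Q_T}$, which are used for pointwise values). Non-ideal relay. Let $r_0:[\underline x,\overline x]\to\{-1,1\}$ (the initial configuration). For $x\in[\underline x,\overline x]$ and $w\in C[0,T]$, define for $t\in[0,T]$: $\mathcal R^x(w)(t)=-1$ if there is $\tau\in[0,t]$ with $w(\tau)<-x$ and $w(s)<x$ for all $s\in[\tau,t]$; $\mathcal R^x(w)(t)=1$ if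 there is $\tau\in[0,t]$ with $w(\tau)\ge x$ and $w(s)\ge -x$ for all $s\in[\tau,t]$; $\mathcal R^x(w)(t)=r_0(x)$ if $-x\le w(\tau)<x$ for all $\tau\in[0,t]$. Put $\mathcal R(w)(x,t)=\mathcal R^x(w)(t)$, and $$\mathcal U(u)(t)=\int_{\underline x}^{\overline x}u(x,t)\,dx,\qquad \mathcal P(u,w)(t)=\int_{\underline x}^{\overline x}u(x,t)\,\mathcal R^x(w)(t)\,dx.$$ State. For an input $w$ the state at time $t$ is $A(t)=\{x\in[\underline x,\overline x]:\mathcal R^x(w)(t)=1\}$. $A(t)$ is simple if it is a union of finitely many (possibly zero) disjoint intervals $[x_k^-,x_k^+]$. $A(0)$ satisfies the compatibility condition if $[\underline x,w(0)]\cap[\underline x,\overline x]\subset A(0)$ when $w(0)\ge\underline x$, and $[\underline x,-w(0))\cap A(0)=\varnothing$ when $w(0)<-\underline x$. (The state $A(0)$ depends only on $w(0)=w_0$ and $r_0$.) Problem (P), with unknowns $u(x,t)$, $v(t)$, $w(t)$: $$u_t=u_{xx}+\left(\tfrac12+w\,\mathcal R(w)\right)v\,u,\qquad \dot v=-\left(\tfrac12\mathcal U(u)+w\,\mathcal P(u,w)\right)v,\qquad \dot w=-\left(\tfrac12+w\right)\left(\tfrac12-w\right)\mathcal P(u,w),$$ $$u_x|_{x=\underline x}=u_x|_{x=\overline x}=0,\qquad u(x,0)=u_0(x),\quad v(0)=v_0,\quad w(0)=w_0.$$ A (strong) solution of (P) on $(0,T)$ is a triple $(u,v,w)\in W_2^{2,1}(Q_T)\times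 C^1[0,T]\times C^1[0,T]$ such that $u$ satisfies the first equation a.e. in $Q_T$ and its boundary and initial conditions in the sense of traces, and $v,w$ satisfy their equations and initial conditions in the classical sense. For initial data with $u_0\ge0$, $v_0\ge 0$, $|w_0|\le1/2$ and $A(0)$ simple and compatible, such a solution exists and is unique for every $T>0$; the solution on $[0,\infty)$ is the triple whose restriction to each $(0,T)$ is this solution. *)

(* Defs.v *)
From HB Require Import structures.
From mathcomp Require Import all_boot all_order all_algebra.
From mathcomp Require Import all_classical all_reals all_analysis.

Set Implicit Arguments.
Unset Strict Implicit.
Unset Printing Implicit Defensive.
Import Order.TTheory GRing.Theory Num.Theory.
Import numFieldNormedType.Exports.
Local Open Scope classical_set_scope.
Local Open Scope ring_scope.

Notation leb2 R := (@lebesgue_measure R \x @lebesgue_measure R)%E.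

Definition L2 (d : measure_display) (X : measurableType d) (R : realType)
    (mu : set X -> \bar R) (D : set X) (f : X -> R) : Prop :=
  measurable_fun D f /\ (\int[mu]_(z in D) ((f z ^+ 2)%:E) < +oo)%E.

Definition cvg_L2 (d : measure_display) (X : measurableType d) (R : realType)
    (mu : set X -> \bar R) (D : set X) (f_ : nat -> X -> R) (f : X -> R) : Prop :=
  (fun n => \int[mu]_(z in D) (((f_ n z - f z) ^+ 2)%:E))%E @ \oo --> 0%E.

(* C^oo: every iterated directional derivative is Frechet differentiable. *)
Definition smooth (R : realType) (V : normedModType R) (f : V -> R) : Prop :=
  forall (s : seq V) (z : V),
    differentiable (foldr (fun v (g : V -> R) => 'D_v g) f s) z.

Definition test_function (R : realType) (V : normedModType R) (D : set V)
    (phi : V -> R) : Prop :=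
  smooth phi /\
  exists K : set V,
    [/\ compact K, K `<=` D & forall z, ~ K z -> phi z = 0].

Definition weak_deriv1 (R : realType) (D : set R) (f g : R -> R) : Prop :=
  forall phi : R -> R, test_function D phi ->
    \int[@lebesgue_measure R]_(x in D) (f x * 'D_1 phi x) =
    - \int[@lebesgue_measure R]_(x in D) (g x * phi x).

(* Weak derivative of f in the direction e, on a domain of the (x, t)-plane. *)
Definition weak_deriv2 (R : realType) (D : set (R * R)) (e : R * R)
    (f g : R * R -> R) : Prop :=
  forall phi : R * R -> R, test_function D phi ->
    \int[leb2 R]_(z in D) (f z * 'D_e phi z) =
    - \int[leb2 R]_(z in D) (g z * phi z).

Definition dir_x (R : realType) : R * R := (1, 0).
Definition dir_t (R : realType) : R * R := (0, 1).

Definition W12 (R : realType) (a b : R) (f : R -> R) : Prop :=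
  L2 (@lebesgue_measure R) `]a, b[ f /\
  exists2 g : R -> R, L2 (@lebesgue_measure R) `]a, b[ g & weak_deriv1 `]a, b[ f g.

Definition QT (R : realType) (a b T : R) : set (R * R) :=
  `]a, b[%classic `*` `]0, T[%classic.

(* u belongs to W_2^{2,1}(Q_T), with weak derivatives u_x, u_xx, u_t. *)
Definition W212 (R : realType) (a b T : R) (u ux uxx ut : R * R -> R) : Prop :=
  [/\ L2 (leb2 R) (QT a b T) u,
      L2 (leb2 R) (QT a b T) ux /\ weak_deriv2 (QT a b T) (dir_x R) u ux,
      L2 (leb2 R) (QT a b T) uxx /\ weak_deriv2 (QT a b T) (dir_x R) ux uxx &
      L2 (leb2 R) (QT a b T) ut /\ weak_deriv2 (QT a b T) (dir_t R) u ut].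

(* g is the trace of p on the side {x0} x (0, T) of Q_T (x0 = a or x0 = b),
   where p and its weak derivative px belong to L_2(Q_T): the trace operator is
   the extension by continuity, from the functions smooth up to the boundary,
   of the restriction to that side. *)
Definition side_trace (R : realType) (a b T x0 : R) (p px : R * R -> R)
    (g : R -> R) : Prop :=
  exists phi_ : nat -> R * R -> R,
    [/\ forall n, smooth (phi_ n),
        cvg_L2 (leb2 R) (QT a b T) phi_ p,
        cvg_L2 (leb2 R) (QT a b T) (fun n => 'D_(dir_x R) (phi_ n)) px &
        cvg_L2 (@lebesgue_measure R) `]0, T[ (fun n t => phi_ n (x0, t)) g].

(* The derivative is one-sided at the end points 0 and T. *)
Definition C1_with_deriv (R : realType) (T : R) (f df : R -> R) : Prop :=
  {within `[0, T], continuous df} /\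
  forall t, t \in `[0, T] ->
    (fun s => (f s - f t) / (s - t)) @ within `[0, T] t^' --> df t.

(* For a continuous w and 0 < x the two tested cases exclude each other, and
   together they fail exactly when -x <= w < x on [0, t]. *)
Definition relay (R : realType) (r0 : R -> R) (w : R -> R) (x t : R) : R :=
  if `[< exists2 tau, tau \in `[0, t] &
           w tau < - x /\ forall s, s \in `[tau, t] -> w s < x >] then -1
  else if `[< exists2 tau, tau \in `[0, t] &
           x <= w tau /\ forall s, s \in `[tau, t] -> - x <= w s >] then 1
  else r0 x.

Definition totalU (R : realType) (a b : R) (u : R * R -> R) (t : R) : R :=
  \int[@lebesgue_measure R]_(x in `[a, b]) u (x, t).

Definition preisachP (R : realType) (a b : R) (r0 : R -> R) (u : R * R -> R)
    (w : R -> R) (t : R) : R :=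
  \int[@lebesgue_measure R]_(x in `[a, b]) (u (x, t) * relay r0 w x t).

Definition state (R : realType) (a b : R) (r0 w : R -> R) (t : R) : set R :=
  [set x | x \in `[a, b] /\ relay r0 w x t = 1].

(* Degenerate intervals [x, x] are allowed. *)
Definition simple_state (R : realType) (A : set R) : Prop :=
  exists (n : nat) (xm xp : 'I_n -> R),
    [/\ forall k, xm k <= xp k,
        trivIset [set: 'I_n] (fun k => `[xm k, xp k]%classic) &
        A = \bigcup_(k in [set: 'I_n]) `[xm k, xp k]%classic].

Definition compatible (R : realType) (a b w0 : R) (A : set R) : Prop :=
  (a <= w0 -> `[a, w0] `&` `[a, b] `<=` A) /\
  (w0 < - a -> `[a, - w0[ `&` A = set0).

(* u is the representative continuous on the closure of Q_T; its trace at t = 0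
   is then its restriction to {t = 0}. *)
Definition strong_solution (R : realType) (a b : R) (r0 u0 : R -> R) (v0 w0 T : R)
    (u : R * R -> R) (v w : R -> R) : Prop :=
  {within `[a, b] `*` `[0, T], continuous u} /\
  (exists ux uxx ut : R * R -> R,
    [/\ W212 a b T u ux uxx ut,
        {ae leb2 R, forall z, QT a b T z ->
           ut z = uxx z + (2^-1 + w z.2 * relay r0 w z.1 z.2) * v z.2 * u z},
        side_trace a b T a ux uxx (cst 0) &
        side_trace a b T b ux uxx (cst 0)]) /\
  {ae @lebesgue_measure R, forall x, x \in `]a, b[ -> u (x, 0) = u0 x} /\
  C1_with_deriv T v
    (fun t => - (2^-1 * totalU a b u t + w t * preisachP a b r0 u w t) * v t) /\
  C1_with_deriv T w
    (fun t => - (2^-1 + w t) * (2^-1 - w t) * preisachP a b r0 u w t) /\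
  v 0 = v0 /\ w 0 = w0.

(* Main.v *)
Require Import Defs.
From HB Require Import structures.
From mathcomp Require Import all_boot all_order all_algebra.
From mathcomp Require Import all_classical all_reals all_analysis.
From mathcomp Require Import measurable_realfun.
From mathcomp Require Import ring lra.

Set Implicit Arguments.
Unset Strict Implicit.
Unset Printing Implicit Defensive.
Import Order.TTheory GRing.Theory Num.Theory.
Import numFieldNormedType.Exports.
Local Open Scope classical_set_scope.
Local Open Scope ring_scope.

(* The sum of [v] and the mass [U] of [u] is conserved.  A relay has the sign of
   its input [w] once [|w|] exceeds its threshold, and all thresholds are below
   [1/2], so that [1/2 + w R(w) >= 1/2 - b > 0]: the mass consumed per unit of time
   is at least [(1/2 - b) U(0) v], hence [v] is integrable and tends to [0].  If
   [u <= M] then the source of the heat equation for [u] is at most [M v], and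
   [u - (M / c) (v(t0) - v(t))] with [c = (1/2 - b) U(0)] is a subsolution of the
   Neumann heat equation, as is [- u].  The maximum principle bounds [u]; comparing
   [u(y, t) - u(x, t)] with [A exp (- l t) (4 L z - z^2)] at [z = y - x], where
   [L = b - a] (doubling of variables), shows that the oscillation of [u] in [x]
   tends to [0].  The limit is then determined by the conserved quantity.

   A strong solution enters only through the equation integrated over rectangles,
   which is enough for a maximum principle applied to averages in time. *)

Section interval_integrals.
Variable R : realType.
Notation mu := (@lebesgue_measure R).
Implicit Types (f g : R -> R) (s t x : R).

Lemma continuous_itv_integrable f s t : continuous f ->
  mu.-integrable `[s, t] (EFin \o f).
Proof.
move=> cf; apply: continuous_compact_integrable; first exact: segment_compact.
exact: continuous_subspaceT.
Qed.

Lemma Rintegral_itv_cat f s t r : s <= t -> t <= r ->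
  mu.-integrable `[s, r] (EFin \o f) ->
  \int[mu]_(x in `[s, r]) f x =
  \int[mu]_(x in `[s, t]) f x + \int[mu]_(x in `[t, r]) f x.
Proof.
move=> st tr fi.
have := @Rintegral_itvB R f (BLeft s) (BRight r) t fi.
rewrite !bnd_simp => /(_ st tr) H.
rewrite -(Rintegral_itv_obnd_cbnd (r := t)) -?H; first by rewrite addrC subrK.
apply: integrableS fi => //.
by apply: subset_itvr; rewrite bnd_simp.
Qed.

Lemma Rintegral_itv_cst (c : R) s t : s <= t ->
  \int[mu]_(x in `[s, t]) c = c * (t - s).
Proof.
move=> st; rewrite Rintegral_cst//= lebesgue_measure_itv/= lte_fin.
case: ltP => [_|ts]; first by rewrite -EFinB.
have -> : t = s by lra.
by rewrite subrr.
Qed.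

Lemma Rintegral_itv_le_cst f (c : R) s t : s <= t ->
  mu.-integrable `[s, t] (EFin \o f) ->
  (forall x, s <= x <= t -> f x <= c) ->
  \int[mu]_(x in `[s, t]) f x <= c * (t - s).
Proof.
move=> st fi fc; rewrite -Rintegral_itv_cst//; apply: le_Rintegral => //.
  by apply: continuous_itv_integrable => x; exact: cvg_cst.
Qed.

Lemma Rintegral_itv_ge_cst f (c : R) s t : s <= t ->
  mu.-integrable `[s, t] (EFin \o f) ->
  (forall x, s <= x <= t -> c <= f x) ->
  c * (t - s) <= \int[mu]_(x in `[s, t]) f x.
Proof.
move=> st fi fc; rewrite -Rintegral_itv_cst//; apply: le_Rintegral => //.
  by apply: continuous_itv_integrable => x; exact: cvg_cst.
Qed.

Lemma Rintegral_itv_norm_le f (c : R) s t : s <= t ->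
  mu.-integrable `[s, t] (EFin \o f) ->
  (forall x, s <= x <= t -> `|f x| <= c) ->
  `|\int[mu]_(x in `[s, t]) f x| <= c * (t - s).
Proof.
move=> st fi fc; rewrite ler_norml -mulNr.
rewrite Rintegral_itv_ge_cst ?Rintegral_itv_le_cst// => x /fc;
by rewrite ler_norml => /andP[].
Qed.

Lemma Rintegral_itv_affine (c d s t : R) : s <= t ->
  \int[mu]_(x in `[s, t]) (c + d * (x - s)) = c * (t - s) + d * (t - s) ^+ 2 / 2.
Proof.
rewrite le_eqVlt => /predU1P[->|st].
  by rewrite set_itv1 Rintegral_set1; ring.
pose F x : R := c * x + d * (x - s) ^+ 2 / 2.
have dF x : is_derive x 1 F (c + d * (x - s)).
  apply: is_derive_eq.
  by rewrite /GRing.scale/=; field.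
rewrite /Rintegral (@continuous_FTC2 _ _ F)//=.
- by rewrite /F; field.
- apply: continuous_subspaceT => x.
  apply: differentiable_continuous; exact/derivable1_diffP.
- split.
  + by move=> x _; exact: ex_derive.
  + apply: cvg_at_right_filter; apply: differentiable_continuous.
    by apply/derivable1_diffP; exact: ex_derive.
  + apply: cvg_at_left_filter; apply: differentiable_continuous.
    by apply/derivable1_diffP; exact: ex_derive.
- by move=> x _; rewrite derive1E derive_val.
Qed.

Lemma Rintegral_itv_FTC1 f c x : continuous f -> c < x ->
  is_derive x 1 (fun y => \int[mu]_(t in `[c, y]) f t) (f x).
Proof.
move=> cf cx.
have xx1 : x < x + 1 by lra.
have [d1 d2] := continuous_FTC1_closed xx1 (continuous_itv_integrable c _ cf) cx (cf x).
apply: (DeriveDef d1).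
by rewrite -derive1E d2.
Qed.

End interval_integrals.

Section steklov.
Variable R : realType.
Notation mu := (@lebesgue_measure R).
Implicit Types (p : R * R -> R) (a b c d e h s t x y : R).

Lemma cvg_to_pair (U V W : topologicalType) (F : set_system U) (f : U -> V)
    (g : U -> W) (x : V) (y : W) : Filter F ->
  f z @[z --> F] --> x -> g z @[z --> F] --> y -> (f z, g z) @[z --> F] --> (x, y).
Proof.
move=> FF fx gy A [[B C] /= [nB nC] BC].
have h1 : F [set z | B (f z)] := fx _ nB.
have h2 : F [set z | C (g z)] := gy _ nC.
apply: (@filterS _ F _ _ _ _ (filterI h1 h2)) => z [Bz Cz].
exact: (BC (f z, g z)).
Qed.

Lemma continuous_slice2 p x : continuous p -> continuous (fun t => p (x, t)).
Proof.
move=> cp t; apply: (@cvg_comp _ _ _ (fun t => (x, t)) p _ (nbhs (x, t))).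
  by apply: cvg_to_pair; [exact: cvg_cst|exact: cvg_id].
exact: cp.
Qed.

Lemma continuous_slice1 p t : continuous p -> continuous (fun x => p (x, t)).
Proof.
move=> cp x; apply: (@cvg_comp _ _ _ (fun x => (x, t)) p _ (nbhs (x, t))).
  by apply: cvg_to_pair; [exact: cvg_id|exact: cvg_cst].
exact: cp.
Qed.

Lemma near_prod (P : R -> Prop) (Q : R -> Prop) (z : R * R) :
  (\forall x \near z.1, P x) -> (\forall t \near z.2, Q t) ->
  \forall w \near z, P w.1 /\ Q w.2.
Proof. by move=> PP QQ; exists (P, Q) => //= w [/= ? ?]. Qed.

Lemma continuous_tube p x c d e : continuous p -> 0 < e ->
  \forall x' \near x, forall t, c <= t <= d -> `|p (x', t) - p (x, t)| < e.
Proof.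
move=> cp e0.
have := (compact_near_coveringP `[c, d]%classic).1 (@segment_compact R c d) _
  (nbhs x) (fun x' t => `|p (x', t) - p (x, t)| < e) _.
move=> H; suff K : forall t, `[c, d]%classic t ->
    \forall t' \near t & x' \near nbhs x, `|p (x', t') - p (x, t')| < e.
  apply: (@filterS _ (nbhs x) _ _ _ _ (H _ K)) => x' Hx' t tcd; apply: (Hx' t).
  by rewrite /= in_itv.
move=> t _.
have e2 : 0 < e / 2 by rewrite divr_gt0.
have /cvgrPdist_lt /(_ _ e2) := cp (x, t).
case=> -[A B] /= [nA nB] AB.
exists (B, A) => //= -[t' x'] /= [Bt' Ax'].
have h1 := AB (x', t') (conj Ax' Bt').
have h2 := AB (x, t') (conj (nbhs_singleton nA) Bt').
rewrite /= in h1 h2.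
rewrite (_ : p (x', t') - p (x, t') =
  (p (x, t) - p (x, t')) - (p (x, t) - p (x', t'))); last by ring.
by rewrite (le_lt_trans (ler_normB _ _))//; lra.
Qed.

Definition steklov p h (z : R * R) := \int[mu]_(t in `[z.2, z.2 + h]) p (z.1, t).

Lemma steklovB p h x t c : continuous p -> 0 < h -> c < t ->
  steklov p h (x, t) = \int[mu]_(s in `[c, t + h]) p (x, s)
                     - \int[mu]_(s in `[c, t]) p (x, s).
Proof.
move=> cp h0 ct; rewrite (@Rintegral_itv_cat _ _ c t (t + h)); [|lra|lra|].
  by rewrite addrC addKr.
exact/continuous_itv_integrable/continuous_slice2.
Qed.

Lemma is_derive_steklov p h x t : continuous p -> 0 < h ->
  is_derive t 1 (fun t => steklov p h (x, t)) (p (x, t + h) - p (x, t)).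
Proof.
move=> cp h0.
pose N y := \int[mu]_(s in `[t - 1, y]) p (x, s).
have dN y : t - 1 < y -> is_derive y 1 N (p (x, y)).
  by move=> ty; apply: Rintegral_itv_FTC1 => //; exact: continuous_slice2.
have d1 : is_derive t 1 N (p (x, t)) by apply: dN; lra.
have d2 : is_derive (t + h) 1 N (p (x, t + h)) by apply: dN; lra.
have d3 : is_derive t 1 (fun t => t + h) 1.
  by apply: is_derive_eq; rewrite addr0.
have d4 := @is_derive1_comp _ _ (fun t => t + h) t _ _ d2 d3.
have d5 : is_derive t 1 (fun t => N (t + h) - N t) (p (x, t + h) - p (x, t)).
  have := is_deriveB d4 d1; rewrite mulr1.
  by [].
apply: near_eq_is_derive d5.
near=> y; rewrite -steklovB //.
by near: y; apply: lt_nbhsr; lra.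
Unshelve. all: by end_near. Qed.

Lemma continuous_steklov p h : continuous p -> 0 < h -> continuous (steklov p h).
Proof.
move=> cp h0 [x t]; apply/cvgrPdist_lt => e e0.
have e2 : 0 < e / 2 by rewrite divr_gt0.
have c1 : {for t, continuous (fun t => steklov p h (x, t))}.
  apply: differentiable_continuous; apply/derivable1_diffP.
  exact: (@ex_derive _ _ _ _ _ _ _ (is_derive_steklov x t cp h0)).
have /cvgrPdist_lt /(_ _ e2) n1 := c1.
have e3 : 0 < e / 2 / h by rewrite divr_gt0.
have n2 := continuous_tube x (t - 1) (t + 1 + h) cp e3.
have n3 : \forall t' \near t, t - 1 < t' < t + 1.
  by near=> t'; apply/andP; split; near: t'; [apply: lt_nbhsr|apply: lt_nbhsl]; lra.
have n4 : \forall t' \near t, `|steklov p h (x, t) - steklov p h (x, t')| < e / 2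
   /\ t - 1 < t' < t + 1 by near=> t'; split; near: t'.
have := @near_prod _ _ (x, t) n2 n4.
apply: filterS => -[x' t'] /= [Hx [Ht /andP[t1 t2]]].
rewrite (_ : _ - _ = (steklov p h (x, t) - steklov p h (x, t')) -
   (steklov p h (x', t') - steklov p h (x, t'))); last by ring.
apply: (le_lt_trans (ler_normB _ _)).
suff : `|steklov p h (x', t') - steklov p h (x, t')| <= e / 2 by lra.
rewrite /steklov/= -RintegralB//; [|exact/continuous_itv_integrable/continuous_slice2..].
rewrite (_ : e / 2 = e / 2 / h * (t' + h - t')); last by field; rewrite gt_eqF.
apply: Rintegral_itv_norm_le; [lra| |].
  apply: continuous_itv_integrable => s.
  by apply: cvgB; exact: continuous_slice2.
by move=> s /andP[s1 s2]; apply/ltW/Hx; apply/andP; split; lra.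
Unshelve. all: by end_near. Qed.

Lemma steklov_approx p a b c d e : continuous p -> 0 < e ->
  \forall h \near (0:R)^'+, forall x t, a <= x <= b -> c <= t <= d ->
    `|steklov p h (x, t) - h * p (x, t)| <= e * h.
Proof.
move=> cp e0.
pose K := `[a, b]%classic `*` `[c, d]%classic.
have cK : compact K by apply: compact_setX; exact: segment_compact.
have H := (compact_near_coveringP K).1 cK R
  ((0:R)^'+) (fun h z => forall s, z.2 <= s <= z.2 + h ->
     `|p (z.1, s) - p z| < e) _.
suff L : forall z : R * R, K z -> \forall z' \near z & h \near (0:R)^'+, forall s,
    z'.2 <= s <= z'.2 + h -> `|p (z'.1, s) - p z'| < e.
  have L2 := H _ L; near=> h => x t xab tcd.
  have h0 : 0 < h by near: h; exact: nbhs_right_gt.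
  have Kxt : K (x, t) by split; rewrite /= in_itv.
  have : K `<=` (fun z => forall s, z.2 <= s <= z.2 + h ->
     `|p (z.1, s) - p z| < e) by near: h; exact: L2.
  move=> /(_ _ Kxt) /= M.
  have -> : h * p (x, t) = \int[mu]_(s in `[t, t + h]) p (x, t).
    by rewrite Rintegral_itv_cst; [ring|lra].
  rewrite /steklov/= -RintegralB//; last 2 first.
    exact/continuous_itv_integrable/continuous_slice2.
    by apply: continuous_itv_integrable => s; exact: cvg_cst.
  rewrite (_ : e * h = e * (t + h - t)); last by ring.
  apply: Rintegral_itv_norm_le; [lra| |].
    apply: continuous_itv_integrable => s.
    by apply: cvgB; [exact: continuous_slice2|exact: cvg_cst].
  by move=> s /M/ltW.
move=> [x t] _.
have e2 : 0 < e / 2 by rewrite divr_gt0.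
have /cvgrPdist_lt /(_ _ e2) := cp (x, t).
case=> -[A B] /= [nA nB] AB.
have /nbhs_ballP [r /= r0 rB] := nB.
have r2 : 0 < r / 2 by rewrite divr_gt0.
exists ((A `*` ball t (r / 2)), [set h | 0 < h < r / 2]) => /=.
  split.
    by exists (A, ball t (r / 2)) => //=; split => //; exact: nbhsx_ballx.
  near=> h; apply/andP; split; near: h; first exact: nbhs_right_gt.
  exact: nbhs_right_lt.
move=> [[x' t'] h] /= [[Ax' Bt'] /andP[h0 hr]] s /andP[s1 s2].
move: Bt'; rewrite /ball/= => Bt'.
have Bs : B s.
  apply: rB; rewrite /ball/=.
  rewrite (_ : t - s = (t - t') + (t' - s)); last by ring.
  apply: (le_lt_trans (ler_normD _ _)).
  suff : `|t' - s| <= r / 2 by lra.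
  by rewrite ler_norml; apply/andP; split; lra.
have Bt : B t' by apply: rB; rewrite /ball/=; lra.
have h1 := AB (x', s) (conj Ax' Bs).
have h2 := AB (x', t') (conj Ax' Bt).
rewrite /= in h1 h2.
rewrite (_ : p (x', s) - p (x', t') =
  (p (x, t) - p (x', t')) - (p (x, t) - p (x', s))); last by ring.
by rewrite (le_lt_trans (ler_normB _ _))//; lra.
Unshelve. all: by end_near. Qed.

Lemma derive_ge0_left_max (f : R -> R) (l t0 t : R) : t0 < t ->
  is_derive t 1 f l -> (forall s, t0 <= s <= t -> f s <= f t) -> 0 <= l.
Proof.
move=> t0t df fmax; rewrite leNgt; apply/negP => l0.
have [dd dl] := df.
have : h^-1 *: (f (h *: 1 + t) - f t) @[h --> 0^'] --> l.
  by rewrite -dl; exact: dd.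
move=> /cvgr_lt /(_ _ l0) [r /= r0 H].
pose h := Num.min (r / 2) (t - t0).
have h0 : 0 < h by rewrite lt_min; apply/andP; split; lra.
have hr : h <= r / 2 by rewrite ge_min lexx.
have ht : h <= t - t0 by rewrite ge_min lexx orbT.
have := H (- h); rewrite /ball_/= sub0r normrN normrN gtr0_norm//.
have hr' : h < r by lra.
have hn : - h != 0 by rewrite oppr_eq0 gt_eqF.
move=> /(_ hr' hn); rewrite scaler1 /GRing.scale/= invrN mulNr oppr_lt0 => H1.
have : f (- h + t) <= f t by apply: fmax; apply/andP; split; lra.
rewrite -subr_le0 => H2.
have h1 : 0 < h^-1 by rewrite invr_gt0.
by move: H1; rewrite ltNge pmulr_rle0// H2.
Qed.

End steklov.

Section max_principle.
Variable R : realType.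
Notation mu := (@lebesgue_measure R).
Implicit Types (p : R * R -> R) (a b c d e h s t x y k : R).

(* The integrated form of [p_t <= p_xx] with Neumann conditions: second
   differences of the time integral of [p] are bounded below by the increment
   of [p]; the last two clauses are the second differences of the even
   reflection of [p] at the end points. *)
Definition subheat a b t0 t1 p := forall s t, t0 <= s -> s < t -> t <= t1 ->
  forall x r m, a <= x <= b -> 0 < r ->
  (forall y, a <= y <= b -> `|y - x| <= r -> m <= p (y, t) - p (y, s)) ->
  let I y := \int[mu]_(tau in `[s, t]) p (y, tau) in
  [/\ a <= x - r -> x + r <= b -> r ^+ 2 * m <= I (x + r) + I (x - r) - 2 * I x,
      x = a -> a + r <= b -> r ^+ 2 * m / 2 <= I (a + r) - I a &
      x = b -> a <= b - r -> r ^+ 2 * m / 2 <= I (b - r) - I b].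

Lemma sqr_radius (r m A : R) : 0 < r -> r ^+ 2 * m <= A -> A <= 0 -> m <= 0.
Proof.
move=> r0 h1 h2; have : r ^+ 2 * m <= 0 by exact: le_trans h1 h2.
by rewrite pmulr_rle0// exprn_gt0.
Qed.

Lemma subheat_argmax a b t0 t1 p s t x r1 m : a < b -> subheat a b t0 t1 p ->
  t0 <= s -> s < t -> t <= t1 -> a <= x <= b -> 0 < r1 ->
  (forall y, a <= y <= b -> `|y - x| < r1 -> m <= p (y, t) - p (y, s)) ->
  (forall y, a <= y <= b -> \int[mu]_(tau in `[s, t]) p (y, tau) <=
                           \int[mu]_(tau in `[s, t]) p (x, tau)) ->
  m <= 0.
Proof.
move=> ab sp t0s st tt1 xab r10 lowm.
set I := fun y => \int[mu]_(tau in `[s, t]) p (y, tau).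
rewrite -/(I x) => Imax.
have HH r : 0 < r -> r < r1 -> [/\
    a <= x - r -> x + r <= b -> r ^+ 2 * m <= I (x + r) + I (x - r) - 2 * I x,
    x = a -> a + r <= b -> r ^+ 2 * m / 2 <= I (a + r) - I a &
    x = b -> a <= b - r -> r ^+ 2 * m / 2 <= I (b - r) - I b].
  move=> r0 rr; apply: (sp s t t0s st tt1 x r m xab r0) => y yab yr.
  by apply: lowm => //; exact: le_lt_trans rr.
have {}Imax y : a <= y -> y <= b -> I y <= I x.
  by move=> y1 y2; apply: Imax; rewrite y1 y2.
move: I HH Imax => I HH Imax {lowm sp t0s st tt1}.
have [xa|xa] := eqVneq x a.
  pose r := Num.min (r1 / 2) (b - a).
  have r0 : 0 < r by rewrite lt_min; apply/andP; split; lra.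
  have rr : r <= r1 / 2 by rewrite ge_min lexx.
  have rb : r <= b - a by rewrite ge_min lexx orbT.
  have rr1 : r < r1 by lra.
  have [_ /(_ xa) H _] := HH r r0 rr1.
  have := Imax (a + r); rewrite xa => H2.
  have ar : a <= a + r by lra.
  have arb : a + r <= b by lra.
  have {}H := H arb; have {}H2 := H2 ar arb.
  by apply: (@sqr_radius r m (2 * (I (a + r) - I a)) r0); lra.
have [xb|xb] := eqVneq x b.
  pose r := Num.min (r1 / 2) (b - a).
  have r0 : 0 < r by rewrite lt_min; apply/andP; split; lra.
  have rr : r <= r1 / 2 by rewrite ge_min lexx.
  have rb : r <= b - a by rewrite ge_min lexx orbT.
  have rr1 : r < r1 by lra.
  have [_ _ /(_ xb) H] := HH r r0 rr1.
  have := Imax (b - r); rewrite xb => H2.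
  have ar : a <= b - r by lra.
  have arb : b - r <= b by lra.
  have {}H := H ar; have {}H2 := H2 ar arb.
  by apply: (@sqr_radius r m (2 * (I (b - r) - I b)) r0); lra.
move/andP: (xab) => [am mb].
have {}am : a < x by rewrite lt_neqAle eq_sym xa.
have {}mb : x < b by rewrite lt_neqAle xb.
pose r := Num.min (r1 / 2) (Num.min (x - a) (b - x)).
have r0 : 0 < r by rewrite !lt_min; apply/and3P; split; lra.
have rr : r <= r1 / 2 by rewrite ge_min lexx.
have ra : r <= x - a by rewrite !ge_min lexx orbT.
have rb : r <= b - x by rewrite !ge_min lexx !orbT.
have rr1 : r < r1 by lra.
have [H _ _] := HH r r0 rr1.
have e1 : a <= x - r by lra.
have e2 : x + r <= b by lra.
have e3 : x - r <= b by lra.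
have e4 : a <= x + r by lra.
have {}H := H e1 e2.
have H1 := Imax _ e1 e3; have H2 := Imax _ e4 e2.
by apply: (sqr_radius r0 H); lra.
Qed.

Lemma subheat_max a b t0 t1 p k : a < b -> continuous p -> subheat a b t0 t1 p ->
  (forall x, a <= x <= b -> p (x, t0) <= k) ->
  forall x t, a <= x <= b -> t0 <= t < t1 -> p (x, t) <= k.
Proof.
move=> ab cp sp pk x1 t2 x1ab /andP[t02 t21]; rewrite leNgt; apply/negP => kp.
pose D := (p (x1, t2) - k) / 4.
have D0 : 0 < D by rewrite /D; lra.
have tt : t0 < t2.
  rewrite lt_neqAle t02 andbT; apply/eqP => E.
  by move: kp; rewrite -E ltNge pk.
pose et := D / (t2 - t0).
have et0 : 0 < et by rewrite /et divr_gt0// subr_gt0.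
near (0:R)^'+ => h.
have h0 : 0 < h by near: h; exact: nbhs_right_gt.
have hlt : h < t1 - t2 by near: h; apply: nbhs_right_lt; lra.
have app : forall x t, a <= x <= b -> t0 <= t <= t2 ->
    `|steklov p h (x, t) - h * p (x, t)| <= D * h.
  by near: h; exact: steklov_approx.
pose F z := steklov p h z - h * et * (z.2 - t0).
have cF : continuous F.
  move=> z; apply: cvgB; first exact: continuous_steklov.
  apply: cvgM; first exact: cvg_cst.
  by apply: cvgB; [exact: cvg_snd|exact: cvg_cst].
pose K := `[a, b]%classic `*` `[t0, t2]%classic.
have [|||[xm tm]] := @compact_EVT_max _ R F K.
- by exists (x1, t2); split; rewrite /= in_itv/= ?x1ab ?lexx ?t02.
- by apply: compact_setX; exact: segment_compact.
- exact: continuous_subspaceT.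
rewrite inE => -[/=]; rewrite !in_itv/= => xmab /andP[t0m tm2] Fmax.
have {}Fmax x t : a <= x <= b -> t0 <= t <= t2 -> F (x, t) <= F (xm, tm).
  by move=> xab t02'; apply: Fmax; rewrite inE; split; rewrite /= in_itv.
have tm0 : t0 < tm.
  rewrite lt_neqAle t0m andbT; apply/eqP => E.
  have := Fmax x1 t2 x1ab; rewrite t02 lexx => /(_ isT).
  have := app _ _ xmab; rewrite -E => /(_ t0); rewrite lexx t02 => /(_ isT).
  have := app _ _ x1ab => /(_ t2); rewrite lexx t02 => /(_ isT).
  rewrite !ler_norml => /andP[A1 _] /andP[_ A2].
  rewrite /F/= subrr mulr0 subr0 => A3.
  have A4 := pk _ xmab.
  have E2 : h * et * (t2 - t0) = h * D.
    by rewrite /et; field; lra.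
  have A5 : h * p (xm, t0) <= h * k by rewrite ler_pM2l.
  have A6 : h * (p (x1, t2) - k) = 4 * (h * D) by rewrite /D; field.
  have A7 : 0 < h * D by rewrite mulr_gt0.
  lra.
have dm : h * et <= p (xm, tm + h) - p (xm, tm).
  rewrite -subr_ge0.
  apply: (@derive_ge0_left_max _ (fun t => F (xm, t)) _ t0 tm tm0); last first.
    by move=> s /andP[s1 s2]; apply: Fmax => //; apply/andP; split; lra.
  rewrite /F/=.
  have H1 := is_derive_steklov xm tm cp h0.
  apply: is_derive_eq; rewrite /GRing.scale/=; ring.
have het0 : 0 < h * et by rewrite mulr_gt0.
pose m : R := h * et / 2.
have mlt : m < p (xm, tm + h) - p (xm, tm) by rewrite /m; lra.
have m0 : 0 < m by rewrite divr_gt0// mulr_gt0.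
have : \forall y \near xm, m < p (y, tm + h) - p (y, tm).
  have c1 : {for xm, continuous (fun y => p (y, tm + h) - p (y, tm))}.
    by apply: cvgB; exact: continuous_slice1.
  by have /cvgr_gt := c1; apply.
move=> /nbhs_ballP [r1 /= r10 r1P].
have th : tm < tm + h by lra.
have th1 : tm + h <= t1 by lra.
suff : m <= 0 by rewrite leNgt m0.
apply: (subheat_argmax ab sp t0m th th1 xmab r10).
  by move=> y yab yr; apply/ltW/r1P; rewrite /ball/= distrC.
move=> x xab; have := Fmax x tm xab; rewrite t0m tm2 => /(_ isT).
by rewrite /F/= lerD2r.
Unshelve. all: by end_near. Qed.

Lemma doubling_argmax a b t0 t1 p1 p2 s t x y r1 m1 m2 B : a < b ->
  subheat a b t0 t1 p1 -> subheat a b t0 t1 p2 ->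
  t0 <= s -> s < t -> t <= t1 -> a <= x -> x < y -> y <= b -> 0 < r1 -> 0 < B ->
  (forall z, a <= z <= b -> `|z - y| < r1 -> m1 <= p1 (z, t) - p1 (z, s)) ->
  (forall z, a <= z <= b -> `|z - x| < r1 -> m2 <= p2 (z, t) - p2 (z, s)) ->
  (forall x' y', a <= x' -> x' <= y' -> y' <= b ->
     \int[mu]_(tau in `[s, t]) p1 (y', tau) + \int[mu]_(tau in `[s, t]) p2 (x', tau)
       - B * (4 * (b - a) * (y' - x') - (y' - x') ^+ 2) <=
     \int[mu]_(tau in `[s, t]) p1 (y, tau) + \int[mu]_(tau in `[s, t]) p2 (x, tau)
       - B * (4 * (b - a) * (y - x) - (y - x) ^+ 2)) ->
  m1 + m2 <= - 8 * B.
Proof.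
move=> ab sp1 sp2 t0s st tt1 ax xy yb r10 B0 low1 low2.
set I1 := fun y => \int[mu]_(tau in `[s, t]) p1 (y, tau).
set I2 := fun y => \int[mu]_(tau in `[s, t]) p2 (y, tau).
rewrite -/(I1 y) -/(I2 x) => Imax.
have xab : a <= x <= b by apply/andP; split; lra.
have yab : a <= y <= b by apply/andP; split; lra.
have H1 r : 0 < r -> r < r1 -> [/\
    a <= y - r -> y + r <= b -> r ^+ 2 * m1 <= I1 (y + r) + I1 (y - r) - 2 * I1 y,
    y = a -> a + r <= b -> r ^+ 2 * m1 / 2 <= I1 (a + r) - I1 a &
    y = b -> a <= b - r -> r ^+ 2 * m1 / 2 <= I1 (b - r) - I1 b].
  move=> r0 rr; apply: (sp1 s t t0s st tt1 y r m1 yab r0) => z zab zr.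
  by apply: low1 => //; exact: le_lt_trans rr.
have H2 r : 0 < r -> r < r1 -> [/\
    a <= x - r -> x + r <= b -> r ^+ 2 * m2 <= I2 (x + r) + I2 (x - r) - 2 * I2 x,
    x = a -> a + r <= b -> r ^+ 2 * m2 / 2 <= I2 (a + r) - I2 a &
    x = b -> a <= b - r -> r ^+ 2 * m2 / 2 <= I2 (b - r) - I2 b].
  move=> r0 rr; apply: (sp2 s t t0s st tt1 x r m2 xab r0) => z zab zr.
  by apply: low2 => //; exact: le_lt_trans rr.
have {}Imax x' y' : a <= x' -> x' <= y' -> y' <= b ->
    I1 y' + I2 x' - B * (4 * (b - a) * (y' - x') - (y' - x') ^+ 2) <=
    I1 y + I2 x - B * (4 * (b - a) * (y - x) - (y - x) ^+ 2) by exact: Imax.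
move: I1 I2 H1 H2 Imax => I1 I2 H1 H2 Imax {low1 low2 sp1 sp2 t0s st tt1 xab yab}.
(* At an end point the first-order term [B (4 (b - a) - 2 (y - x)) >= 2 B (b - a)]
   of the quadratic would have to be compensated by a term of order [r ^+ 2]. *)
have bdry (m D : R) (r := Num.min (Num.min (r1 / 2) (y - x))
    (B * (b - a) / (`|m| + 1))) : r ^+ 2 * m / 2 <= D ->
    D <= B * (- 4 * (b - a) * r + 2 * (y - x) * r - r ^+ 2) -> False.
  have n0 : 0 < `|m| + 1 by have := normr_ge0 m; lra.
  have Bab : 0 < B * (b - a) by rewrite mulr_gt0// subr_gt0.
  have r0 : 0 < r.
    by rewrite !lt_min; apply/andP; split; [apply/andP; split; lra|rewrite divr_gt0].
  have r3 : r * (`|m| + 1) <= B * (b - a).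
    by rewrite -ler_pdivlMr// ge_min lexx orbT.
  have mm : - `|m| <= m by have := ler_norm (- m); rewrite normrN; lra.
  have rm : - (B * (b - a)) <= r * m.
    have : r * (- `|m|) <= r * m by rewrite ler_pM2l.
    by rewrite mulrN => ?; move: r3; rewrite mulrDr; lra.
  move=> e1 e2.
  have e3 : B * (- 4 * (b - a) * r + 2 * (y - x) * r - r ^+ 2) <=
      r * (- 2 * (B * (b - a))).
    rewrite -subr_ge0.
    have -> : r * (- 2 * (B * (b - a))) -
        B * (- 4 * (b - a) * r + 2 * (y - x) * r - r ^+ 2) =
        B * r * (2 * ((b - y) + (x - a)) + r) by ring.
    by rewrite mulr_ge0 ?mulr_ge0// ?ltW//; lra.
  have e4 : r * (r * m / 2) <= r * (- 2 * (B * (b - a))).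
    apply: le_trans e3; apply: le_trans e2; apply: le_trans e1.
    by rewrite expr2 !mulrA.
  move: e4; rewrite ler_pM2l//; lra.
have rP (m : R) (r := Num.min (Num.min (r1 / 2) (y - x)) (B * (b - a) / (`|m| + 1))) :
    [/\ 0 < r, r < r1 & r <= y - x].
  have n0 : 0 < `|m| + 1 by have := normr_ge0 m; lra.
  have Bab : 0 < B * (b - a) by rewrite mulr_gt0// subr_gt0.
  have r2 : r <= r1 / 2 by rewrite !ge_min lexx.
  split; last 2 first.
  - lra.
  - by rewrite !ge_min lexx orbT.
  by rewrite !lt_min; apply/andP; split; [apply/andP; split; lra|rewrite divr_gt0].
have [yb'|yb'] := eqVneq y b.
  exfalso; move: (bdry m1) (rP m1) => /=.
  set r := Num.min _ _ => bd [r0 rr ry].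
  have [_ _ /(_ yb') H] := H1 r r0 rr.
  have abr : a <= b - r by lra.
  apply: (bd _ (H abr)).
  have xbr : x <= b - r by lra.
  have brb : b - r <= b by lra.
  have := Imax x (b - r) ax xbr brb.
  rewrite {1}yb' => e1; rewrite -subr_ge0; move: e1; rewrite -subr_ge0.
  by congr (0 <= _); rewrite yb'; ring.
have [xa'|xa'] := eqVneq x a.
  exfalso; move: (bdry m2) (rP m2) => /=.
  set r := Num.min _ _ => bd [r0 rr ry].
  have [_ /(_ xa') H _] := H2 r r0 rr.
  have abr : a + r <= b by lra.
  apply: (bd _ (H abr)).
  have aar : a <= a + r by lra.
  have ary : a + r <= y by lra.
  have := Imax (a + r) y aar ary yb.
  rewrite -subr_ge0 => e1; rewrite -subr_ge0; move: e1.
  by congr (0 <= _); rewrite xa'; ring.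
have {}ax : a < x by rewrite lt_neqAle eq_sym xa'.
have {}yb : y < b by rewrite lt_neqAle yb'.
pose r := Num.min (Num.min (r1 / 2) ((y - x) / 2)) (Num.min (x - a) (b - y)).
have r0 : 0 < r by rewrite !lt_min; apply/andP; split; apply/andP; split; lra.
have rr : r <= r1 / 2 by rewrite !ge_min lexx.
have rxy : r <= (y - x) / 2 by rewrite !ge_min lexx orbT.
have ra : r <= x - a by rewrite !ge_min lexx !orbT.
have rb : r <= b - y by rewrite !ge_min lexx !orbT.
have rr1 : r < r1 by lra.
have [h1 _ _] := H1 r r0 rr1.
have [h2 _ _] := H2 r r0 rr1.
have h1a : a <= y - r by lra.
have h1b : y + r <= b by lra.
have h2a : a <= x - r by lra.
have h2b : x + r <= b by lra.
have {}h1 := h1 h1a h1b.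
have {}h2 := h2 h2a h2b.
have o1 : x - r <= y + r by lra.
have o2 : x + r <= y - r by lra.
have o3 : a <= x + r by lra.
have o4 : y - r <= b by lra.
have k1 := Imax _ _ h2a o1 h1b.
have k2 := Imax _ _ o3 o2 o4.
suff : r ^+ 2 * (m1 + m2 + 8 * B) <= 0.
  by rewrite pmulr_rle0 ?exprn_gt0// => ?; lra.
have := lerD (lerD k1 k2) (lerD h1 h2).
clear; move=> h; rewrite -subr_ge0 in h; rewrite -subr_ge0; move: h.
by congr (0 <= _); ring.
Qed.

Lemma subheat_doubling a b t0 t1 p1 p2 A e (l := 8 / (3 * (b - a) ^+ 2))
    (psi := fun z t => e + A * expR (- l * (t - t0)) * (4 * (b - a) * z - z ^+ 2)) :
  a < b -> 0 < A -> 0 < e -> continuous p1 -> continuous p2 ->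
  subheat a b t0 t1 p1 -> subheat a b t0 t1 p2 ->
  (forall x y, a <= x -> x <= y -> y <= b -> p1 (y, t0) + p2 (x, t0) <= psi (y - x) t0) ->
  (forall x t, a <= x <= b -> t0 <= t -> p1 (x, t) + p2 (x, t) <= 0) ->
  forall x y t, a <= x -> x <= y -> y <= b -> t0 <= t < t1 ->
  p1 (y, t) + p2 (x, t) <= psi (y - x) t.
Proof.
move=> ab A0 e0 cp1 cp2 sp1 sp2 init diag x1 y1 t2 ax1 xy1 yb1 /andP[t02 t21].
rewrite leNgt; apply/negP => viol.
pose D := (p1 (y1, t2) + p2 (x1, t2) - psi (y1 - x1) t2) / 4.
have D0 : 0 < D by rewrite /D; lra.
have tt : t0 < t2.
  rewrite lt_neqAle t02 andbT; apply/eqP => E.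
  by move: viol; rewrite -E ltNge init.
pose et := D / (t2 - t0).
have et0 : 0 < et by rewrite /et divr_gt0// subr_gt0.
have D2 : 0 < D / 2 by lra.
near (0:R)^'+ => h.
have h0 : 0 < h by near: h; exact: nbhs_right_gt.
have hlt : h < t1 - t2 by near: h; apply: nbhs_right_lt; lra.
have app1 : forall x t, a <= x <= b -> t0 <= t <= t2 ->
    `|steklov p1 h (x, t) - h * p1 (x, t)| <= D / 2 * h.
  by near: h; exact: steklov_approx.
have app2 : forall x t, a <= x <= b -> t0 <= t <= t2 ->
    `|steklov p2 h (x, t) - h * p2 (x, t)| <= D / 2 * h.
  by near: h; exact: steklov_approx.
pose F (z : (R * R) * R) := steklov p1 h (z.1.2, z.2) + steklov p2 h (z.1.1, z.2)
  - h * psi (z.1.2 - z.1.1) z.2 - h * et * (z.2 - t0).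
have cF : continuous F.
  move=> z.
  have c11 : (fun z : (R * R) * R => z.1.1) @ z --> z.1.1.
    by apply: (@cvg_comp _ _ _ fst fst _ (nbhs z.1)); exact: cvg_fst.
  have c12 : (fun z : (R * R) * R => z.1.2) @ z --> z.1.2.
    by apply: (@cvg_comp _ _ _ fst snd _ (nbhs z.1)); [exact: cvg_fst|exact: cvg_snd].
  have c2 : (fun z : (R * R) * R => z.2) @ z --> z.2 by exact: cvg_snd.
  have cz : (fun z : (R * R) * R => z.1.2 - z.1.1) @ z --> z.1.2 - z.1.1.
    exact: cvgB.
  have ct : (fun z : (R * R) * R => z.2 - t0) @ z --> z.2 - t0.
    by apply: cvgB => //; exact: cvg_cst.
  apply: cvgB; [apply: cvgB; [apply: cvgD|]|].
  - apply: (@cvg_comp _ _ _ (fun z : (R * R) * R => (z.1.2, z.2)) _ _ (nbhs (z.1.2, z.2))).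
      exact: cvg_to_pair.
    exact: continuous_steklov.
  - apply: (@cvg_comp _ _ _ (fun z : (R * R) * R => (z.1.1, z.2)) _ _ (nbhs (z.1.1, z.2))).
      exact: cvg_to_pair.
    exact: continuous_steklov.
  - apply: cvgM; first exact: cvg_cst.
    apply: cvgD; first exact: cvg_cst.
    apply: cvgM.
      apply: cvgM; first exact: cvg_cst.
      apply: (@cvg_comp _ _ _ _ (@expR R) _ (nbhs (- l * (z.2 - t0)))).
        by apply: cvgM => //; exact: cvg_cst.
      exact: continuous_expR.
    apply: cvgB; first by apply: cvgM => //; exact: cvg_cst.
    by rewrite expr2; under eq_fun do rewrite expr2; exact: cvgM.
  - by apply: cvgM => //; exact: cvg_cst.
pose K : set ((R * R) * R) := ((`[a, b]%classic `*` `[a, b]%classic) `*`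
  `[t0, t2]%classic) `&` [set z | z.1.1 <= z.1.2].
have [|||[[xm ym] tm]] := @compact_EVT_max _ R F K.
- exists ((x1, y1), t2); split => //.
  by split; [split|]; rewrite /= in_itv/=; apply/andP; split => //; lra.
- apply: compact_closedI.
    apply: compact_setX; last exact: segment_compact.
    by apply: compact_setX; exact: segment_compact.
  rewrite (_ : [set _ | _] = (fun z : (R * R) * R => z.1.2 - z.1.1) @^-1` [set x | 0 <= x]).
    apply: closed_comp; last exact: closed_ge.
    move=> z _; apply: cvgB.
      by apply: (@cvg_comp _ _ _ fst snd _ (nbhs z.1)); [exact: cvg_fst|exact: cvg_snd].
    by apply: (@cvg_comp _ _ _ fst fst _ (nbhs z.1)); exact: cvg_fst.
  by apply/seteqP; split => z /=; rewrite subr_ge0.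
- exact: continuous_subspaceT.
rewrite inE => -[[[]]] /=; rewrite !in_itv/=.
move=> /andP[axm xmb] /andP[aym ymb] /andP[t0m tm2] xym Fmax.
have {}Fmax x y t : a <= x -> x <= y -> y <= b -> t0 <= t -> t <= t2 ->
    F ((x, y), t) <= F ((xm, ym), tm).
  move=> h1 h2 h3 h4 h5; apply: Fmax; rewrite inE; split => //.
  by split; [split|]; rewrite /= in_itv/=; apply/andP; split => //; lra.
have hD : 0 < h * D by rewrite mulr_gt0.
have Fub x y t : a <= x -> x <= y -> y <= b -> t0 <= t -> t <= t2 ->
    `|F ((x, y), t) - (h * (p1 (y, t) + p2 (x, t) - psi (y - x) t) - h * et * (t - t0))|
    <= h * D.
  move=> h1 h2 h3 h4 h5.
  have xab : a <= x <= b by apply/andP; split; [|exact: le_trans h3].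
  have yab : a <= y <= b by apply/andP; split; [exact: le_trans h2|].
  have tt' : t0 <= t <= t2 by rewrite h4 h5.
  have q1 := app1 _ _ yab tt'; have q2 := app2 _ _ xab tt'.
  rewrite /F/=.
  have -> : steklov p1 h (y, t) + steklov p2 h (x, t) - h * psi (y - x) t
      - h * et * (t - t0) - (h * (p1 (y, t) + p2 (x, t) - psi (y - x) t)
      - h * et * (t - t0)) = (steklov p1 h (y, t) - h * p1 (y, t)) +
      (steklov p2 h (x, t) - h * p2 (x, t)) by ring.
  apply: (le_trans (ler_normD _ _)); apply: (le_trans (lerD q1 q2)).
  by rewrite -mulrDl -splitr mulrC.
have Flow : 2 * (h * D) <= F ((xm, ym), tm).
  apply: le_trans (Fmax x1 y1 t2 ax1 xy1 yb1 t02 (lexx _)).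
  have := Fub x1 y1 t2 ax1 xy1 yb1 t02 (lexx _).
  have -> : h * (p1 (y1, t2) + p2 (x1, t2) - psi (y1 - x1) t2) - h * et * (t2 - t0)
    = 3 * (h * D) by rewrite /et /D; field; rewrite subr_eq0 gt_eqF.
  by clear; rewrite ler_norml => /andP[? _]; lra.
have Fm := Fub xm ym tm axm xym ymb t0m tm2.
have tm0 : t0 < tm.
  rewrite lt_neqAle t0m andbT; apply/eqP => E.
  have hi : h * (p1 (ym, tm) + p2 (xm, tm) - psi (ym - xm) tm) <= 0.
    by rewrite pmulr_rle0// subr_le0 -E init.
  have ht : h * et * (tm - t0) = 0 by rewrite E subrr mulr0.
  move: Fm Flow hi; rewrite ht; move: hD; clear.
  by rewrite ler_norml => ? /andP[_ ?] ? ?; lra.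
have het0 : 0 < h * et by rewrite mulr_gt0.
have xym' : xm < ym.
  rewrite lt_neqAle xym andbT; apply/eqP => E.
  have hi : h * (p1 (ym, tm) + p2 (xm, tm) - psi (ym - xm) tm) <= 0.
    rewrite pmulr_rle0// subr_le0 E.
    apply: (le_trans (diag _ _ _ _)) => //; first by rewrite aym ymb.
    by rewrite /psi subrr expr0n/= !mulr0 subrr mulr0 addr0 ltW.
  have ht : 0 <= h * et * (tm - t0) by rewrite mulr_ge0 ?subr_ge0// ltW.
  move: Fm Flow hi ht hD; clear.
  by rewrite ler_norml => /andP[_ ?] ? ? ? ?; lra.
pose E := A * expR (- l * (tm - t0)).
have E0 : 0 < E by rewrite mulr_gt0// expR_gt0.
pose q := 4 * (b - a) * (ym - xm) - (ym - xm) ^+ 2.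
have lq : l * q <= 8.
  have ba0 : 0 < b - a by rewrite subr_gt0.
  have q3 : q <= 3 * (b - a) ^+ 2.
    have : 0 <= ((b - a) - (ym - xm)) * (3 * (b - a) - (ym - xm)).
      by rewrite mulr_ge0//; move: axm ymb xym (ab); clear; lra.
    by rewrite /q => ?; lra.
  rewrite /l mulrAC ler_pdivrMr ?mulr_gt0 ?exprn_gt0//.
  by rewrite ler_pM2l.
have dm : h * et - 8 * (h * E) <=
    (p1 (ym, tm + h) - p1 (ym, tm)) + (p2 (xm, tm + h) - p2 (xm, tm)).
  have hlq : h * E * (l * q) <= h * E * 8.
    by rewrite ler_pM2l// mulr_gt0.
  have : 0 <= (p1 (ym, tm + h) - p1 (ym, tm)) + (p2 (xm, tm + h) - p2 (xm, tm))
      - h * (- l * E * q) - h * et.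
    apply: (@derive_ge0_left_max _ (fun t => F ((xm, ym), t)) _ t0 tm tm0); last first.
      by move=> s /andP[s1 s2]; apply: Fmax => //; exact: le_trans tm2.
    rewrite /F/= /psi -/q.
    have H1 := is_derive_steklov ym tm cp1 h0.
    have H2 := is_derive_steklov xm tm cp2 h0.
    apply: is_derive_eq; rewrite /GRing.scale/= /E /q; ring.
  rewrite (_ : h * (- l * E * q) = - (h * E * (l * q))); last by ring.
  move: hlq; move: (h * E * (l * q)) (h * E) => X Y; clear; lra.
pose m1 : R := p1 (ym, tm + h) - p1 (ym, tm) - h * et / 4.
pose m2 : R := p2 (xm, tm + h) - p2 (xm, tm) - h * et / 4.
have near_low p (m x0 : R) : continuous p -> m < p (x0, tm + h) - p (x0, tm) ->
    \forall r \near (0:R)^'+, forall y, `|y - x0| < r -> m <= p (y, tm + h) - p (y, tm).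
  move=> cp mp.
  have : \forall y \near x0, m < p (y, tm + h) - p (y, tm).
    have c1 : {for x0, continuous (fun y => p (y, tm + h) - p (y, tm))}.
      by apply: cvgB; exact: continuous_slice1.
    by have /cvgr_gt := c1; apply.
  move=> /nbhs_ballP[r /= r0 rP].
  near=> r' => y yr; apply/ltW/rP; rewrite /ball/= distrC; apply: (lt_le_trans yr).
  by near: r'; exact: nbhs_right_le.
have m1lt : m1 < p1 (ym, tm + h) - p1 (ym, tm) by rewrite /m1; move: het0; clear; lra.
have m2lt : m2 < p2 (xm, tm + h) - p2 (xm, tm) by rewrite /m2; move: het0; clear; lra.
near (0:R)^'+ => r.
have r0 : 0 < r by near: r; exact: nbhs_right_gt.
have low1 : forall y, `|y - ym| < r -> m1 <= p1 (y, tm + h) - p1 (y, tm).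
  by near: r; exact: near_low.
have low2 : forall y, `|y - xm| < r -> m2 <= p2 (y, tm + h) - p2 (y, tm).
  by near: r; exact: near_low.
have th : tm < tm + h by move: h0; clear; lra.
have th1 : tm + h <= t1 by move: hlt tm2; clear; lra.
have hE0 : 0 < h * E by rewrite mulr_gt0.
suff : m1 + m2 <= - 8 * (h * E).
  by move: dm het0; rewrite /m1 /m2; clear; lra.
apply: (doubling_argmax ab sp1 sp2 t0m th th1 axm xym' ymb r0 hE0).
- by move=> y _; exact: low1.
- by move=> y _; exact: low2.
move=> x y ax' xy' yb'.
have := Fmax x y tm ax' xy' yb' t0m tm2.
rewrite /F /steklov/= /psi /E; clear; move=> hh.
rewrite -subr_ge0 in hh; rewrite -subr_ge0; move: hh.
by congr (0 <= _); ring.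
Unshelve. all: by end_near. Qed.

End max_principle.

Section subheat_intro.
Variable R : realType.
Notation mu := (@lebesgue_measure R).
Implicit Types (p : R * R -> R) (G : R -> R) (a b s t x y m r : R).

Lemma flux_taylor a b p s t G x r m : continuous p ->
  mu.-integrable `[a, b] (EFin \o G) ->
  (forall x y, a <= x -> x <= y -> y <= b ->
    \int[mu]_(z in `[x, y]) (p (z, t) - p (z, s)) <= G y - G x) ->
  a <= x <= b -> 0 < r ->
  (forall y, a <= y <= b -> `|y - x| <= r -> m <= p (y, t) - p (y, s)) ->
  (x + r <= b -> G x * r + m * r ^+ 2 / 2 <= \int[mu]_(z in `[x, x + r]) G z) /\
  (a <= x - r -> \int[mu]_(z in `[x - r, x]) G z <= G x * r - m * r ^+ 2 / 2).
Proof.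
move=> cp iG dG /andP[ax xb] r0 lowm.
have cd : continuous (fun z => p (z, t) - p (z, s)).
  by move=> z; apply: cvgB; exact: continuous_slice1.
have ci (c d e : R) : mu.-integrable `[d, e] (EFin \o (fun z => c + m * (z - d))).
  apply: continuous_itv_integrable => z; apply: cvgD; first exact: cvg_cst.
  apply: cvgM; first exact: cvg_cst.
  by apply: cvgB; [exact: cvg_id|exact: cvg_cst].
split=> [xrb|axr].
- have -> : G x * r + m * r ^+ 2 / 2 = \int[mu]_(z in `[x, x + r]) (G x + m * (z - x)).
    by rewrite Rintegral_itv_affine; [field|lra].
  apply: le_Rintegral => //.
    by apply: integrableS iG => //; apply: subset_itvScc; rewrite bnd_simp; lra.
  move=> z /=; rewrite in_itv/= => /andP[xz zr].
  have zb : z <= b by lra.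
  have := dG x z ax xz zb; suff : m * (z - x) <= \int[mu]_(z in `[x, z]) (p (z, t) - p (z, s)).
    by move=> h1 h2; rewrite -lerBrDl; exact: le_trans h1 h2.
  apply: Rintegral_itv_ge_cst => //; first exact: continuous_itv_integrable.
  move=> y /andP[xy yz]; apply: lowm; first by apply/andP; split; lra.
  by rewrite ger0_norm; lra.
- have -> : G x * r - m * r ^+ 2 / 2 =
      \int[mu]_(z in `[x - r, x]) (G x - m * r + m * (z - (x - r))).
    by rewrite Rintegral_itv_affine; [field|lra].
  apply: le_Rintegral => //.
    by apply: integrableS iG => //; apply: subset_itvScc; rewrite bnd_simp; lra.
  move=> z /=; rewrite in_itv/= => /andP[rz zx].
  have az : a <= z by lra.
  have := dG z x az zx xb; suff : m * (x - z) <= \int[mu]_(z in `[z, x]) (p (z, t) - p (z, s)).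
    move=> h1 h2; have -> : G x - m * r + m * (z - (x - r)) = G x - m * (x - z) by ring.
    by rewrite lerBrDr addrC -lerBrDr; exact: le_trans h1 h2.
  apply: Rintegral_itv_ge_cst => //; first exact: continuous_itv_integrable.
  move=> y /andP[zy yx]; apply: lowm; first by apply/andP; split; lra.
  by rewrite ler0_norm; lra.
Qed.

Lemma subheat_flux a b t0 t1 p : continuous p ->
  (forall s t, t0 <= s -> s < t -> t <= t1 -> exists G : R -> R,
    [/\ G a = 0, G b = 0, mu.-integrable `[a, b] (EFin \o G),
       (forall x y, a <= x -> x <= y -> y <= b ->
         \int[mu]_(tau in `[s, t]) p (y, tau) - \int[mu]_(tau in `[s, t]) p (x, tau) =
         \int[mu]_(z in `[x, y]) G z) &
       (forall x y, a <= x -> x <= y -> y <= b ->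
         \int[mu]_(z in `[x, y]) (p (z, t) - p (z, s)) <= G y - G x)]) ->
  subheat a b t0 t1 p.
Proof.
move=> cp H s t t0s st tt1 x r m xab r0 lowm.
have [G [Ga Gb iG dI dG]] := H s t t0s st tt1.
have [T1 T2] := flux_taylor cp iG dG xab r0 lowm.
move: dI; set I := fun y => \int[mu]_(tau in `[s, t]) p (y, tau).
rewrite /= -/(I _) -/(I _) -/(I _) => dI.
have {}dI x' y : a <= x' -> x' <= y -> y <= b -> I y - I x' =
         \int[mu]_(z in `[x', y]) G z by exact: dI.
move/andP: xab => [ax xb].
have up : x + r <= b -> G x * r + m * r ^+ 2 / 2 <= I (x + r) - I x.
  by move=> h; rewrite dI//; [exact: T1|lra].
have dn : a <= x - r -> I x - I (x - r) <= G x * r - m * r ^+ 2 / 2.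
  by move=> h; rewrite dI//; [exact: T2|lra].
split.
- by move=> /dn ? /up ?; lra.
- by move=> xa; move: up; rewrite xa Ga mul0r add0r => h /h ?; lra.
- by move=> xa; move: dn; rewrite xa Gb mul0r add0r => h /h ?; lra.
Qed.

End subheat_intro.

Section smooth_one_variable.
Variable R : realType.
Implicit Types (f g : R -> R) (p : {poly R}) (x y : R).

Fixpoint Ck n f : Prop :=
  if n is n'.+1 then exists2 g, forall x, is_derive x 1 f (g x) & Ck n' g
  else True.

Lemma CkW n f : Ck n.+1 f -> Ck n f.
Proof.
elim: n f => [//|n IH] f [g dg Hg]; exists g => //; exact: IH.
Qed.

Lemma CkD n f g : Ck n f -> Ck n g -> Ck n (fun x => f x + g x).
Proof.
elim: n f g => [//|n IH] f g [f' df Hf] [g' dg Hg].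
exists (fun x => f' x + g' x); last exact: IH.
by move=> x; exact: is_deriveD.
Qed.

Lemma CkM n f g : Ck n f -> Ck n g -> Ck n (fun x => f x * g x).
Proof.
elim: n f g => [//|n IH] f g /[dup] Hf0 [f' df Hf] /[dup] Hg0 [g' dg Hg].
exists (fun x => f x * g' x + g x * f' x).
  by move=> x; exact: is_deriveM.
apply: CkD; apply: IH => //; exact: CkW.
Qed.

Lemma Ck_cst n (c : R) : Ck n (fun=> c).
Proof.
elim: n c => [//|n IH] c; exists (fun=> 0) => // x; exact: is_derive_cst.
Qed.

Lemma Ck_affine n f (c d : R) : Ck n f -> Ck n (fun x => f (c * x + d)).
Proof.
elim: n f => [//|n IH] f [f' df Hf].
exists (fun x => f' (c * x + d) * c); last by apply: CkM; [exact: IH|exact: Ck_cst].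
move=> x; have dd : is_derive x 1 (fun x => c * x + d) c.
  by apply: is_derive_eq; rewrite addr0 /GRing.scale/= mulr1.
exact: (@is_derive1_comp _ f (fun x => c * x + d) x _ _ (df _) dd).
Qed.

Lemma CkV n f : (forall x, f x != 0) -> Ck n f -> Ck n (fun x => (f x)^-1).
Proof.
move=> f0; elim: n => [//|n IH] /[dup] /CkW /IH Hf0 [f' df Hf].
exists (fun x => (-1 * f' x) * ((f x)^-1 * (f x)^-1)); last first.
  by apply: CkM; apply: CkM => //; exact: Ck_cst.
move=> x; have := is_deriveV (f0 x) (df x).
suff -> : - f x ^- 2 *: f' x = -1 * f' x * ((f x)^-1 * (f x)^-1) by [].
by rewrite /GRing.scale/= expr2 invfM; ring.
Qed.

Definition flat p x := if 0 < x then p.[x^-1] * expR (- x^-1) else 0.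

Lemma flat_le0 p x : x <= 0 -> flat p x = 0.
Proof. by move=> x0; rewrite /flat ltNge x0. Qed.

Lemma horner_le p y : 1 <= y ->
  `|p.[y]| <= (\sum_(i < size p) `|p`_i|) * y ^+ size p.
Proof.
move=> y1; rewrite horner_coef mulr_suml; apply: (le_trans (ler_norm_sum _ _ _)).
apply: ler_sum => i _; rewrite normrM ler_wpM2l// ger0_norm ?exprn_ge0//; last first.
  exact: le_trans y1.
by rewrite ler_weXn2l// ltnW.
Qed.

Lemma flat_le p : exists2 C : R, 0 < C & forall x, 0 < x <= 1 -> `|flat p x| <= C * x ^+ 2.
Proof.
pose S := \sum_(i < size p) `|p`_i|.
pose k := (size p).+1.
have S0 : 0 <= S by exact: sumr_ge0.
exists ((S + 1) * (k.+1)`!%:R).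
  by rewrite mulr_gt0 ?ltr0n ?fact_gt0//; lra.
move=> x /andP[x0 x1]; rewrite /flat x0 normrM (ger0_norm (expR_ge0 _)).
set y := x^-1.
have y1 : 1 <= y by rewrite /y invf_ge1.
have y0 : 0 < y by lra.
have xy : x = y^-1 by rewrite /y invrK.
rewrite expRN ler_pdivrMr ?expR_gt0//.
have e1 : y ^+ k.+1 <= k.+1`!%:R * expR y.
  have /= := expR_ge1Dxn k (ltW y0).
  rewrite -ler_pdivrMl ?ltr0n ?fact_gt0// mulrC => ?; lra.
apply: (le_trans (horner_le p y1)); rewrite -/S.
have -> : (S + 1) * k.+1`!%:R * x ^+ 2 * expR y =
   (S + 1) * (y ^- 2 * (k.+1`!%:R * expR y)) by rewrite xy exprVn; ring.
apply: ler_pM => //; first by rewrite exprn_ge0// ltW.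
  lra.
rewrite ler_pdivlMl ?exprn_gt0//.
by apply: le_trans e1; rewrite -exprD /k addSn addSn add0n.
Qed.

Lemma is_derive_flat p x : is_derive x 1 (flat p) (flat ('X^2 * (p - p^`())) x).
Proof.
have [x0|x0|x0] := ltgtP 0 x.
- rewrite {2}/flat x0.
  have d1 : is_derive x 1 (fun x => x^-1) (- x ^- 2).
    have := @is_deriveV _ id x 1 1; rewrite /= gt_eqF// => /(_ isT _).
    by rewrite /GRing.scale/= mulr1; apply.
  have d2 := is_derive1_comp (is_derive_poly p x^-1) d1.
  have d3 : is_derive x 1 (fun x => - x^-1) (x ^- 2).
    by have := is_deriveN d1; rewrite opprK.
  have d4 := @is_derive1_comp _ expR (fun x => - x^-1) x _ _ (is_derive_expR _) d3.
  have d5 := is_deriveM d2 d4.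
  apply: (@near_eq_is_derive _ _ _
    ((horner p \o (fun x => x^-1)) * (expR \o (fun x => - x^-1)))).
    by near=> y; rewrite /flat ifT//; near: y; exact: lt_nbhsr.
  rewrite /= in d5.
  suff -> : ('X^2 * (p - p^`())).[x^-1] * expR (- x^-1) =
    p.[x^-1] *: (expR (- x^-1) / x ^+ 2) +
       expR (- x^-1) *: (p^`().[x^-1] * - x ^- 2) by exact: d5.
  by rewrite hornerM hornerXn hornerD hornerN exprVn /GRing.scale/=; ring.
- rewrite {2}/flat ltNge (ltW x0)/=.
  apply: (@near_eq_is_derive _ _ _ (fun=> 0)).
  near=> y; rewrite /flat ifF//; apply/negbTE; rewrite -leNgt ltW//.
  by near: y; exact: lt_nbhsl.
- rewrite -x0 {2}/flat ltxx.
  have [C C0 HC] := flat_le p.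
  have cv : h^-1 *: (flat p (h *: 1 + 0) - flat p 0) @[h --> 0^'] --> (0 : R).
    apply/cvgrPdist_lt => e e0.
    near=> h; rewrite sub0r normrN addr0 scaler1 {2}/flat ltxx subr0 /GRing.scale/=.
    have hn0 : h != 0 by near: h; exact: nbhs_dnbhs_neq.
    have [h0|h0] := ltP 0 h; last by rewrite flat_le0// mulr0 normr0.
    rewrite normrM ger0_norm ?invr_ge0 ?(ltW h0)// ltr_pdivrMl//.
    have h1 : h <= 1.
      by apply: le_trans (ler_norm _) _; near: h; exact: dnbhs0_le.
    apply: (@le_lt_trans _ _ (C * h ^+ 2)); first by apply: HC; rewrite h0.
    rewrite expr2 mulrCA ltr_pM2l// mulrC -ltr_pdivlMr//.
    apply: le_lt_trans (ler_norm _) _; near: h; apply: dnbhs0_lt.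
    by rewrite divr_gt0.
  apply: DeriveDef; first by apply/cvg_ex; exists 0.
  by apply: cvg_lim cv.
Unshelve. all: by end_near. Qed.

Lemma Ck_flat n p : Ck n (flat p).
Proof.
elim: n p => [//|n IH] p; exists (flat ('X^2 * (p - p^`()))) => //.
by move=> x; exact: is_derive_flat.
Qed.

Lemma flat1_ge0 x : 0 <= flat 1 x.
Proof. by rewrite /flat; case: ifPn => // _; rewrite hornerE mul1r expR_ge0. Qed.

Lemma flat1_gt0 x : 0 < x -> 0 < flat 1 x.
Proof. by rewrite /flat => ->; rewrite hornerE mul1r expR_gt0. Qed.

Lemma smooth_step : exists S dS : R -> R,
  [/\ (forall n, Ck n S) /\ (forall x, is_derive x 1 S (dS x)),
      forall x, 0 <= dS x, forall x, 0 <= S x <= 1,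
      forall x, x <= 0 -> S x = 0 /\ dS x = 0 &
      forall x, 1 <= x -> S x = 1 /\ dS x = 0].
Proof.
pose e := flat 1; pose e' x := flat 1 (-1 * x + 1).
pose d x := e x + e' x.
have d0 x : 0 < d x.
  have [x0|x0] := ltP 0 x.
    by have := flat1_gt0 x0; have := flat1_ge0 (-1 * x + 1); rewrite /d/e/e'; lra.
  have x1 : 0 < -1 * x + 1 by lra.
  by have := flat1_gt0 x1; have := flat1_ge0 x; rewrite /d/e/e'; lra.
have Cd n : Ck n d by apply: CkD; [exact: Ck_flat|apply: Ck_affine; exact: Ck_flat].
pose S x := e x * (d x)^-1.
have CS n : Ck n S.
  apply: CkM; first exact: Ck_flat.
  by apply: CkV => // x; rewrite gt_eqF.
have pos p x : (forall y, 0 <= p.[y]) -> 0 <= flat p x.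
  move=> p0; rewrite /flat; case: ifPn => // _.
  by rewrite mulr_ge0// expR_ge0.
pose q : {poly R} := 'X^2 * (1 - 1^`()).
have q0 x : 0 <= flat q x.
  by apply: pos => y; rewrite /q derivC subr0 mulr1 hornerE sqr_ge0.
have dE x : is_derive x 1 e (flat q x) by exact: is_derive_flat.
have dE' x : is_derive x 1 e' (- flat q (-1 * x + 1)).
  have dd : is_derive x 1 (fun x => -1 * x + 1) (-1 : R).
    by apply: is_derive_eq; rewrite addr0 /GRing.scale/= mulr1.
  have := @is_derive1_comp _ (flat 1) (fun x => -1 * x + 1) x _ _ (is_derive_flat 1 _) dd.
  by rewrite -/q mulrN1.
pose dS x := (flat q x * e' x + e x * flat q (-1 * x + 1)) * (d x)^-2.
exists S, dS; split.
- split => // x; have dd : is_derive x 1 d (flat q x - flat q (-1 * x + 1)).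
    exact: is_deriveD.
  have d0' : d x != 0 by rewrite gt_eqF.
  have := is_deriveM (dE x) (is_deriveV d0' dd).
  suff -> : e x *: (- d x ^- 2 *: (flat q x - flat q (-1 * x + 1))) +
     (d x)^-1 *: flat q x = dS x by [].
  by rewrite /dS /GRing.scale/= /d; field; rewrite -/(d x).
- move=> x; rewrite mulr_ge0 ?invr_ge0 ?exprn_ge0 ?(ltW (d0 _))//.
  by rewrite addr_ge0// mulr_ge0//; exact: flat1_ge0.
- move=> x; rewrite /S divr_ge0 ?(ltW (d0 _)) ?flat1_ge0//= ler_pdivrMr// mul1r.
  by rewrite /d lerDl; exact: flat1_ge0.
- move=> x x0; rewrite /S /dS /e (flat_le0 1 x0) (flat_le0 q x0).
  by rewrite !mul0r addr0 mul0r.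
- move=> x x1; have x1' : -1 * x + 1 <= 0 by lra.
  rewrite /S /dS /d /e' (flat_le0 1 x1') (flat_le0 q x1') !mulr0 !addr0 mul0r.
  by split => //; rewrite divff// gt_eqF// flat1_gt0//; lra.
Qed.

End smooth_one_variable.

Section smooth_two_variables.
Variable R : realType.
Implicit Types (F G : R * R -> R) (f g : R -> R).

Fixpoint Ck2 n F : Prop :=
  if n is n'.+1 then exists Fx Ft : R * R -> R,
    [/\ forall z, is_diff z F (fun v => v.1 * Fx z + v.2 * Ft z), Ck2 n' Fx & Ck2 n' Ft]
  else True.

Lemma Ck2_lin n F G (c d : R) : Ck2 n F -> Ck2 n G ->
  Ck2 n (fun z => c * F z + d * G z).
Proof.
elim: n F G => [//|n IH] F G [Fx [Ft [dF HFx HFt]]] [Gx [Gt [dG HGx HGt]]].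
exists (fun z => c * Fx z + d * Gx z), (fun z => c * Ft z + d * Gt z).
split; [|exact: IH..].
move=> z.
rewrite [X in is_diff _ _ X](_ : _ = c *: (fun v : R * R => v.1 * Fx z + v.2 * Ft z) +
    d *: (fun v : R * R => v.1 * Gx z + v.2 * Gt z)); last first.
  by apply/funext => v; rewrite !fctE /GRing.scale/=; ring.
exact: (is_diffD (is_diffZ c (dF z)) (is_diffZ d (dG z))).
Qed.

Lemma is_diff_derive F (z : R * R) (c d : R) (v : R * R) :
  is_diff z F (fun v => v.1 * c + v.2 * d) -> 'D_v F z = v.1 * c + v.2 * d.
Proof.
by move=> dF; rewrite deriveE ?diff_val//; exact: ex_diff.
Qed.

Lemma Ck2_smooth F : (forall n, Ck2 n F) -> smooth F.
Proof.
move=> CF s z.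
have H n : Ck2 n (foldr (fun v (g : R * R -> R) => 'D_v g) F s).
  elim: s n => [|v s IH] n /=; first exact: CF.
  have [Fx [Ft [dF Hx Ht]]] := IH n.+1.
  rewrite (_ : 'D_v _ = fun z => v.1 * Fx z + v.2 * Ft z); first exact: Ck2_lin.
  by apply/funext => w; exact: is_diff_derive.
by have [Fx [Ft [dF _ _]]] := H 1%N; case: (dF z).
Qed.

Lemma is_diff_tensor f g (z : R * R) (df dg : R) : is_derive z.1 1 f df ->
  is_derive z.2 1 g dg ->
  is_diff z (fun z => f z.1 * g z.2) (fun v => v.1 * (df * g z.2) + v.2 * (f z.1 * dg)).
Proof.
move=> Hf Hg.
have d1 (h : R -> R) (x l : R) : is_derive x 1 h l -> is_diff x h (fun v => v * l).
  move=> Hh; have Hd : differentiable h x.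
    by apply/derivable1_diffP; exact: ex_derive.
  apply: DiffDef => //; apply/funext => v.
  have -> : v = v *: 1 by rewrite /GRing.scale/= mulr1.
  rewrite linearZ/= -deriveE// derive_val /GRing.scale/= mulr1.
  by [].
have f1 : is_diff z (fst : R * R -> R) fst.
  apply: DiffDef; first by apply: linear_differentiable => w; exact: cvg_fst.
  by rewrite diff_lin// => w; exact: cvg_fst.
have f2 : is_diff z (snd : R * R -> R) snd.
  apply: DiffDef; first by apply: linear_differentiable => w; exact: cvg_snd.
  by rewrite diff_lin// => w; exact: cvg_snd.
have c1 := is_diff_comp f1 (d1 _ _ _ Hf).
have c2 := is_diff_comp f2 (d1 _ _ _ Hg).
rewrite [X in is_diff _ _ X](_ : _ = (f \o fst) z *: ( *%R^~ dg \o snd) +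
    (g \o snd) z *: ( *%R^~ df \o fst)); last first.
  by apply/funext => v; rewrite !fctE /GRing.scale/=; ring.
exact: (is_diffM c1 c2).
Qed.

Lemma Ck2_tensor n f g : Ck n f -> Ck n g -> Ck2 n (fun z => f z.1 * g z.2).
Proof.
elim: n f g => [//|n IH] f g /[dup] /CkW Hf0 [f' df Hf] /[dup] /CkW Hg0 [g' dg Hg].
exists (fun z => f' z.1 * g z.2), (fun z => f z.1 * g' z.2).
by split; [move=> z; exact: is_diff_tensor|exact: IH..].
Qed.

Lemma smooth_tensor f g : (forall n, Ck n f) -> (forall n, Ck n g) ->
  smooth (fun z : R * R => f z.1 * g z.2).
Proof. by move=> Hf Hg; apply: Ck2_smooth => n; exact: Ck2_tensor. Qed.

End smooth_two_variables.

Section plane_measurability.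
Variable R : realType.

Lemma open_measurable_plane (A : set (R * R)) : open A -> measurable A.
Proof.
move=> oA.
pose B (p q : rat) (n : nat) : set (R * R) :=
  ball (ratr p : R) n.+1%:R^-1 `*` ball (ratr q : R) n.+1%:R^-1.
have -> : A = \bigcup_(p : rat) \bigcup_(q : rat) \bigcup_(n : nat)
    (if `[< B p q n `<=` A >] then B p q n else set0).
  apply/seteqP; split; last first.
    by move=> z [p _ [q _ [n _]]]; case: ifPn => // /asboolP; exact.
  move=> [x y] Axy.
  have [[U V] /= [nU nV] UV] : nbhs (x, y) A by exact: open_nbhs_nbhs.
  have /nbhs_ballP[r1 /= r10 rU] := nU.
  have /nbhs_ballP[r2 /= r20 rV] := nV.
  pose r := Num.min r1 r2.
  have r0 : 0 < r by rewrite lt_min r10.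
  have rr1 : r <= r1 by rewrite ge_min lexx.
  have rr2 : r <= r2 by rewrite ge_min lexx orbT.
  have [n] := ltr_add_invr r0.
  rewrite add0r => nr.
  pose m := (n.+1 + n.+1)%N.
  pose d : R := m.+1%:R^-1.
  have d0 : 0 < d by rewrite invr_gt0.
  have dr : d + d <= r.
    apply: ltW; apply: le_lt_trans nr.
    have -> : d + d = 2 * d by ring.
    rewrite /d ler_pdivrMr// mulrC ler_pdivlMr// -natrM ler_nat /m.
    by rewrite mul2n addnn.
  have [p /itvP pd] := @rat_in_itvoo R (x - d) (x + d) ltac:(lra).
  have [q /itvP qd] := @rat_in_itvoo R (y - d) (y + d) ltac:(lra).
  have px : `|ratr p - x| < d.
    by rewrite ltr_norml ltrBlDr ltrBrDr; rewrite [- _ + _]addrC [d + _]addrC !pd.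
  have qy : `|ratr q - y| < d.
    by rewrite ltr_norml ltrBlDr ltrBrDr; rewrite [- _ + _]addrC [d + _]addrC !qd.
  exists p => //; exists q => //; exists m => //.
  suff -> : `[< B p q m `<=` A >] by split.
  apply/asboolP => -[x' y'] [/= Bx By].
  apply: (UV (x', y')); split => /=.
  - apply: rU; apply: le_ball (rr1) _ _; rewrite /ball/=.
    have -> : x - x' = - (ratr p - x) + (ratr p - x') by ring.
    apply: le_lt_trans (ler_normD _ _) _; rewrite normrN.
    by move: Bx; rewrite /ball/= -/d => Bx; lra.
  - apply: rV; apply: le_ball (rr2) _ _; rewrite /ball/=.
    have -> : y - y' = - (ratr q - y) + (ratr q - y') by ring.
    apply: le_lt_trans (ler_normD _ _) _; rewrite normrN.
    by move: By; rewrite /ball/= -/d => By; lra.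
apply: bigcupT_measurable_rat => p; apply: bigcupT_measurable_rat => q.
apply: bigcupT_measurable => n; case: ifPn => // _.
by apply: measurableX; exact: measurable_ball.
Qed.

Lemma closed_measurable_plane (A : set (R * R)) : closed A -> measurable A.
Proof. by move/closed_openC/open_measurable_plane/measurableC; rewrite setCK. Qed.

Lemma continuous_measurable_plane (f : R * R -> R) :
  continuous f -> measurable_fun setT f.
Proof.
move=> /continuousP cf; apply: (measurability _ (RGenOpens.measurableE R)).
move=> _ [_ [a [b ->] <-]]; rewrite setTI; apply: open_measurable_plane.
exact/cf/interval_open.
Qed.

End plane_measurability.

Section fubini_rectangle.
Variable R : realType.
Notation mu := (@lebesgue_measure R).
Variables (A B : set R) (f : R * R -> R) (C : R).
Hypotheses (mA : measurable A) (mB : measurable B).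
Hypotheses (Afin : (mu A < +oo)%E) (Bfin : (mu B < +oo)%E).
Hypothesis mf : measurable_fun (A `*` B) f.
Hypothesis fC : forall z, (A `*` B) z -> `|f z| <= C.

Lemma bounded_integrable_rectangle : (leb2 R).-integrable (A `*` B) (EFin \o f).
Proof.
apply: measurable_bounded_integrable => //; first exact: measurableX.
  rewrite [ltLHS](_ : _ = (mu A * mu B)%E); last exact: product_measure1E.
  by apply: lte_mul_pinfty => //; rewrite ge0_fin_numE.
exists C; split; first exact: num_real.
by move=> M CM z /fC h; apply: le_trans h _; exact: ltW.
Qed.

Let mfr : measurable_fun setT (f \_ (A `*` B)).
Proof. exact/(measurable_restrictT f (measurableX mA mB)). Qed.

Lemma bounded_integrable_slice2 x : A x -> mu.-integrable B (EFin \o (fun t => f (x, t))).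
Proof.
move=> Ax; apply: measurable_bounded_integrable => //.
  apply: (@eq_measurable_fun _ _ _ _ B (fun t => (f \_ (A `*` B)) (x, t))).
    by move=> t /set_mem Bt; rewrite patchE mem_set.
  apply: measurable_funS (measurableT) _ _ => //.
  exact: (measurableT_comp mfr (pair1_measurable x)).
exists C; split; first exact: num_real.
by move=> M CM t Bt; apply: le_trans (fC _) _ => //; exact: ltW.
Qed.

Lemma bounded_integrable_slice1 t : B t -> mu.-integrable A (EFin \o (fun x => f (x, t))).
Proof.
move=> Bt; apply: measurable_bounded_integrable => //.
  apply: (@eq_measurable_fun _ _ _ _ A (fun x => (f \_ (A `*` B)) (x, t))).
    by move=> x /set_mem Ax; rewrite patchE mem_set.
  apply: measurable_funS (measurableT) _ _ => //.
  exact: (measurableT_comp mfr (pair2_measurable t)).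
exists C; split; first exact: num_real.
by move=> M CM x Ax; apply: le_trans (fC _) _ => //; exact: ltW.
Qed.

Let intr : (leb2 R).-integrable setT ((EFin \o f) \_ (A `*` B)).
Proof.
apply/(integrable_mkcond _ _).1; first exact: measurableX.
exact: bounded_integrable_rectangle.
Qed.

Lemma fubini_rectangle12 : \int[leb2 R]_(z in A `*` B) f z =
  \int[mu]_(x in A) (\int[mu]_(t in B) f (x, t)).
Proof.
rewrite /Rintegral integral_mkcond -integral12_prod_meas1//.
congr fine; rewrite [RHS]integral_mkcond; apply: eq_integral => x _.
rewrite [in RHS]patchE; case: ifPn => [/set_mem Ax|xA].
  rewrite fineK; last by apply: integrable_fin_num => //; exact: bounded_integrable_slice2.
  rewrite [RHS]integral_mkcond; apply: eq_integral => t _.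
  rewrite !patchE; have [Bt|Bt] := boolP (t \in B).
    by rewrite mem_set//; split => //; exact: set_mem.
  by rewrite ifF//; apply/negbTE; apply: contra Bt => /set_mem[/= _ ?]; exact: mem_set.
rewrite /fubini_F integral0_eq// => t _; rewrite patchE ifF//; apply/negbTE.
by apply: contra xA => /set_mem[/= ? _]; exact: mem_set.
Qed.

Lemma fubini_rectangle21 : \int[leb2 R]_(z in A `*` B) f z =
  \int[mu]_(t in B) (\int[mu]_(x in A) f (x, t)).
Proof.
rewrite /Rintegral integral_mkcond -integral21_prod_meas1//.
congr fine; rewrite [RHS]integral_mkcond; apply: eq_integral => t _.
rewrite [in RHS]patchE; case: ifPn => [/set_mem Bt|tB].
  rewrite fineK; last by apply: integrable_fin_num => //; exact: bounded_integrable_slice1.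
  rewrite [RHS]integral_mkcond; apply: eq_integral => x _.
  rewrite !patchE; have [Ax|Ax] := boolP (x \in A).
    by rewrite mem_set//; split => //; exact: set_mem.
  by rewrite ifF//; apply/negbTE; apply: contra Ax => /set_mem[/= ? _]; exact: mem_set.
rewrite /fubini_G integral0_eq// => x _; rewrite patchE ifF//; apply/negbTE.
by apply: contra tB => /set_mem[/= _ ?]; exact: mem_set.
Qed.

End fubini_rectangle.

Section L2_facts.
Context (d : measure_display) (X : measurableType d) (R : realType).
Variable mu : {measure set X -> \bar R}.
Variables D : set X.
Hypotheses (mD : measurable D) (Dfin : (mu D < +oo)%E).

Lemma integrable_RD (f g : X -> R) : mu.-integrable D (EFin \o f) ->
  mu.-integrable D (EFin \o g) -> mu.-integrable D (EFin \o (fun x => f x + g x)).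
Proof. by move=> fi gi; exact: (integrableD mD fi gi). Qed.

Lemma integrable_RB (f g : X -> R) : mu.-integrable D (EFin \o f) ->
  mu.-integrable D (EFin \o g) -> mu.-integrable D (EFin \o (fun x => f x - g x)).
Proof. by move=> fi gi; exact: (integrableB mD fi gi). Qed.

Lemma integrable_RZ (c : R) (f : X -> R) : mu.-integrable D (EFin \o f) ->
  mu.-integrable D (EFin \o (fun x => c * f x)).
Proof. by move=> fi; exact: (integrableZl mD c fi). Qed.

Lemma integrable_Rcst (c : R) : mu.-integrable D (EFin \o (fun=> c)).
Proof.
apply: measurable_bounded_integrable => //.
exists `|c|; split; first exact: num_real.
by move=> M cM z _; exact: ltW.
Qed.

Lemma L2_integrable (f : X -> R) : L2 mu D f -> mu.-integrable D (EFin \o f).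
Proof.
move=> [mf f2].
have i1 : mu.-integrable D (EFin \o (fun x => f x ^+ 2)).
  apply/integrableP; split.
    by apply/measurable_EFinP; exact: measurable_funX.
  by under eq_integral do rewrite /= ger0_norm ?sqr_ge0//.
have i2 : mu.-integrable D (EFin \o (fun x => 1 + f x ^+ 2)).
  by apply: integrable_RD => //; exact: integrable_Rcst.
apply: le_integrable i2 => //; first exact/measurable_EFinP.
move=> x _ /=; rewrite lee_fin.
have h : 0 <= f x ^+ 2 by exact: sqr_ge0.
rewrite [leRHS]ger0_norm; last by lra.
have := sqr_ge0 (`|f x| - 1); rewrite sqrrB expr1n mulr1 -normrX ger0_norm// => h2.
have := normr_ge0 (f x); move: h2; rewrite mulr2n; lra.
Qed.

Lemma cvg_L2_L1 (f_ : nat -> X -> R) (f : X -> R) :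
  (forall n, mu.-integrable D (EFin \o f_ n)) ->
  mu.-integrable D (EFin \o f) -> cvg_L2 mu D f_ f ->
  \int[mu]_(x in D) `|f_ n x - f x| @[n --> \oo] --> 0.
Proof.
move=> if_ fi /fine_cvgP[finD cv].
pose M := fine (mu D) + 1.
have M0 : 0 < M by rewrite /M; have := fine_ge0 (measure_ge0 mu D); lra.
have MD : fine (mu D) < M by rewrite /M; lra.
apply/cvgrPdist_lt => e e0.
have [dl dl0 dlM] : exists2 dl : R, 0 < dl & e = dl * (2 * M).
  exists (e / (2 * M)); first by rewrite divr_gt0// mulr_gt0.
  by rewrite divfK// gt_eqF// mulr_gt0.
have ed : 0 < e * dl by rewrite mulr_gt0.
have /cvgrPdist_lt /(_ _ ed) cvn := cv.
near=> n.
have fn : (\int[mu]_(z in D) ((f_ n z - f z) ^+ 2)%:E)%E \is a fin_num.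
  by near: n; exact: finD.
have sm : `|0 - \int[mu]_(z in D) ((f_ n z - f z) ^+ 2)| < e * dl.
  by near: n; exact: cvn.
have mdf : measurable_fun D (fun z => f_ n z - f z).
  apply: measurable_funB; apply/measurable_EFinP; first exact: measurable_int (if_ n).
  exact: measurable_int fi.
have i2 : mu.-integrable D (EFin \o (fun z => (f_ n z - f z) ^+ 2)).
  apply/integrableP; split.
    by apply/measurable_EFinP; exact: measurable_funX.
  under eq_integral do rewrite /= ger0_norm ?sqr_ge0//.
  by rewrite ltey_eq fn.
have idf : mu.-integrable D (EFin \o (fun z => f_ n z - f z)).
  exact: integrable_RB.
have iN : mu.-integrable D (EFin \o (fun z => `|f_ n z - f z|)).
  by have := integrable_norm idf.
have i3 := integrable_RZ (2 * dl)^-1 i2.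
have i4 := integrable_RD (integrable_Rcst (dl / 2)) i3.
rewrite sub0r normrN ger0_norm; last exact: Rintegral_ge0.
apply: (@le_lt_trans _ _ (\int[mu]_(z in D) (dl / 2 + (2 * dl)^-1 * (f_ n z - f z) ^+ 2))).
  apply: le_Rintegral => // z _.
  set q := f_ n z - f z.
  have -> : dl / 2 + (2 * dl)^-1 * q ^+ 2 = (dl ^+ 2 + `|q| ^+ 2) / (2 * dl).
    by rewrite real_normK ?num_real//; field; rewrite gt_eqF.
  rewrite ler_pdivlMr ?mulr_gt0//.
  have := sqr_ge0 (dl - `|q|); rewrite sqrrB mulr2n; lra.
rewrite RintegralD//; last exact: integrable_Rcst.
rewrite Rintegral_cst// RintegralZl//.
move: sm; rewrite sub0r normrN ger0_norm; last first.
  by apply: Rintegral_ge0 => z _; exact: sqr_ge0.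
set J := \int[mu]_(z in D) _ => sm.
have h1 : (2 * dl)^-1 * J <= e / 2.
  rewrite ler_pdivrMl ?mulr_gt0//; apply: ltW; apply: lt_le_trans sm _.
  by rewrite le_eqVlt; apply/orP; left; apply/eqP; field.
have h2 : dl / 2 * fine (mu D) <= e / 4.
  have -> : e / 4 = dl / 2 * M by rewrite dlM; field.
  by rewrite ler_pM2l ?divr_gt0// ltW.
lra.
Unshelve. all: by end_near. Qed.

Lemma Rintegral_sub_dist (f g : X -> R) (E : set X) : measurable E -> E `<=` D ->
  mu.-integrable D (EFin \o f) -> mu.-integrable D (EFin \o g) ->
  `|\int[mu]_(x in E) f x - \int[mu]_(x in E) g x| <= \int[mu]_(x in D) `|f x - g x|.
Proof.
move=> mE ED fi gi; have idf := integrable_RB fi gi.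
have iN : mu.-integrable D (EFin \o (fun z => `|f z - g z|)).
  by have := integrable_norm idf.
rewrite -RintegralB//; [|exact: integrableS fi|exact: integrableS gi].
apply: (le_trans (le_normr_Rintegral _ _)) => //; first exact: integrableS idf.
apply: fine_le.
- by apply: integrable_fin_num => //; exact: integrableS iN.
- exact: integrable_fin_num.
- by apply: ge0_subset_integral => //; exact: measurable_int iN.
Qed.

End L2_facts.

Section trapezoids.
Variable R : realType.
Notation mu := (@lebesgue_measure R).
Implicit Types (f g : R -> R) (l r x : R).

Lemma is_derive_continuous f (df : R -> R) : (forall x, is_derive x 1 f (df x)) ->
  continuous f.
Proof.
move=> H x; apply: differentiable_continuous; apply/derivable1_diffP.
exact: (@ex_derive _ _ _ _ _ _ _ (H x)).
Qed.

Lemma Rintegral_FTC2 f (df : R -> R) l r : l <= r ->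
  (forall x, is_derive x 1 f (df x)) -> continuous df ->
  \int[mu]_(x in `[l, r]) df x = f r - f l.
Proof.
rewrite le_eqVlt => /predU1P[->|lr] dF cd.
  by rewrite set_itv1 Rintegral_set1 subrr.
have cf := is_derive_continuous dF.
rewrite /Rintegral (@continuous_FTC2 _ _ f)//=.
- exact: continuous_subspaceT.
- split.
  + by move=> x _; exact: (@ex_derive _ _ _ _ _ _ _ (dF x)).
  + by apply: cvg_at_right_filter; exact: cf.
  + by apply: cvg_at_left_filter; exact: cf.
- by move=> x _; rewrite derive1E; exact: (@derive_val _ _ _ _ _ _ _ (dF x)).
Qed.

Lemma Ck2_continuous_deriv f (df : R -> R) : (forall x, is_derive x 1 f (df x)) ->
  Ck 2 f -> continuous df.
Proof.
move=> H [g dg [h dh _]]; rewrite (_ : df = g); first exact: is_derive_continuous dh.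
apply/funext => x.
by rewrite -(@derive_val _ _ _ _ _ _ _ (H x)) (@derive_val _ _ _ _ _ _ _ (dg x)).
Qed.

Lemma integral_approx_unit (A : R -> R) (dA : R -> R) g l r c d :
  l <= r -> (forall x, is_derive x 1 A (dA x)) -> continuous dA -> continuous g ->
  (forall x, 0 <= dA x) -> A l = 0 -> A r = 1 ->
  (forall x, l <= x <= r -> dA x = 0 \/ `|g x - c| <= d) ->
  `|\int[mu]_(x in `[l, r]) (g x * dA x) - c| <= d.
Proof.
move=> lr hA cA cg A0 Al Ar H.
have I1 : \int[mu]_(x in `[l, r]) dA x = 1.
  by rewrite (Rintegral_FTC2 lr hA cA) Al Ar subr0.
have cgA : continuous (fun x => g x * dA x) by move=> x; apply: cvgM; [exact: cg|exact: cA].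
have iA : mu.-integrable `[l, r] (EFin \o dA) by exact: continuous_itv_integrable.
have -> : c = \int[mu]_(x in `[l, r]) (c * dA x) by rewrite RintegralZl// I1 mulr1.
have icA : mu.-integrable `[l, r] (EFin \o (fun x => c * dA x)).
  by apply: continuous_itv_integrable => x; apply: cvgM; [exact: cvg_cst|exact: cA].
rewrite -RintegralB//; last exact: continuous_itv_integrable.
have cB : continuous (fun x => g x * dA x - c * dA x).
  by move=> x; apply: cvgB; [exact: cgA|apply: cvgM; [exact: cvg_cst|exact: cA]].
apply: (le_trans (le_normr_Rintegral _ _)) => //; first exact: continuous_itv_integrable.
have -> : d = \int[mu]_(x in `[l, r]) (d * dA x) by rewrite RintegralZl// I1 mulr1.
apply: le_Rintegral => //.
- apply: continuous_itv_integrable => x; apply: cvg_norm; exact: cB.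
- by apply: continuous_itv_integrable => x; apply: cvgM; [exact: cvg_cst|exact: cA].
move=> x /=; rewrite in_itv/= => /H[->|h]; first by rewrite !mulr0 subrr normr0.
by rewrite -mulrBl normrM (ger0_norm (A0 x)) ler_wpM2r.
Qed.

Lemma smooth_trapezoids l r : l < r -> exists X dX : nat -> R -> R,
  [/\ (forall n k, Ck k (X n)) /\ (forall n x, is_derive x 1 (X n) (dX n x)),
      (forall n x, `|X n x| <= 1) /\
      (forall n, exists2 d, 0 < d & forall x, X n x = 0 /\ dX n x = 0 \/ l + d <= x <= r - d),
      forall x, l < x < r -> \forall n \near \oo, X n x = 1,
      forall n, \int[mu]_(x in `[l, r]) `|dX n x| <= 2 &
      forall g, continuous g ->
        \int[mu]_(x in `[l, r]) (g x * dX n x) @[n --> \oo] --> g l - g r].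
Proof.
move=> lr.
have [S [dS [[CS dSS] dS0 S01 Sl Sr]]] := smooth_step R.
pose N n : R := 4 / (r - l) * n.+1%:R.
have N4 n : 4 / (r - l) <= N n.
  by rewrite /N ler_pMr ?divr_gt0 ?subr_gt0// ler1n.
have N0 n : 0 < N n by rewrite mulr_gt0 ?divr_gt0 ?subr_gt0.
have NV n : (N n)^-1 <= (r - l) / 4.
  by rewrite -[leRHS]invrK lef_pV2 ?posrE ?invf_div ?divr_gt0 ?subr_gt0.
have NV0 n : 0 < (N n)^-1 by rewrite invr_gt0.
pose A n x := S (N n * x + (- N n * l - 1)).
pose dA n x := dS (N n * x + (- N n * l - 1)) * N n.
pose B n x := S (N n * x + (- N n * r + 2)).
pose dB n x := dS (N n * x + (- N n * r + 2)) * N n.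
have aff (c d x : R) : is_derive x 1 (fun x => c * x + d) c.
  by apply: is_derive_eq; rewrite addr0 /GRing.scale/= mulr1.
have hA n x : is_derive x 1 (A n) (dA n x).
  exact: (@is_derive1_comp _ S (fun x => N n * x + (- N n * l - 1)) x _ _ (dSS _) (aff _ _ _)).
have hB n x : is_derive x 1 (B n) (dB n x).
  exact: (@is_derive1_comp _ S (fun x => N n * x + (- N n * r + 2)) x _ _ (dSS _) (aff _ _ _)).
have CA n k : Ck k (A n) by exact: Ck_affine.
have CB n k : Ck k (B n) by exact: Ck_affine.
have cA n : continuous (dA n) := Ck2_continuous_deriv (hA n) (CA n 2).
have cB n : continuous (dB n) := Ck2_continuous_deriv (hB n) (CB n 2).
have dA0 n x : 0 <= dA n x by rewrite mulr_ge0// ltW.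
have dB0 n x : 0 <= dB n x by rewrite mulr_ge0// ltW.
have Alo n x : x <= l + (N n)^-1 -> A n x = 0 /\ dA n x = 0.
  move=> h; have /Sl[h1 h2] : N n * x + (- N n * l - 1) <= 0.
    have : N n * x <= N n * (l + (N n)^-1) by rewrite ler_pM2l.
    by rewrite mulrDr divff ?gt_eqF//; lra.
  by rewrite /A /dA h1 h2 mul0r.
have Ahi n x : l + 2 * (N n)^-1 <= x -> A n x = 1 /\ dA n x = 0.
  move=> h; have /Sr[h1 h2] : 1 <= N n * x + (- N n * l - 1).
    have : N n * (l + 2 * (N n)^-1) <= N n * x by rewrite ler_pM2l.
    by rewrite mulrDr mulrCA divff ?gt_eqF//; lra.
  by rewrite /A /dA h1 h2 mul0r.
have Blo n x : x <= r - 2 * (N n)^-1 -> B n x = 0 /\ dB n x = 0.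
  move=> h; have /Sl[h1 h2] : N n * x + (- N n * r + 2) <= 0.
    have : N n * x <= N n * (r - 2 * (N n)^-1) by rewrite ler_pM2l.
    by rewrite mulrBr mulrCA divff ?gt_eqF//; lra.
  by rewrite /B /dB h1 h2 mul0r.
have Bhi n x : r - (N n)^-1 <= x -> B n x = 1 /\ dB n x = 0.
  move=> h; have /Sr[h1 h2] : 1 <= N n * x + (- N n * r + 2).
    have : N n * (r - (N n)^-1) <= N n * x by rewrite ler_pM2l.
    by rewrite mulrBr divff ?gt_eqF//; lra.
  by rewrite /B /dB h1 h2 mul0r.
have [Al Ar] : (forall n, A n l = 0) /\ (forall n, A n r = 1).
  by split=> n; [apply: (Alo _ _ _).1|apply: (Ahi _ _ _).1]; have := NV n; have := NV0 n; lra.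
have [Bl Br] : (forall n, B n l = 0) /\ (forall n, B n r = 1).
  by split=> n; [apply: (Blo _ _ _).1|apply: (Bhi _ _ _).1]; have := NV n; have := NV0 n; lra.
have Ncv (e : R) : 0 < e -> \forall n \near \oo, 2 * (N n)^-1 < e.
  move=> e0.
  have e1 : 0 < e * (2 / (r - l)) by rewrite mulr_gt0 ?divr_gt0 ?subr_gt0.
  near=> n.
  have : n.+1%:R^-1 < e * (2 / (r - l)).
    by near: n; exact: (near_infty_natSinv_lt (PosNum e1)).
  rewrite -ltr_pdivrMr ?divr_gt0 ?subr_gt0//; congr (_ < _).
  by rewrite /N; field; rewrite subr_eq0 gt_eqF//= pnatr_eq0.
exists (fun n x => A n x - B n x), (fun n x => dA n x - dB n x); split.
- split=> [n k|n x]; last exact: is_deriveB.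
  rewrite (_ : (fun x => _) = (fun x => A n x + (-1) * B n x)).
    by apply: CkD => //; apply: CkM => //; exact: Ck_cst.
  by apply/funext => x; rewrite mulN1r.
- split=> [n x|n].
    have /andP[a1 a2] := S01 (N n * x + (- N n * l - 1)).
    have /andP[b1 b2] := S01 (N n * x + (- N n * r + 2)).
    by rewrite ler_norml /A /B; apply/andP; split; lra.
  exists (N n)^-1 => // x.
  have [h|h] := leP x (l + (N n)^-1).
    have [-> ->] := Alo _ _ h.
    have [|-> ->] := Blo n x; first by have := NV n; lra.
    by left; rewrite subrr.
  have [h2|h2] := leP (r - (N n)^-1) x; last by right; apply/andP; split; lra.
  have [-> ->] := Bhi _ _ h2.
  have [|-> ->] := Ahi n x; first by have := NV n; lra.
  by left; rewrite !subrr.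
- move=> x /andP[lx xr].
  have e0 : 0 < Num.min (x - l) (r - x) by rewrite lt_min !subr_gt0 lx.
  near=> n.
  have : 2 * (N n)^-1 < Num.min (x - l) (r - x) by near: n; exact: Ncv.
  rewrite lt_min => /andP[h1 h2].
  have [|-> _] := Ahi n x; first by lra.
  have [|-> _] := Blo n x; first by lra.
  by rewrite subr0.
- move=> n.
  have -> : 2 = \int[mu]_(x in `[l, r]) (dA n x + dB n x).
    rewrite RintegralD//; [|exact: continuous_itv_integrable..].
    rewrite (Rintegral_FTC2 (ltW lr) (hA n) (cA n)) (Rintegral_FTC2 (ltW lr) (hB n) (cB n)).
    by rewrite Al Ar Bl Br; ring.
  apply: le_Rintegral => //.
  + by apply: continuous_itv_integrable => x; apply: cvg_norm; apply: cvgB; [exact: cA|exact: cB].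
  + by apply: continuous_itv_integrable => x; apply: cvgD; [exact: cA|exact: cB].
  by move=> x _; apply: (le_trans (ler_normB _ _)); rewrite !ger0_norm.
- move=> g cg.
  have gA : \int[mu]_(x in `[l, r]) (g x * dA n x) @[n --> \oo] --> g l.
    apply/cvgrPdist_le => e e0.
    have /cvgrPdist_le /(_ _ e0) /nbhs_ballP [d /= d0 dP] := cg l.
    near=> n; rewrite distrC; apply: (integral_approx_unit (ltW lr) (hA n)) => // x /andP[lx xr].
    have [h|h] := leP (l + 2 * (N n)^-1) x; first by left; apply: (Ahi _ _ _).2.
    right; rewrite distrC; apply: dP; rewrite /ball/= distrC ger0_norm; last lra.
    have : 2 * (N n)^-1 < d by near: n; exact: Ncv.
    lra.
  have gB : \int[mu]_(x in `[l, r]) (g x * dB n x) @[n --> \oo] --> g r.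
    apply/cvgrPdist_le => e e0.
    have /cvgrPdist_le /(_ _ e0) /nbhs_ballP [d /= d0 dP] := cg r.
    near=> n; rewrite distrC; apply: (integral_approx_unit (ltW lr) (hB n)) => // x /andP[lx xr].
    have [h|h] := leP x (r - 2 * (N n)^-1); first by left; apply: (Blo _ _ _).2.
    right; rewrite distrC; apply: dP; rewrite /ball/= ger0_norm; last lra.
    have : 2 * (N n)^-1 < d by near: n; exact: Ncv.
    lra.
  rewrite (_ : (fun n => _) = (fun n => \int[mu]_(x in `[l, r]) (g x * dA n x)
      - \int[mu]_(x in `[l, r]) (g x * dB n x))); first exact: cvgB.
  apply/funext => n; rewrite -RintegralB//; last 2 first.
  + by apply: continuous_itv_integrable => x; apply: cvgM; [exact: cg|exact: cA].
  + by apply: continuous_itv_integrable => x; apply: cvgM; [exact: cg|exact: cB].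
  by apply: eq_Rintegral => x _; rewrite mulrBr.
Unshelve. all: by end_near. Qed.

End trapezoids.

Lemma Rintegral_dominated_cvg (d : measure_display) (X : measurableType d)
    (R : realType) (mu : {measure set X -> \bar R}) (D : set X)
    (f_ : nat -> X -> R) (f g : X -> R) : measurable D ->
  (forall n, measurable_fun D (f_ n)) -> measurable_fun D f ->
  (forall x, D x -> f_ n x @[n --> \oo] --> f x) ->
  mu.-integrable D (EFin \o g) -> (forall n x, D x -> `|f_ n x| <= g x) ->
  \int[mu]_(x in D) f_ n x @[n --> \oo] --> \int[mu]_(x in D) f x.
Proof.
move=> mD mf_ mf cf ig fg.
have [|||//||h1 h2 h3] := @dominated_convergence _ _ _ mu D mD
    (fun n => EFin \o f_ n) (EFin \o f) (EFin \o g).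
- by move=> n; exact/measurable_EFinP.
- exact/measurable_EFinP.
- by apply: aeW => x Dx; apply: cvg_EFin; [exact: nearW|exact: cf].
- by apply: aeW => x n Dx; rewrite lee_fin; exact: fg.
apply: fine_cvg; rewrite fineK; first exact: h3.
exact: integrable_fin_num.
Qed.

Lemma lebesgue_measure_itv_lty (R : realType) (b1 b2 : bool) (x y : R) :
  (@lebesgue_measure R [set` Interval (BSide b1 x) (BSide b2 y)] < +oo)%E.
Proof.
by rewrite lebesgue_measure_itv/=; case: ifP => _; rewrite -?EFinB ltry.
Qed.

Section weak_rectangle.
Variable R : realType.
Notation mu := (@lebesgue_measure R).
Implicit Types (P p g : R * R -> R) (s t x : R).

Lemma continuous_param_integral P s t : s <= t -> continuous P ->
  continuous (fun x => \int[mu]_(tau in `[s, t]) P (x, tau)).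
Proof.
move=> st cP x; apply/cvgrPdist_le => e e0.
have e1 : 0 < e / (t - s + 1) by rewrite divr_gt0//; lra.
have := continuous_tube x s t cP e1.
apply: filterS => x' H; rewrite distrC -RintegralB//;
  [|exact/continuous_itv_integrable/continuous_slice2..].
apply: (@le_trans _ _ (e / (t - s + 1) * (t - s))).
  apply: Rintegral_itv_norm_le => //.
    by apply: continuous_itv_integrable => tau; apply: cvgB; exact: continuous_slice2.
  by move=> tau /H/ltW.
rewrite -mulrA ger_pMr// ler_pdivrMl; lra.
Qed.

Lemma Rintegral_itv_oo_cc (f : R -> R) s t : mu.-integrable `[s, t] (EFin \o f) ->
  \int[mu]_(x in `]s, t[) f x = \int[mu]_(x in `[s, t]) f x.
Proof.
move=> fi; rewrite Rintegral_itv_bndo_bndc; last first.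
  by apply: integrableS fi => //; exact: subset_itv_oo_cc.
rewrite Rintegral_itv_obnd_cbnd//; apply: integrableS fi => //.
exact: subset_itv_oc_cc.
Qed.

Lemma continuous_bounded_rectangle g x1 x2 s t : x1 <= x2 -> s <= t -> continuous g ->
  exists C : R, forall x tau, x1 <= x <= x2 -> s <= tau <= t -> `|g (x, tau)| <= C.
Proof.
move=> x12 st cg.
have cng : continuous (fun z => `|g z|) by move=> z; apply: cvg_norm; exact: cg.
have [|||zm _ gmax] := @compact_EVT_max _ R (fun z => `|g z|)
   (`[x1, x2]%classic `*` `[s, t]%classic).
- by exists (x1, s); split; rewrite /= in_itv/= lexx.
- by apply: compact_setX; exact: segment_compact.
- exact: continuous_subspaceT.
exists `|g zm| => x tau hx ht; apply: gmax.
by rewrite inE; split; rewrite /= in_itv.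
Qed.

Lemma continuous_slices_swap g : continuous g -> continuous (fun z : R * R => g (z.2, z.1)).
Proof.
move=> cg z; apply: (@cvg_comp _ _ _ (fun z : R * R => (z.2, z.1)) g _ (nbhs (z.2, z.1))).
  by apply: cvg_to_pair; [exact: cvg_snd|exact: cvg_fst].
exact: cg.
Qed.

Lemma fubini_continuous g x1 x2 s t : x1 <= x2 -> s <= t -> continuous g ->
  \int[leb2 R]_(z in `]x1, x2[ `*` `]s, t[) g z =
    \int[mu]_(x in `[x1, x2]) (\int[mu]_(tau in `[s, t]) g (x, tau)) /\
  \int[leb2 R]_(z in `]x1, x2[ `*` `]s, t[) g z =
    \int[mu]_(tau in `[s, t]) (\int[mu]_(x in `[x1, x2]) g (x, tau)).
Proof.
move=> x12 st cg.
have [C gC] := continuous_bounded_rectangle x12 st cg.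
have mg : measurable_fun (`]x1, x2[%classic `*` `]s, t[%classic) g.
  exact: measurable_funS (measurableT) _ (continuous_measurable_plane cg).
have gC' z : (`]x1, x2[%classic `*` `]s, t[%classic) z -> `|g z| <= C.
  case: z => x tau [/=]; rewrite !in_itv/= => /andP[i1 i2] /andP[i3 i4].
  by apply: gC; rewrite !ltW.
have m1 := @lebesgue_measure_itv_lty R false true x1 x2.
have m2 := @lebesgue_measure_itv_lty R false true s t.
split.
- rewrite (fubini_rectangle12 (measurable_itv _) (measurable_itv _) m1 m2 mg gC').
  under eq_Rintegral do rewrite Rintegral_itv_oo_cc
    ?(continuous_itv_integrable _ _ (continuous_slice2 cg))//.
  by rewrite Rintegral_itv_oo_cc//; exact/continuous_itv_integrable/continuous_param_integral.
- rewrite (fubini_rectangle21 (measurable_itv _) (measurable_itv _) m1 m2 mg gC').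
  under eq_Rintegral do rewrite Rintegral_itv_oo_cc
    ?(continuous_itv_integrable _ _ (continuous_slice1 cg))//.
  rewrite Rintegral_itv_oo_cc//; apply: continuous_itv_integrable.
  exact: (continuous_param_integral x12 (continuous_slices_swap cg)).
Qed.

Lemma trapezoid_limit P x1 x2 s t (X dT : nat -> R -> R) : x1 < x2 -> s < t ->
  continuous P -> (forall n, continuous (X n)) -> (forall n, continuous (dT n)) ->
  (forall n x, `|X n x| <= 1) ->
  (forall x, x1 < x < x2 -> \forall n \near \oo, X n x = 1) ->
  (forall n, \int[mu]_(x in `[s, t]) `|dT n x| <= 2) ->
  (forall g : R -> R, continuous g ->
     \int[mu]_(x in `[s, t]) (g x * dT n x) @[n --> \oo] --> g s - g t) ->
  \int[mu]_(x in `[x1, x2]) (X n x * \int[mu]_(tau in `[s, t]) (P (x, tau) * dT n tau))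
    @[n --> \oo] --> \int[mu]_(x in `[x1, x2]) (P (x, s) - P (x, t)).
Proof.
move=> x12 st cP cX cdT X1 Xcv dT2 dTcv.
have cPT n : continuous (fun z : R * R => P z * dT n z.2).
  move=> z; apply: cvgM; first exact: cP.
  by apply: (@cvg_comp _ _ _ snd (dT n) _ (nbhs z.2)); [exact: cvg_snd|exact: cdT].
have cJ n : continuous (fun x => \int[mu]_(tau in `[s, t]) (P (x, tau) * dT n tau)).
  exact: (continuous_param_integral (ltW st) (cPT n)).
have [C PC] := continuous_bounded_rectangle (ltW x12) (ltW st) cP.
have C0 : 0 <= C by apply: le_trans (normr_ge0 _) (PC x1 s _ _); rewrite lexx ltW.
have cXJ n : continuous (fun x => X n x * \int[mu]_(tau in `[s, t]) (P (x, tau) * dT n tau)).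
  by move=> x; apply: cvgM; [exact: cX|exact: cJ].
have cPP : continuous (fun x => P (x, s) - P (x, t)).
  by move=> x; apply: cvgB; exact: continuous_slice1.
rewrite -Rintegral_itv_oo_cc; last exact: continuous_itv_integrable.
rewrite (_ : (fun n => _) = (fun n => \int[mu]_(x in `]x1, x2[)
    (X n x * \int[mu]_(tau in `[s, t]) (P (x, tau) * dT n tau)))); last first.
  by apply/funext => n; rewrite Rintegral_itv_oo_cc//; exact: continuous_itv_integrable.
apply: (@Rintegral_dominated_cvg _ _ _ _ _ _ _ (fun=> C * 2)) => //.
- move=> n; apply: measurable_funS (measurableT) _ _ => //.
  exact: continuous_measurable_fun.
- apply: measurable_funS (measurableT) _ _ => //.
  exact: continuous_measurable_fun.
- move=> x /=; rewrite in_itv/= => xx.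
  have h := dTcv (fun tau => P (x, tau)) (@continuous_slice2 _ P x cP).
  have : (1 : R) * \int[mu]_(tau in `[s, t]) (P (x, tau) * dT n tau) @[n --> \oo] -->
      P (x, s) - P (x, t) by under eq_fun do rewrite mul1r.
  apply: cvg_trans; apply: near_eq_cvg; near=> n.
  suff -> : X n x = 1 by [].
  by near: n; exact: Xcv.
- apply: integrable_Rcst => //.
  exact: lebesgue_measure_itv_lty.
move=> n x /=; rewrite in_itv/= => /andP[h1 h2].
rewrite normrM -[leRHS]mul1r; apply: ler_pM => //.
have i1 : mu.-integrable `[s, t] (EFin \o (fun tau => P (x, tau) * dT n tau)).
  apply: continuous_itv_integrable => tau; apply: cvgM; last exact: cdT.
  exact: continuous_slice2.
have cnT : continuous (fun tau => `|dT n tau|).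
  by move=> tau; apply: cvg_norm; exact: cdT.
apply: (le_trans (le_normr_Rintegral _ i1)) => //.
apply: (@le_trans _ _ (\int[mu]_(tau in `[s, t]) (C * `|dT n tau|))).
  apply: le_Rintegral => //.
  - exact: (integrable_norm i1).
  - apply: integrable_RZ => //; exact: continuous_itv_integrable.
  move=> tau /=; rewrite in_itv/= => ht; rewrite normrM ler_wpM2r//.
  by apply: PC => //; rewrite !ltW.
rewrite RintegralZl//; last exact: continuous_itv_integrable.
by rewrite ler_wpM2l.
Unshelve. all: by end_near. Qed.

Lemma rectangle_limit (D : set (R * R)) g x1 x2 s t (X T : nat -> R -> R) :
  measurable D -> `]x1, x2[%classic `*` `]s, t[%classic `<=` D ->
  (leb2 R).-integrable D (EFin \o g) ->
  (forall n, continuous (X n)) -> (forall n, continuous (T n)) ->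
  (forall n x, `|X n x| <= 1) -> (forall n x, `|T n x| <= 1) ->
  (forall x, x1 < x < x2 -> \forall n \near \oo, X n x = 1) ->
  (forall x, s < x < t -> \forall n \near \oo, T n x = 1) ->
  (forall n x, X n x = 0 \/ x1 < x < x2) -> (forall n x, T n x = 0 \/ s < x < t) ->
  \int[leb2 R]_(z in D) (g z * (X n z.1 * T n z.2)) @[n --> \oo] -->
  \int[leb2 R]_(z in `]x1, x2[ `*` `]s, t[) g z.
Proof.
move=> mD rD ig cX cT X1 T1 Xcv Tcv X0 T0.
have mg : measurable_fun D g by apply/measurable_EFinP; exact: measurable_int ig.
pose E := `]x1, x2[%classic `*` `]s, t[%classic.
have mE : measurable E by exact: measurableX.
rewrite (_ : \int[leb2 R]_(z in _) g z = \int[leb2 R]_(z in D) (g \_ E) z); last first.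
  by rewrite -Rintegral_mkcondr; congr (Rintegral _ _ _); apply/esym/setIidr.
apply: (@Rintegral_dominated_cvg _ _ R (leb2 R) D
  (fun n z => g z * (X n z.1 * T n z.2)) (g \_ E) (fun z => `|g z|)) => //.
- move=> n; apply: measurable_funM => //; apply: measurable_funS (measurableT) _ _ => //.
  apply: continuous_measurable_plane => z; apply: cvgM.
    by apply: (@cvg_comp _ _ _ fst (X n) _ (nbhs z.1)); [exact: cvg_fst|exact: cX].
  by apply: (@cvg_comp _ _ _ snd (T n) _ (nbhs z.2)); [exact: cvg_snd|exact: cT].
- by apply/(measurable_restrict _ mE mD); apply: measurable_funS mg => //; exact: subIsetl.
- move=> z Dz; rewrite patchE; case: ifPn => [/set_mem[/=]|zE].
    rewrite !in_itv/= => z1 z2; apply: cvg_near_cst; near=> n.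
    have -> : X n z.1 = 1 by near: n; exact: Xcv.
    have -> : T n z.2 = 1 by near: n; exact: Tcv.
    by rewrite !mulr1.
  apply: cvg_near_cst; near=> n; have [->|h1] := X0 n z.1; first by rewrite mul0r mulr0.
  have [->|h2] := T0 n z.2; first by rewrite !mulr0.
  by case/negP: zE; rewrite inE; split; rewrite /= in_itv.
- exact: (integrable_norm ig).
move=> n z Dz; rewrite normrM ler_piMr// normrM mulr_ile1//.
Unshelve. all: by end_near. Qed.


Lemma open_rectangle_sub_QT a b T x1 x2 s t : a <= x1 -> x2 <= b -> 0 <= s -> t <= T ->
  `]x1, x2[%classic `*` `]s, t[%classic `<=` QT a b T.
Proof.
move=> h1 h2 h3 h4 z [/=]; rewrite !in_itv/= => /andP[i1 i2] /andP[i3 i4].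
split; rewrite /= in_itv/=; apply/andP; split.
- exact: le_lt_trans i1.
- exact: lt_le_trans h2.
- exact: le_lt_trans i3.
- exact: lt_le_trans h4.
Qed.

Lemma tensor_test_function (D : set (R * R)) x1 x2 s t (X dX T dT : R -> R) (d e : R) :
  `]x1, x2[%classic `*` `]s, t[%classic `<=` D ->
  (forall k, Ck k X) -> (forall k, Ck k T) ->
  0 < d -> (forall x, X x = 0 /\ dX x = 0 \/ x1 + d <= x <= x2 - d) ->
  0 < e -> (forall x, T x = 0 /\ dT x = 0 \/ s + e <= x <= t - e) ->
  test_function D (fun z => X z.1 * T z.2).
Proof.
move=> rD CX CT d0 X0 e0 T0; split; first exact: smooth_tensor.
exists (`[x1 + d, x2 - d]%classic `*` `[s + e, t - e]%classic); split.
- by apply: compact_setX; exact: segment_compact.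
- move=> z [/=]; rewrite !in_itv/= => /andP[i1 i2] /andP[i3 i4]; apply: rD.
  by split; rewrite /= in_itv/=; apply/andP; split; lra.
- move=> z nK; have [[-> _]|h1] := X0 z.1; first by rewrite mul0r.
  have [[-> _]|h2] := T0 z.2; first by rewrite mulr0.
  by case: nK; split; rewrite /= in_itv.
Qed.

(* Testing with smooth approximations of the indicator of the rectangle turns a
   weak derivative into the difference of the integrals over two opposite sides. *)
Lemma weak_rectangle_t a b T0 (u ut p : R * R -> R) x1 x2 s t :
  weak_deriv2 (QT a b T0) (dir_t R) u ut ->
  (leb2 R).-integrable (QT a b T0) (EFin \o ut) ->
  continuous p -> (forall z, QT a b T0 z -> p z = u z) ->
  a <= x1 -> x1 < x2 -> x2 <= b -> 0 <= s -> s < t -> t <= T0 ->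
  \int[leb2 R]_(z in `]x1, x2[ `*` `]s, t[) ut z =
  \int[mu]_(x in `[x1, x2]) (p (x, t) - p (x, s)).
Proof.
move=> wd iut cp pu ax x12 xb s0 st tT.
have rD := open_rectangle_sub_QT ax xb s0 tT.
have mQ : measurable (QT a b T0) by apply: measurableX; exact: measurable_itv.
have [X [dX [[CX hX] [X1 X0] Xcv _ _]]] := smooth_trapezoids x12.
have [T [dT [[CT hT] [T1 T00] Tcv dT2 dTcv]]] := smooth_trapezoids st.
have cX n : continuous (X n) := is_derive_continuous (hX n).
have cT n : continuous (T n) := is_derive_continuous (hT n).
have cdT n : continuous (dT n) := Ck2_continuous_deriv (hT n) (CT n 2).
have L1 := rectangle_limit mQ rD iut cX cT X1 T1 Xcv Tcv.
have {}L1 : \int[leb2 R]_(z in QT a b T0) (ut z * (X n z.1 * T n z.2)) @[n --> \oo] -->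
  \int[leb2 R]_(z in `]x1, x2[ `*` `]s, t[) ut z.
  apply: L1 => n x.
    by have [d d0 /(_ x)[[-> _]|h]] := X0 n; [left|right; lra].
  by have [d d0 /(_ x)[[-> _]|h]] := T00 n; [left|right; lra].
have L2 := trapezoid_limit x12 st cp cX cdT X1 Xcv dT2 dTcv.
have E n : \int[leb2 R]_(z in QT a b T0) (ut z * (X n z.1 * T n z.2)) =
   - \int[mu]_(x in `[x1, x2]) (X n x * \int[mu]_(tau in `[s, t]) (p (x, tau) * dT n tau)).
  have [d d0 X0n] := X0 n; have [e e0 T0n] := T00 n.
  have tf := tensor_test_function rD (CX n) (CT n) d0 X0n e0 T0n.
  have := wd _ tf => /(congr1 -%R); rewrite opprK => <-; congr (- _).
  have dphi z : 'D_(dir_t R) (fun z => X n z.1 * T n z.2) z = X n z.1 * dT n z.2.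
    have := is_diff_tensor (hX n z.1) (hT n z.2).
    by move/(is_diff_derive (dir_t R)) => ->; rewrite /= mul0r add0r mul1r.
  pose g z := p z * (X n z.1 * dT n z.2).
  have cg : continuous g.
    move=> z; apply: cvgM; first exact: cp.
    apply: cvgM.
      by apply: (@cvg_comp _ _ _ fst (X n) _ (nbhs z.1)); [exact: cvg_fst|exact: cX].
    by apply: (@cvg_comp _ _ _ snd (dT n) _ (nbhs z.2)); [exact: cvg_snd|exact: cdT].
  rewrite (_ : \int[leb2 R]_(z in QT a b T0) _ =
     \int[leb2 R]_(z in QT a b T0) (g \_ (`]x1, x2[%classic `*` `]s, t[%classic)) z); last first.
    apply: eq_Rintegral => z /set_mem Qz; rewrite dphi -pu// patchE -/(g z).
    case: ifPn => // zE; rewrite /g.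
    have [[-> _]|h1] := X0n z.1; first by rewrite mul0r mulr0.
    have [[_ ->]|h2] := T0n z.2; first by rewrite !mulr0.
    by case/negP: zE; rewrite inE; split; rewrite /= in_itv/=; apply/andP; split; lra.
  rewrite -Rintegral_mkcondr (setIidr rD).
  rewrite (fubini_continuous (ltW x12) (ltW st) cg).1; apply: eq_Rintegral => x _.
  rewrite -RintegralZl//; last first.
    by apply: continuous_itv_integrable => y; apply: cvgM; [exact: continuous_slice2|exact: cdT].
  by apply: eq_Rintegral => tau _; rewrite /g/=; ring.
have L3 : \int[leb2 R]_(z in QT a b T0) (ut z * (X n z.1 * T n z.2)) @[n --> \oo] -->
    - \int[mu]_(x in `[x1, x2]) (p (x, s) - p (x, t)).
  by under eq_fun do rewrite E; exact: cvgN.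
rewrite (cvg_unique _ L1 L3)//.
have cpp t' t'' : continuous (fun x => p (x, t') - p (x, t'')).
  by move=> x; apply: cvgB; exact: continuous_slice1.
rewrite -mulN1r -RintegralZl//; last exact: continuous_itv_integrable.
by apply: eq_Rintegral => x _; ring.
Qed.

Lemma weak_rectangle_x a b T0 (u ux p : R * R -> R) x1 x2 s t :
  weak_deriv2 (QT a b T0) (dir_x R) u ux ->
  (leb2 R).-integrable (QT a b T0) (EFin \o ux) ->
  continuous p -> (forall z, QT a b T0 z -> p z = u z) ->
  a <= x1 -> x1 < x2 -> x2 <= b -> 0 <= s -> s < t -> t <= T0 ->
  \int[leb2 R]_(z in `]x1, x2[ `*` `]s, t[) ux z =
  \int[mu]_(tau in `[s, t]) (p (x2, tau) - p (x1, tau)).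
Proof.
move=> wd iut cp pu ax x12 xb s0 st tT.
have rD := open_rectangle_sub_QT ax xb s0 tT.
have mQ : measurable (QT a b T0) by apply: measurableX; exact: measurable_itv.
have [X [dX [[CX hX] [X1 X0] Xcv dX2 dXcv]]] := smooth_trapezoids x12.
have [T [dT [[CT hT] [T1 T00] Tcv _ _]]] := smooth_trapezoids st.
have cX n : continuous (X n) := is_derive_continuous (hX n).
have cT n : continuous (T n) := is_derive_continuous (hT n).
have cdX n : continuous (dX n) := Ck2_continuous_deriv (hX n) (CX n 2).
have L1 := rectangle_limit mQ rD iut cX cT X1 T1 Xcv Tcv.
have {}L1 : \int[leb2 R]_(z in QT a b T0) (ux z * (X n z.1 * T n z.2)) @[n --> \oo] -->
  \int[leb2 R]_(z in `]x1, x2[ `*` `]s, t[) ux z.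
  apply: L1 => n x.
    by have [d d0 /(_ x)[[-> _]|h]] := X0 n; [left|right; lra].
  by have [d d0 /(_ x)[[-> _]|h]] := T00 n; [left|right; lra].
have csp := continuous_slices_swap cp.
have L2 := trapezoid_limit st x12 csp cT cdX T1 Tcv dX2 dXcv.
have E n : \int[leb2 R]_(z in QT a b T0) (ux z * (X n z.1 * T n z.2)) =
   - \int[mu]_(tau in `[s, t]) (T n tau * \int[mu]_(x in `[x1, x2]) (p (x, tau) * dX n x)).
  have [d d0 X0n] := X0 n; have [e e0 T0n] := T00 n.
  have tf := tensor_test_function rD (CX n) (CT n) d0 X0n e0 T0n.
  have := wd _ tf => /(congr1 -%R); rewrite opprK => <-; congr (- _).
  have dphi z : 'D_(dir_x R) (fun z => X n z.1 * T n z.2) z = dX n z.1 * T n z.2.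
    have := is_diff_tensor (hX n z.1) (hT n z.2).
    by move/(is_diff_derive (dir_x R)) => ->; rewrite /= mul0r addr0 mul1r.
  pose g z := p z * (dX n z.1 * T n z.2).
  have cg : continuous g.
    move=> z; apply: cvgM; first exact: cp.
    apply: cvgM.
      by apply: (@cvg_comp _ _ _ fst (dX n) _ (nbhs z.1)); [exact: cvg_fst|exact: cdX].
    by apply: (@cvg_comp _ _ _ snd (T n) _ (nbhs z.2)); [exact: cvg_snd|exact: cT].
  rewrite (_ : \int[leb2 R]_(z in QT a b T0) _ =
     \int[leb2 R]_(z in QT a b T0) (g \_ (`]x1, x2[%classic `*` `]s, t[%classic)) z); last first.
    apply: eq_Rintegral => z /set_mem Qz; rewrite dphi -pu// patchE -/(g z).
    case: ifPn => // zE; rewrite /g.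
    have [[_ ->]|h1] := X0n z.1; first by rewrite mul0r mulr0.
    have [[-> _]|h2] := T0n z.2; first by rewrite !mulr0.
    by case/negP: zE; rewrite inE; split; rewrite /= in_itv/=; apply/andP; split; lra.
  rewrite -Rintegral_mkcondr (setIidr rD).
  rewrite (fubini_continuous (ltW x12) (ltW st) cg).2; apply: eq_Rintegral => tau _.
  rewrite -RintegralZl//; last first.
    by apply: continuous_itv_integrable => y; apply: cvgM; [exact: continuous_slice1|exact: cdX].
  by apply: eq_Rintegral => x _; rewrite /g/=; ring.
have L3 : \int[leb2 R]_(z in QT a b T0) (ux z * (X n z.1 * T n z.2)) @[n --> \oo] -->
    - \int[mu]_(tau in `[s, t]) (p (x1, tau) - p (x2, tau)).
  by under eq_fun do rewrite E; exact: cvgN.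
rewrite (cvg_unique _ L1 L3)//.
have cpp y y' : continuous (fun tau => p (y, tau) - p (y', tau)).
  by move=> tau; apply: cvgB; exact: continuous_slice2.
rewrite -mulN1r -RintegralZl//; last exact: continuous_itv_integrable.
by apply: eq_Rintegral => x _; ring.
Qed.

End weak_rectangle.

Lemma Rintegral_zero (d : measure_display) (X : measurableType d) (R : realType)
    (mu : {measure set X -> \bar R}) (D : set X) : \int[mu]_(x in D) (0 : R) = 0.
Proof. by rewrite /Rintegral integral0. Qed.

Lemma measurable_QT (R : realType) (a b T : R) : measurable (QT a b T).
Proof. by apply: measurableX; exact: measurable_itv. Qed.

Lemma measure_QT_lty (R : realType) (a b T : R) : ((leb2 R) (QT a b T) < +oo)%E.
Proof.
rewrite [ltLHS](_ : _ = (lebesgue_measure `]a, b[ * lebesgue_measure `]0%R, T[)%E);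
  last exact: product_measure1E.
by apply: lte_mul_pinfty => //; rewrite ?ge0_fin_numE//; exact: lebesgue_measure_itv_lty.
Qed.

Section flux.
Variable R : realType.
Notation mu := (@lebesgue_measure R).
Implicit Types (s t x y : R) (phi : R * R -> R).

Lemma smooth_continuous phi : smooth phi -> continuous phi.
Proof. by move=> sphi z; apply: differentiable_continuous; exact: (sphi [::] z). Qed.

Lemma smooth_continuous_dx phi : smooth phi -> continuous ('D_(dir_x R) phi).
Proof.
by move=> sphi z; apply: differentiable_continuous; exact: (sphi [:: dir_x R] z).
Qed.

Lemma smooth_is_derive_x phi x t : smooth phi ->
  is_derive x 1 (fun x => phi (x, t)) ('D_(dir_x R) phi (x, t)).
Proof.
move=> sphi.
have dphi : derivable phi (x, t) (dir_x R) by apply: diff_derivable; exact: (sphi [::]).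
have E : (fun h : R => h^-1 *: (phi (h *: 1 + x, t) - phi (x, t))) =
   (fun h : R => h^-1 *: (phi (h *: dir_x R + (x, t)) - phi (x, t))).
  apply/funext => h; congr (_ *: (phi _ - _)).
  by rewrite /dir_x; congr (_, _); rewrite /= scaler0 add0r.
apply: DeriveDef; rewrite /derivable /derive /= E; first exact: dphi.
by [].
Qed.

Lemma smooth_rectangle phi x y s t : x <= y -> s <= t -> smooth phi ->
  \int[leb2 R]_(z in `]x, y[ `*` `]s, t[) 'D_(dir_x R) phi z =
  \int[mu]_(tau in `[s, t]) phi (y, tau) - \int[mu]_(tau in `[s, t]) phi (x, tau).
Proof.
move=> xy st sphi; have cphi := smooth_continuous sphi.
have cd := smooth_continuous_dx sphi.
rewrite (fubini_continuous xy st cd).2 -RintegralB//;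
  [|exact/continuous_itv_integrable/continuous_slice2..].
apply: eq_Rintegral => tau _.
exact: (Rintegral_FTC2 xy (fun x' => smooth_is_derive_x x' tau sphi)
  (@continuous_slice1 _ _ tau cd)).
Qed.

Variables (a b T : R).
Hypotheses (ab : a < b) (T0 : 0 < T).
Let Q := QT a b T.

Let mQ : measurable Q := measurable_QT a b T.
Let Qfin : ((leb2 R) Q < +oo)%E := measure_QT_lty a b T.

Lemma continuous_integrable_QT phi : continuous phi -> (leb2 R).-integrable Q (EFin \o phi).
Proof.
move=> cphi; have [C HC] := continuous_bounded_rectangle (ltW ab) (ltW T0) cphi.
apply: (@bounded_integrable_rectangle _ _ _ _ C) => //.
- exact: lebesgue_measure_itv_lty.
- exact: lebesgue_measure_itv_lty.
- exact: measurable_funS (measurableT) _ (continuous_measurable_plane cphi).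
- case=> x t [/=]; rewrite !in_itv/= => /andP[i1 i2] /andP[i3 i4].
  by apply: HC; rewrite !ltW.
Qed.

Variables (ux uxx : R * R -> R) (s t : R).
Hypotheses (iux : (leb2 R).-integrable Q (EFin \o ux)).
Hypotheses (iuxx : (leb2 R).-integrable Q (EFin \o uxx)).
Hypotheses (s0 : 0 <= s) (st : s < t) (tT : t <= T).

Definition flux x := \int[leb2 R]_(z in `]a, x[ `*` `]s, t[) uxx z.

Let rect x y : a <= x -> y <= b -> `]x, y[%classic `*` `]s, t[%classic `<=` Q.
Proof. by move=> ax yb; exact: open_rectangle_sub_QT. Qed.

Let mrect x y : measurable (`]x, y[%classic `*` `]s, t[%classic : set (R * R)).
Proof. exact: measurableX. Qed.

Lemma flux_a : flux a = 0.
Proof.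
rewrite /flux (_ : `]a, a[%classic `*` _ = set0) ?Rintegral_set0//.
by apply/seteqP; split => // z [/=]; rewrite in_itv/= => /andP[h1 h2] _; lra.
Qed.

Section approximants.
Variable phi_ : nat -> R * R -> R.
Hypotheses (sphi : forall n, smooth (phi_ n)).
Hypothesis cv0 : cvg_L2 (leb2 R) Q phi_ ux.
Hypothesis cv1 : cvg_L2 (leb2 R) Q (fun n => 'D_(dir_x R) (phi_ n)) uxx.

Let gam n x := \int[mu]_(tau in `[s, t]) phi_ n (x, tau).
Let eps n := \int[leb2 R]_(z in Q) `|'D_(dir_x R) (phi_ n) z - uxx z|.

Let eps_cv : eps n @[n --> \oo] --> 0.
Proof.
apply: cvg_L2_L1 cv1 => // n.
exact/continuous_integrable_QT/smooth_continuous_dx.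
Qed.

Lemma gamB n x y : a <= x -> x <= y -> y <= b ->
  `|(gam n y - gam n x) - \int[leb2 R]_(z in `]x, y[ `*` `]s, t[) uxx z| <= eps n.
Proof.
move=> ax xy yb; rewrite /gam -(smooth_rectangle xy (ltW st) (sphi n)).
have id := continuous_integrable_QT (smooth_continuous_dx (sphi n)).
exact: (@Rintegral_sub_dist _ _ R (leb2 R) Q mQ _ uxx _ (mrect x y) (rect ax yb) id iuxx).
Qed.

Lemma fluxB x y : a <= x -> x <= y -> y <= b ->
  \int[leb2 R]_(z in `]x, y[ `*` `]s, t[) uxx z = flux y - flux x.
Proof.
move=> ax xy yb.
have lim x' y' : a <= x' -> x' <= y' -> y' <= b -> gam n y' - gam n x' @[n --> \oo] -->
    \int[leb2 R]_(z in `]x', y'[ `*` `]s, t[) uxx z.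
  move=> h1 h2 h3; apply/cvgrPdist_le => e e0.
  have /cvgrPdist_le /(_ _ e0) := eps_cv; apply: filterS => n.
  rewrite sub0r normrN => h; rewrite distrC; apply: le_trans (gamB n h1 h2 h3) _.
  exact: le_trans (ler_norm _) h.
have aa := lexx a.
have l1 := lim a y aa (le_trans ax xy) yb.
have l2 := lim a x aa ax (le_trans xy yb).
have l3 := lim x y ax xy yb.
apply: cvg_unique l3 _ => //.
rewrite /= (_ : (fun n => gam n y - gam n x) =
  (fun n => (gam n y - gam n a) - (gam n x - gam n a))); first exact: cvgB.
by apply/funext => n; ring.
Qed.

Lemma flux_bounded x : a <= x <= b -> `|flux x| <= \int[leb2 R]_(z in Q) `|uxx z|.
Proof.
move=> /andP[ax xb].
have i0 : (leb2 R).-integrable Q (EFin \o (fun=> 0 : R)) by exact: integrable_Rcst.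
have := @Rintegral_sub_dist _ _ _ (leb2 R) Q mQ uxx (fun=> 0) _ (mrect a x)
  (rect (lexx a) xb) iuxx i0.
rewrite Rintegral_zero subr0 => /le_trans; apply.
by under eq_Rintegral do rewrite subr0.
Qed.

Lemma flux_integrable : mu.-integrable `[a, b] (EFin \o flux).
Proof.
apply: measurable_bounded_integrable => //.
- exact: lebesgue_measure_itv_lty.
- apply: (@measurable_fun_cvg _ _ _ _ (fun n x => gam n x - gam n a)) => //.
    move=> n; apply: measurable_funS (measurableT) _ _ => //.
    apply: continuous_measurable_fun => x; apply: cvgB; last exact: cvg_cst.
    exact: (continuous_param_integral (ltW st) (smooth_continuous (sphi n))).
  move=> x /=; rewrite in_itv/= => /andP[ax xb].
  apply/cvgrPdist_le => e e0.
  have /cvgrPdist_le /(_ _ e0) := eps_cv; apply: filterS => n.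
  rewrite sub0r normrN => h; rewrite distrC; apply: le_trans (gamB n (lexx a) ax xb) _.
  exact: le_trans (ler_norm _) h.
- exists (\int[leb2 R]_(z in Q) `|uxx z|); split; first exact: num_real.
  move=> M CM x /=; rewrite in_itv/= => /flux_bounded h.
  by apply: le_trans h _; exact: ltW.
Qed.

Lemma flux_trace x0 : x0 = a \/ x0 = b ->
  cvg_L2 mu `]0, T[ (fun n tau => phi_ n (x0, tau)) (cst 0) ->
  forall x y, a <= x -> x < y -> y <= b ->
  \int[leb2 R]_(z in `]x, y[ `*` `]s, t[) ux z = \int[mu]_(z in `[x, y]) (flux z - flux x0).
Proof.
move=> x0ab cvb x y ax xy yb.
have x0I : a <= x0 <= b by case: x0ab => ->; rewrite lexx ltW.
have cphi n := smooth_continuous (sphi n).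
have g0 : gam n x0 @[n --> \oo] --> 0.
  have Tfin := lebesgue_measure_itv_lty false true 0 T.
  have i1 n : mu.-integrable `]0, T[ (EFin \o (fun tau => phi_ n (x0, tau))).
    have fi := continuous_itv_integrable 0 T (@continuous_slice2 _ _ x0 (cphi n)).
    by apply: integrableS fi => //; exact: subset_itv_oo_cc.
  have i2 : mu.-integrable `]0, T[ (EFin \o (cst 0 : R -> R)) by exact: integrable_Rcst.
  have L := @cvg_L2_L1 _ _ R mu `]0, T[%classic (measurable_itv _) Tfin _ _ i1 i2 cvb.
  apply/cvgrPdist_le => e e0.
  have /cvgrPdist_le /(_ _ e0) := L; apply: filterS => n.
  rewrite !sub0r !normrN => h; apply: le_trans (le_trans (ler_norm _) h).
  have sub : `]s, t[%classic `<=` `]0, T[%classic.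
    by apply: subset_itvSoo; rewrite bnd_simp.
  have := @Rintegral_sub_dist _ _ R mu `]0, T[%classic (measurable_itv _) _ _ _
    (measurable_itv `]s, t[) sub (i1 n) i2.
  rewrite Rintegral_zero subr0 Rintegral_itv_oo_cc//.
  exact/continuous_itv_integrable/continuous_slice2.
have L1 : \int[mu]_(z in `[x, y]) gam n z @[n --> \oo] -->
    \int[leb2 R]_(z in `]x, y[ `*` `]s, t[) ux z.
  have iphi n := continuous_integrable_QT (cphi n).
  have L := @cvg_L2_L1 _ _ R (leb2 R) Q mQ Qfin _ _ iphi iux cv0.
  apply/cvgrPdist_le => e e0.
  have /cvgrPdist_le /(_ _ e0) := L; apply: filterS => n.
  rewrite sub0r normrN => h; rewrite distrC; apply: le_trans (le_trans (ler_norm _) h).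
  rewrite -(fubini_continuous (ltW xy) (ltW st) (cphi n)).1.
  exact: (@Rintegral_sub_dist _ _ R (leb2 R) Q mQ _ _ _ (mrect x y) (rect ax yb) (iphi n) iux).
have ifl : mu.-integrable `[x, y] (EFin \o (fun z => flux z - flux x0)).
  apply: integrable_RB => //.
    by apply: integrableS flux_integrable => //; apply: subset_itvScc; rewrite bnd_simp.
  by apply: integrable_Rcst => //; exact: lebesgue_measure_itv_lty.
apply: cvg_unique L1 _ => //.
apply/cvgrPdist_le => e e0.
have xy0 : 0 < y - x by rewrite subr_gt0.
have e1 : 0 < e / 2 / (y - x) by rewrite !divr_gt0.
have /cvgrPdist_le /(_ _ e1) n1 := eps_cv.
have /cvgrPdist_le /(_ _ e1) n2 := g0.
near=> n.
have h1 : eps n <= e / 2 / (y - x).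
  by apply: le_trans (ler_norm _) _; rewrite -normrN -sub0r; near: n; exact: n1.
have h2 : `|gam n x0| <= e / 2 / (y - x).
  by rewrite -normrN -sub0r; near: n; exact: n2.
have cg : continuous (gam n) by exact: continuous_param_integral (ltW st) (cphi n).
rewrite distrC -RintegralB//; last exact: continuous_itv_integrable.
have -> : e = (e / 2 / (y - x) + e / 2 / (y - x)) * (y - x) by field; rewrite gt_eqF.
apply: Rintegral_itv_norm_le; first exact: ltW.
  by apply: integrable_RB => //; exact: continuous_itv_integrable.
move=> z /andP[xz zy].
have az : a <= z by exact: le_trans xz.
have zb : z <= b by exact: le_trans yb.
have h3 : `|gam n z - gam n x0 - (flux z - flux x0)| <= eps n.
  case: x0ab x0I => -> _.
    by rewrite -fluxB//; exact: gamB.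
  have := gamB n az zb (lexx b); rewrite fluxB// => h; rewrite -normrN.
  by rewrite (_ : - (gam n z - gam n b - (flux z - flux b)) =
    gam n b - gam n z - (flux b - flux z)) //; ring.
have -> : gam n z - (flux z - flux x0) = (gam n z - gam n x0 - (flux z - flux x0)) + gam n x0.
  by ring.
apply: le_trans (ler_normD _ _) _; apply: lerD => //.
exact: le_trans h1.
Unshelve. all: by end_near. Qed.

End approximants.

End flux.

(* The Neumann condition at [b] enters as [flux b = 0]: both traces represent the
   same function [x |-> \int u(x, .)], with fluxes that differ by [flux b]. *)
Lemma solution_flux (R : realType) (a b T : R) (u ux uxx ut p f : R * R -> R) :
  a < b -> 0 < T -> W212 a b T u ux uxx ut ->
  side_trace a b T a ux uxx (cst 0) -> side_trace a b T b ux uxx (cst 0) ->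
  continuous p -> (forall z, QT a b T z -> p z = u z) ->
  (leb2 R).-integrable (QT a b T) (EFin \o f) ->
  {ae leb2 R, forall z, QT a b T z -> ut z = uxx z + f z} ->
  forall s t : R, 0 <= s -> s < t -> t <= T -> exists G : R -> R,
    [/\ G a = 0, G b = 0, lebesgue_measure.-integrable `[a, b] (EFin \o G),
       (forall x y, a <= x -> x <= y -> y <= b ->
         \int[lebesgue_measure]_(tau in `[s, t]) p (y, tau) -
         \int[lebesgue_measure]_(tau in `[s, t]) p (x, tau) =
         \int[lebesgue_measure]_(z in `[x, y]) G z) &
       (forall x y, a <= x -> x <= y -> y <= b ->
         G y - G x = \int[lebesgue_measure]_(z in `[x, y]) (p (z, t) - p (z, s)) -
         \int[leb2 R]_(z in `]x, y[ `*` `]s, t[) f z)].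
Proof.
move=> ab T0 [Lu [Lux wux] [Luxx wuxx] [Lut wut]].
move=> [phia [sa a0 a1 atr]] [phib [sb b0 b1 btr]] cp pu fi ae s t s0 st tT.
pose Q := QT a b T.
have mQ : measurable Q := measurable_QT a b T.
have Qfin : ((leb2 R) Q < +oo)%E := measure_QT_lty a b T.
have iux := @L2_integrable _ _ R (leb2 R) Q mQ Qfin _ Lux.
have iuxx := @L2_integrable _ _ R (leb2 R) Q mQ Qfin _ Luxx.
have iut := @L2_integrable _ _ R (leb2 R) Q mQ Qfin _ Lut.
have mrect x y : measurable (`]x, y[%classic `*` `]s, t[%classic : set (R * R)).
  exact: measurableX.
pose G := flux a uxx s t.
have iG : lebesgue_measure.-integrable `[a, b] (EFin \o G).
  exact: (flux_integrable ab T0 iuxx s0 st tT sa a1).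
have GB := fluxB ab T0 iuxx s0 st tT sa a1.
have ta := flux_trace ab T0 iux iuxx s0 st tT sa a0 a1 (or_introl erefl) atr.
have tb := flux_trace ab T0 iux iuxx s0 st tT sb b0 b1 (or_intror erefl) btr.
have G0 : G a = 0 by exact: flux_a.
have Gb : G b = 0.
  have e1 c : \int[lebesgue_measure]_(z in `[a, b]) (G z - G c) =
      \int[lebesgue_measure]_(z in `[a, b]) G z - G c * (b - a).
    have ic : lebesgue_measure.-integrable `[a, b] (EFin \o (fun=> G c)).
      by apply: continuous_itv_integrable => x; exact: cvg_cst.
    by rewrite (RintegralB _ iG ic) ?(Rintegral_itv_cst _ (ltW ab)).
  have e2 := ta a b (lexx a) ab (lexx b).
  have := tb a b (lexx a) ab (lexx b); rewrite e2 (e1 a) (e1 b) G0 mul0r.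
  move=> /addrI /oppr_inj /esym /eqP; rewrite mulf_eq0 => /orP[/eqP//|].
  by rewrite subr_eq0 gt_eqF.
exists G; split => //.
- move=> x y ax; rewrite le_eqVlt => /predU1P[->|xy] yb.
    by rewrite subrr set_itv1 Rintegral_set1.
  rewrite -RintegralB//; [|exact/continuous_itv_integrable/continuous_slice2..].
  rewrite -(weak_rectangle_x wux iux cp pu ax xy yb s0 st tT) ta//.
  by apply: eq_Rintegral => z _; rewrite -/(G a) G0 subr0.
- move=> x y ax; rewrite le_eqVlt => /predU1P[->|xy] yb.
    rewrite subrr set_itv1 Rintegral_set1 (_ : `]y, y[%classic `*` _ = set0).
      by rewrite Rintegral_set0 subrr.
    by apply/seteqP; split => // z [/=]; rewrite in_itv/= => /andP[h1 h2] _; lra.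
  rewrite -(weak_rectangle_t wut iut cp pu ax xy yb s0 st tT) -/(G y) -/(G x)
    -(GB x y ax (ltW xy) yb).
  have rQ : `]x, y[%classic `*` `]s, t[%classic `<=` Q by exact: open_rectangle_sub_QT.
  have iut' := @integrableS _ _ R (leb2 R) Q _ _ mQ (mrect x y) rQ iut.
  have fi' := @integrableS _ _ R (leb2 R) Q _ _ mQ (mrect x y) rQ fi.
  rewrite -(@RintegralB _ _ R (leb2 R) _ _ _ (mrect x y) iut' fi').
  congr fine; apply: (@ae_eq_integral _ _ R (leb2 R) _ _ _ (mrect x y)).
  + exact: measurable_int (@integrableS _ _ R (leb2 R) Q _ _ mQ (mrect x y) rQ iuxx).
  + exact: measurable_int (@integrable_RB _ _ R (leb2 R) _ (mrect x y) _ _ iut' fi').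
  + apply: filterS ae; first exact: (ae_filter_ringOfSetsType (leb2 R)).
    by move=> z H /rQ /H /= ->; rewrite addrK.
Qed.

Section relay.
Variable R : realType.
Implicit Types (r w : R -> R) (a b x t : R).

Lemma relay_ext (r0 : R -> R) w w' x t : (forall s, 0 <= s <= t -> w s = w' s) ->
  relay r0 w x t = relay r0 w' x t.
Proof.
move=> ww'; rewrite /relay.
have E (P : R -> R -> Prop) (Q : R -> Prop) :
  `[< exists2 tau, tau \in `[0, t] & P tau (w tau) /\ forall s, s \in `[tau, t] -> Q (w s) >] =
  `[< exists2 tau, tau \in `[0, t] & P tau (w' tau) /\ forall s, s \in `[tau, t] -> Q (w' s) >].
  apply: asbool_equiv_eq; split=> -[tau tau0 [h1 h2]]; exists tau => //;
    have /andP[t0 t1] : 0 <= tau <= t by move: tau0; rewrite in_itv.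
  - split; first by rewrite -ww' ?t0.
    move=> s sI; have /andP[s1 s2] : tau <= s <= t by move: sI; rewrite in_itv.
    have <- : w s = w' s by apply: ww'; rewrite s2 (le_trans t0 s1).
    exact: h2.
  - split; first by rewrite ww' ?t0.
    move=> s sI; have /andP[s1 s2] : tau <= s <= t by move: sI; rewrite in_itv.
    have -> : w s = w' s by apply: ww'; rewrite s2 (le_trans t0 s1).
    exact: h2.
by rewrite (E (fun _ y => y < - x) (fun y => y < x)) (E (fun _ y => x <= y) (fun y => - x <= y)).
Qed.

Lemma relay_pm1 (r0 : R -> R) w a b x t :
  (forall x, x \in `[a, b] -> r0 x = -1 \/ r0 x = 1) -> a <= x <= b ->
  relay r0 w x t = -1 \/ relay r0 w x t = 1.
Proof.
move=> H xab; rewrite /relay; case: ifPn => _; first by left.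
by case: ifPn => _; [right|apply: H; rewrite in_itv].
Qed.

(* Beyond its threshold [x] the input imposes its own sign, and [x <= b]. *)
Lemma relay_lower (r0 : R -> R) w a b x t :
  (forall x, x \in `[a, b] -> r0 x = -1 \/ r0 x = 1) ->
  0 < a -> a <= x <= b -> 0 <= t -> - b <= w t * relay r0 w x t.
Proof.
move=> H a0 /[dup] xab /andP[ax xb] t0.
have tI : t \in `[0, t] by rewrite in_itv/= t0 lexx.
have tt s : s \in `[t, t] -> s = t.
  by rewrite in_itv/= => /andP[h1 h2]; apply/eqP; rewrite eq_le h1 h2.
have [wb|wb] := ltP b (w t).
  suff -> : relay r0 w x t = 1 by lra.
  rewrite /relay ifF; last first.
    apply/negbTE/negP => /asboolP[tau]; rewrite in_itv/= => /andP[_ h1] [_ h2].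
    have : w t < x by apply: h2; rewrite in_itv/= h1 lexx.
    lra.
  rewrite ifT//; apply/asboolP; exists t => //; split; first by lra.
  by move=> s /tt ->; lra.
have [wb'|wb'] := ltP (w t) (- b).
  suff -> : relay r0 w x t = -1 by lra.
  rewrite /relay ifT//; apply/asboolP; exists t => //; split; first by lra.
  by move=> s /tt ->; lra.
by have [->|->] := relay_pm1 w t H xab; lra.
Qed.

Lemma relay_exhaustive w x t : continuous w -> 0 < x -> 0 <= t ->
  ~ (exists2 tau, tau \in `[0, t] & w tau < - x /\ forall s, s \in `[tau, t] -> w s < x) ->
  ~ (exists2 tau, tau \in `[0, t] & x <= w tau /\ forall s, s \in `[tau, t] -> - x <= w s) ->
  forall s, 0 <= s <= t -> - x <= w s < x.
Proof.
move=> cw x0 t0 n1 n2.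
have D1 s : 0 <= s <= t -> w s < x.
  move=> s0t; rewrite ltNge; apply/negP => xws.
  pose S := `[0, t]%classic `&` [set s | x <= w s].
  have [|||tau] := @compact_EVT_max _ R id S.
  - by exists s; split; rewrite //= in_itv.
  - apply: compact_closedI; first exact: segment_compact.
    by apply: (@closed_comp _ _ w [set y | x <= y]) => //; exact: closed_ge.
  - by apply: continuous_subspaceT => y; exact: cvg_id.
  rewrite inE => -[/=]; rewrite in_itv/= => /andP[tau0 taut] xtau smax.
  apply: n2; exists tau; first by rewrite in_itv/= tau0.
  split=> // s'; rewrite in_itv/= => /andP[s1 s2].
  rewrite leNgt; apply/negP => ws'.
  apply: n1; exists s'; first by rewrite in_itv/= s2 (le_trans tau0).
  split=> // s''; rewrite in_itv/= => /andP[s3 s4].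
  rewrite ltNge; apply/negP => xs''.
  have h : s'' <= tau.
    apply: smax; rewrite inE; split => //=.
    by rewrite in_itv/= s4 (le_trans tau0)// (le_trans s1).
  have E : s' = tau by apply/eqP; rewrite eq_le s1 (le_trans s3 h).
  by move: ws'; rewrite E; lra.
move=> s /[dup] s0t /andP[s0 st]; rewrite D1// andbT leNgt; apply/negP => ws.
apply: n1; exists s; first by rewrite in_itv.
by split=> // s'; rewrite in_itv/= => /andP[s1 s2]; apply: D1; rewrite s2 (le_trans s0).
Qed.

Lemma open_forall_homothety w (a b : R) : continuous w ->
  open [set z : R * R | forall th, a <= th <= b -> w (th * z.2) < z.1].
Proof.
move=> cw; rewrite openE => z Hz; rewrite /interior/=.
have H := (compact_near_coveringP `[a, b]%classic).1 (@segment_compact R a b) _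
  (nbhs z) (fun z th => w (th * z.2) < z.1) _.
suff L : forall th, `[a, b]%classic th ->
    \forall th' \near th & z' \near nbhs z, w (th' * z'.2) < z'.1.
  apply: (@filterS _ (nbhs z) _ _ _ _ (H _ L)) => z' Hz' th thI.
  by apply: (Hz' th); rewrite /= in_itv.
move=> th /=; rewrite in_itv/= => thI.
have c1 : (fun y : R * (R * R) => y.2.1 - w (y.1 * y.2.2)) @ (th, z) --> z.1 - w (th * z.2).
  apply: cvgB.
    by apply: (@cvg_comp _ _ _ snd fst _ (nbhs z)); [exact: cvg_snd|exact: cvg_fst].
  apply: (@cvg_comp _ _ _ (fun y : R * (R * R) => y.1 * y.2.2) w _ (nbhs (th * z.2))).
    apply: cvgM; first exact: cvg_fst.
    by apply: (@cvg_comp _ _ _ snd snd _ (nbhs z)); [exact: cvg_snd|exact: cvg_snd].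
  exact: cw.
have lt0 : 0 < z.1 - w (th * z.2) by rewrite subr_gt0 Hz.
have /cvgr_gt /(_ _ lt0) := c1.
by apply: filterS => y; rewrite subr_gt0.
Qed.

Lemma closed_forall_homothety w : continuous w ->
  closed [set z : R * R | forall th, 0 <= th <= 1 -> - z.1 <= w (th * z.2)].
Proof.
move=> cw.
rewrite (_ : [set _ | _] = \bigcap_(th in `[0, 1]%classic)
   [set z : R * R | 0 <= w (th * z.2) + z.1]).
  apply: closed_bigI => th _.
  apply: (@closed_comp _ _ (fun z : R * R => w (th * z.2) + z.1) [set y | 0 <= y]);
    last exact: closed_ge.
  move=> z _; apply: cvgD; last exact: cvg_fst.
  apply: (@cvg_comp _ _ _ (fun z : R * R => th * z.2) w _ (nbhs (th * z.2))); last exact: cw.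
  by apply: cvgM; [exact: cvg_cst|exact: cvg_snd].
apply/seteqP; split=> z H th.
  by rewrite /= in_itv/= => thI; rewrite addrC -lerBlDl sub0r H.
by move=> thI; rewrite -sub0r lerBlDl addrC; apply: H; rewrite /= in_itv.
Qed.

Lemma simple_state_measurable (A : set R) : simple_state A -> measurable A.
Proof.
move=> [n [xm [xp [_ _ ->]]]]; apply: fin_bigcup_measurable; first exact: finite_finset.
by move=> k _; exact: measurable_itv.
Qed.

Section relay_measurable.
Variables (r0 w : R -> R) (a b w0 : R).
Hypotheses (a0 : 0 < a) (cw : continuous w) (ww0 : w 0 = w0).
Hypothesis r0_pm1 : forall x, x \in `[a, b] -> r0 x = -1 \/ r0 x = 1.
Hypothesis A0_simple : simple_state (state a b r0 (cst w0) 0).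

Let B : set (R * R) := \bigcup_(sg in `[0, 1]%classic)
  ([set z : R * R | w (sg * z.2) < - z.1] `&`
   [set z : R * R | forall th, sg <= th <= 1 -> w (th * z.2) < z.1]).
Let D1 : set (R * R) := [set z | forall th, 0 <= th <= 1 -> w (th * z.2) < z.1].
Let D2 : set (R * R) := [set z | forall th, 0 <= th <= 1 -> - z.1 <= w (th * z.2)].
Let M : set (R * R) := B `|` ((D1 `&` D2) `\` ((state a b r0 (cst w0) 0) `*` setT)).

Let mM : measurable M.
Proof.
apply: measurableU.
  apply: open_measurable_plane; apply: bigcup_open => sg _; apply: openI.
    rewrite (_ : [set _ | _] =
        (fun z : R * R => - z.1 - w (sg * z.2)) @^-1` [set y | 0 < y]).
      apply: open_comp; last exact: open_gt.
      move=> z _; apply: cvgB; first by apply: cvgN; exact: cvg_fst.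
      apply: (@cvg_comp _ _ _ (fun z : R * R => sg * z.2) w _ (nbhs (sg * z.2))); last exact: cw.
      by apply: cvgM; [exact: cvg_cst|exact: cvg_snd].
    by apply/seteqP; split => z /=; rewrite subr_gt0.
  exact: open_forall_homothety.
apply: measurableD; last by apply: measurableX => //; exact: simple_state_measurable.
apply: measurableI; first by apply: open_measurable_plane; exact: open_forall_homothety.
by apply: closed_measurable_plane; exact: closed_forall_homothety.
Qed.

Lemma relayE (x t : R) : a <= x <= b -> 0 < t ->
  relay r0 w x t = 1 - 2 * \1_M (x, t).
Proof.
move=> xab t0; have x0 : 0 < x by case/andP: xab => h _; exact: lt_le_trans h.
have BP : (exists2 tau, tau \in `[0, t] & w tau < - x /\
    forall s, s \in `[tau, t] -> w s < x) <-> B (x, t).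
  split.
  - move=> [tau]; rewrite in_itv/= => /andP[h1 h2] [h3 h4].
    exists (tau / t).
      by rewrite /= in_itv/= divr_ge0 ?(ltW t0)//= ler_pdivrMr// mul1r.
    split; rewrite /= ?divfK ?gt_eqF// => th /andP[g1 g2].
    apply: h4; rewrite in_itv/= -ler_pdivrMr// g1/=.
    by rewrite ger_pMl.
  - move=> [sg]; rewrite /= in_itv/= => /andP[h1 h2] [/= h3 h4].
    exists (sg * t); first by rewrite in_itv/= mulr_ge0 ?(ltW t0)//= ger_pMl.
    split=> // s; rewrite in_itv/= => /andP[g1 g2].
    have := h4 (s / t); rewrite divfK ?gt_eqF//; apply.
    by rewrite ler_pdivlMr// g1 ler_pdivrMr// mul1r.
rewrite /relay; case: ifPn => [/asboolP/BP Bz|/asboolP nB].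
  rewrite indicE mem_set; last by left.
  by rewrite mulr1; ring.
have nBz : ~ B (x, t) by move/BP.
case: ifPn => [/asboolP[tau]|/asboolP nC].
  rewrite in_itv/= => /andP[h1 h2] [h3 _].
  rewrite indicE memNset; first by rewrite mulr0 subr0.
  move=> [//|[[d1 _] _]].
  have := d1 (tau / t); rewrite /= divfK ?gt_eqF// => d.
  have : w tau < x by apply: d; rewrite divr_ge0 ?(ltW t0)//= ler_pdivrMr// mul1r.
  lra.
have ex := relay_exhaustive cw x0 (ltW t0) nB nC.
have d12 : (D1 `&` D2) (x, t).
  split=> th /andP[g1 g2] /=; have /andP[e1 e2] : - x <= w (th * t) < x; rewrite ?e1 ?e2//;
  by apply: ex; rewrite mulr_ge0 ?(ltW t0)//= ger_pMl.
have /andP[w1 w2] : - x <= w 0 < x by apply: ex; rewrite lexx ltW.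
have st : state a b r0 (cst w0) 0 x <-> r0 x = 1.
  have -> : state a b r0 (cst w0) 0 x = (x \in `[a, b] /\ r0 x = 1).
    rewrite /state/=; congr (_ /\ _ = _); rewrite /relay ifF; last first.
      by apply/negbTE/negP => /asboolP[tau _ [+ _]]; rewrite /cst -ww0; lra.
    rewrite ifF//; apply/negbTE/negP => /asboolP[tau _ [+ _]]; rewrite /cst -ww0; lra.
  by split=> [[]//|]; rewrite in_itv.
have xI : x \in `[a, b] by rewrite in_itv.
rewrite indicE; have [h|h] := r0_pm1 xI.
  rewrite h mem_set; first by rewrite mulr1; ring.
  right; split => // -[/= /st]; rewrite h; lra.
rewrite h memNset; first by rewrite mulr0 subr0.
by move=> [//|[_ []]]; split => //=; exact/st.
Qed.

Lemma measurable_relay (T : R) :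
  measurable_fun (`[a, b] `*` `]0, T[) (fun z : R * R => relay r0 w z.1 z.2).
Proof.
apply: (@eq_measurable_fun _ _ _ _ _ (fun z : R * R => (1 - 2 * \1_M z : R))).
  case=> x t /set_mem[/=]; rewrite !in_itv/= => xab /andP[t0 _].
  by rewrite relayE.
by apply: measurable_funB => //; apply: measurable_funM.
Qed.

End relay_measurable.

End relay.

Lemma continuous_le_right (R : realType) (f : R -> R) (c s t : R) :
  continuous f -> s < t -> (forall r, s <= r < t -> f r <= c) -> f t <= c.
Proof.
move=> cf st fc; rewrite leNgt; apply/negP => ct.
have /cvgrPdist_lt /(_ (f t - c)) := cf t; rewrite subr_gt0 => /(_ ct).
move=> /nbhs_ballP[e /= e0 he].
have s' : s <= Num.max s (t - e / 2) < t.
  by rewrite le_max lexx /= gt_max st /=; lra.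
have := he (Num.max s (t - e / 2)).
have [m1 m2] : t - e / 2 <= Num.max s (t - e / 2) /\ Num.max s (t - e / 2) < t.
  by split; [rewrite le_max lexx orbT|case/andP: s'].
move: (fc _ s') m1 m2; move: (Num.max _ _) => r fr m1 m2.
rewrite /ball /= ger0_norm; last lra.
move=> /(_ ltac:(lra)); rewrite ltr_norml => /andP[_ h].
by move: fr h; lra.
Qed.

Lemma continuous_modulus (R : realType) (h : R -> R) (a b e : R) :
  continuous h -> 0 < e -> exists2 B : R, 0 < B & forall x y : R, a <= x -> x <= y -> y <= b ->
  `|h y - h x| <= e + B * (y - x).
Proof.
move=> ch e0.
pose g (z : R * R) := `|h z.2 - h z.1|.
have cg : continuous g.
  move=> z; apply: (@continuous_comp _ _ _ (fun z : R * R => h z.2 - h z.1) Num.norm).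
    apply: cvgB.
      by apply: (@continuous_comp _ _ _ snd h); [exact: cvg_snd|exact: ch].
    by apply: (@continuous_comp _ _ _ fst h); [exact: cvg_fst|exact: ch].
  exact: norm_continuous.
pose K : set (R * R) := (`[a, b]%classic `*` `[a, b]%classic) `&` (g @^-1` [set r | e <= r]).
have cK : compact K.
  apply: compact_closedI; first by apply: compact_setX; exact: segment_compact.
  by apply: closed_comp; [move=> z _; exact: cg|exact: closed_ge].
have KP x y : a <= x -> x <= y -> y <= b -> e <= `|h y - h x| -> K (x, y).
  move=> ax xy yb exy; split; last by [].
  by split; rewrite /= in_itv/=; apply/andP; split => //; [exact: le_trans yb|exact: le_trans xy].
have [K0|/set0P[z0 Kz0]] := eqVneq K set0.
  exists 1 => // x y ax xy yb; rewrite mul1r.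
  have [exy|/ltW exy] := leP e `|h y - h x|; last by move: xy exy; lra.
  by have := KP _ _ ax xy yb exy; rewrite K0.
have cd : continuous (fun z : R * R => - `|z.2 - z.1|).
  move=> z; apply: cvgN; apply: (@continuous_comp _ _ _ (fun z : R * R => z.2 - z.1) Num.norm).
    by apply: cvgB; [exact: cvg_snd|exact: cvg_fst].
  exact: norm_continuous.
have [zd /set_mem Kd dmin] := compact_EVT_max (ex_intro _ z0 Kz0) cK (continuous_subspaceT cd).
have [zm /set_mem Km gmax] := compact_EVT_max (ex_intro _ z0 Kz0) cK (continuous_subspaceT cg).
pose d := `|zd.2 - zd.1|.
have d0 : 0 < d.
  rewrite /d normr_gt0 subr_eq0; apply/eqP => E; case: Kd => _ /=.
  by rewrite /g E subrr normr0; move: e0; lra.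
have gm0 : 0 <= g zm by rewrite /g.
exists (g zm / d + 1) => [|x y ax xy yb]; first by rewrite ltr_wpDl// divr_ge0// ltW.
have z0' : 0 <= y - x by rewrite subr_ge0.
have B0 : 0 <= g zm / d + 1 by rewrite addr_ge0// divr_ge0// ltW.
have [exy|/ltW exy] := leP e `|h y - h x|; last first.
  by apply: le_trans exy _; rewrite lerDl mulr_ge0.
have Kxy := mem_set (KP _ _ ax xy yb exy).
have h1 := gmax _ Kxy; have := dmin _ Kxy; rewrite /= lerN2 -/d ger0_norm// => h2.
apply: le_trans h1 _.
have : g zm / d * d <= g zm / d * (y - x) by apply: ler_wpM2l => //; rewrite divr_ge0// ltW.
rewrite divfK ?gt_eqF// mulrDl mul1r; move: e0 z0'; lra.
Qed.

Lemma expR_small (R : realType) (l B e : R) : 0 < l -> 0 <= B -> 0 < e ->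
  exists2 S : R, 0 <= S & forall s : R, S <= s -> B * expR (- l * s) <= e.
Proof.
move=> l0 B0 e0; exists (B / e / l) => [|s Ss].
  by apply: divr_ge0; [apply: divr_ge0 => //|]; exact: ltW.
rewrite mulNr expRN ler_pdivrMr ?expR_gt0// mulrC -ler_pdivrMr//.
apply: le_trans (expR_ge1Dx _).
by move: Ss; rewrite ler_pdivrMr// [s * l]mulrC; lra.
Qed.

Section asymptotics.
Variable R : realType.
Notation mu := (@lebesgue_measure R).
Variables (a b k : R) (p q : R * R -> R) (v : R -> R).
Hypotheses (ab : a < b) (k0 : 0 < k) (cp : continuous p) (cv : continuous v).
Hypothesis v_ge0 : forall t : R, 0 <= t -> 0 <= v t.
Hypothesis q_bound : forall x t : R, a <= x <= b -> 0 < t -> k * v t <= q (x, t) <= v t.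
Let f z := q z * p z.
Hypothesis fi : forall T : R, 0 < T -> (leb2 R).-integrable (QT a b T) (EFin \o f).
Let Phi x y s t := \int[leb2 R]_(z in `]x, y[ `*` `]s, t[) f z.
Hypothesis pflux : forall s t : R, 0 <= s -> s < t -> exists G : R -> R,
    [/\ G a = 0, G b = 0, mu.-integrable `[a, b] (EFin \o G),
       (forall x y, a <= x -> x <= y -> y <= b ->
         \int[mu]_(tau in `[s, t]) p (y, tau) - \int[mu]_(tau in `[s, t]) p (x, tau) =
         \int[mu]_(z in `[x, y]) G z) &
       (forall x y, a <= x -> x <= y -> y <= b ->
         G y - G x = \int[mu]_(z in `[x, y]) (p (z, t) - p (z, s)) - Phi x y s t)].
Hypothesis mass : forall s t : R, 0 <= s -> s < t -> Phi a b s t = v s - v t.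
Hypothesis p0_ge0 : forall x, a <= x <= b -> 0 <= p (x, 0).
Let U t := \int[mu]_(x in `[a, b]) p (x, t).
Hypothesis U0_gt0 : 0 < U 0.

Lemma Phi_le (sg : R) (g : R * R -> R) (x y s t : R) : a <= x -> x <= y -> y <= b ->
  0 <= s -> s < t -> continuous g ->
  (forall z tau : R, a <= z <= b -> s < tau -> tau < t -> sg * f (z, tau) <= g (z, tau)) ->
  sg * Phi x y s t <= \int[leb2 R]_(z in `]x, y[ `*` `]s, t[) g z.
Proof.
move=> ax xy yb s0 st cg fg.
have t0 : 0 < t by exact: le_lt_trans st.
pose D : set (R * R) := `]x, y[ `*` `]s, t[.
have mD : measurable D by exact: measurableX.
have mQ : measurable (QT a b t) := measurable_QT a b t.
have DQ : D `<=` QT a b t by apply: open_rectangle_sub_QT.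
have ifD := @integrableS _ _ R (leb2 R) (QT a b t) _ _ mQ mD DQ (fi t0).
have igD := @integrableS _ _ R (leb2 R) (QT a b t) _ _ mQ mD DQ (continuous_integrable_QT ab t0 cg).
have isD := @integrable_RZ _ _ R (leb2 R) D mD sg f ifD.
rewrite /Phi -(@RintegralZl _ _ R (leb2 R) D f sg mD ifD).
have := @le_Rintegral _ _ R (leb2 R) D (fun z => sg * f z) g mD isD igD; apply => -[z tau] [] /=.
rewrite !in_itv/= => /andP[z1 z2] /andP[t1 t2]; apply: fg => //.
by rewrite (le_trans ax (ltW z1)) (le_trans (ltW z2) yb).
Qed.

Lemma Phi_le_time (sg : R) (c : R -> R) (x y s t : R) : a <= x -> x <= y -> y <= b ->
  0 <= s -> s < t -> continuous c ->
  (forall z tau : R, a <= z <= b -> s < tau -> tau < t -> sg * f (z, tau) <= c tau) ->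
  sg * Phi x y s t <= (\int[mu]_(tau in `[s, t]) c tau) * (y - x).
Proof.
move=> ax xy yb s0 st cc fc.
have cg : continuous (fun z : R * R => c z.2).
  by move=> z; apply: continuous_comp; [exact: cvg_snd|exact: cc].
apply: le_trans (Phi_le ax xy yb s0 st cg fc) _.
rewrite (fubini_continuous xy (ltW st) cg).1 /= -Rintegral_itv_cst//.
Qed.

Lemma solution_subheat (sg : R) (Gam : R -> R) (t0 t1 : R) : 0 <= t0 -> continuous Gam ->
  (forall x y s t : R, a <= x -> x <= y -> y <= b -> t0 <= s -> s < t -> t <= t1 ->
     sg * Phi x y s t <= (Gam t - Gam s) * (y - x)) ->
  subheat a b t0 t1 (fun z => sg * p z - Gam z.2).
Proof.
move=> t00 cG hG.
have cgam : continuous (fun z : R * R => Gam z.2).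
  by move=> z; apply: continuous_comp; [exact: cvg_snd|exact: cG].
have csp : continuous (fun z => sg * p z).
  by move=> z; apply: cvgM; [exact: cvg_cst|exact: cp].
have cpg : continuous (fun z => sg * p z - Gam z.2).
  by move=> z; apply: cvgB; [exact: csp|exact: cgam].
apply: subheat_flux => // s t t0s st tt1.
have s0 : 0 <= s by exact: le_trans t0s.
have [G [Ga Gb iG GI GP]] := pflux s0 st.
have mab : measurable (`[a, b]%classic : set R) by [].
exists (fun x => sg * G x); split.
- by rewrite Ga mulr0.
- by rewrite Gb mulr0.
- exact: integrable_RZ.
- move=> x y ax xy yb.
  have mxy : measurable (`[x, y]%classic : set R) by [].
  have iGxy : mu.-integrable `[x, y] (EFin \o G).
    apply: integrableS iG => //; apply: subset_itv; rewrite bnd_simp //.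
  rewrite RintegralZl// -GI//.
  have E z : \int[mu]_(tau in `[s, t]) (sg * p (z, tau) - Gam tau) =
    sg * \int[mu]_(tau in `[s, t]) p (z, tau) - \int[mu]_(tau in `[s, t]) Gam tau.
    have i1 : mu.-integrable `[s, t] (EFin \o (fun tau => p (z, tau))).
      by apply: continuous_itv_integrable; exact: continuous_slice2.
    rewrite RintegralB//; last 2 first.
    - exact: integrable_RZ.
    - exact: continuous_itv_integrable.
    by rewrite RintegralZl.
  by rewrite /= !E; move: (\int[mu]_(tau in _) _); move=> *; ring.
- move=> x y ax xy yb.
  have mxy : measurable (`[x, y]%classic : set R) by [].
  rewrite -mulrBr GP//.
  have i1 r : mu.-integrable `[x, y] (EFin \o (fun z => p (z, r))).
    by apply: continuous_itv_integrable; exact: continuous_slice1.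
  have i2 : mu.-integrable `[x, y] (EFin \o (fun z => p (z, t) - p (z, s))).
    exact: integrable_RB.
  have -> : \int[mu]_(z in `[x, y]) (sg * p (z, t) - Gam t - (sg * p (z, s) - Gam s)) =
    sg * \int[mu]_(z in `[x, y]) (p (z, t) - p (z, s)) - (Gam t - Gam s) * (y - x).
    rewrite -RintegralZl// -Rintegral_itv_cst// -RintegralB//; last 2 first.
    - exact: integrable_RZ.
    - by apply: continuous_itv_integrable => ?; exact: cvg_cst.
    by apply: eq_Rintegral => z _; ring.
  have := hG x y s t ax xy yb t0s st tt1.
  move: (Phi x y s t) (Rintegral _ _ _) => A B; lra.
Qed.

Lemma subheat_max_le (t0 t1 c : R) (g : R * R -> R) : continuous g -> t0 < t1 ->
  subheat a b t0 t1 g -> (forall x, a <= x <= b -> g (x, t0) <= c) ->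
  forall x t, a <= x <= b -> t0 <= t <= t1 -> g (x, t) <= c.
Proof.
move=> cg t01 sg g0 x t xab /andP[tt]; rewrite le_eqVlt => /predU1P[->|tt1].
  apply: (@continuous_le_right _ (fun t => g (x, t)) c t0 t1) => //.
    exact: continuous_slice2.
  by move=> r rr; exact: (subheat_max ab cg sg g0).
by apply: (subheat_max ab cg sg g0) => //; rewrite tt.
Qed.

Lemma p_ge0 (x t : R) : a <= x <= b -> 0 <= t -> 0 <= p (x, t).
Proof.
move=> xab t0; pose T := t + 1.
have T0 : 0 < T by rewrite /T; lra.
have [tv _ vmax] := @EVT_max R v 0 T (ltW T0) (continuous_subspaceT cv).
pose be := 2 * v tv.
have vbe s : 0 <= s <= T -> v s <= be / 2.
  by move=> sT; have := vmax s; rewrite in_itv/= => /(_ sT); rewrite /be; lra.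
have be0 : 0 <= be.
  have := v_ge0 (lexx 0); have := vbe 0; rewrite lexx ltW// => /(_ isT); lra.
pose h z : R := - p z * expR (- be * z.2).
have ce (c : R) : continuous (fun s : R => expR (c * s)).
  move=> s; apply: (@continuous_comp _ _ _ (fun s => c * s) expR); last exact: continuous_expR.
  by apply: cvgM; [exact: cvg_cst|exact: cvg_id].
have ch : continuous h.
  move=> z; apply: cvgM; first by apply: cvgN; exact: cp.
  apply: (@continuous_comp _ _ _ snd (fun s => expR (- be * s))); first exact: cvg_snd.
  exact: ce.
pose K := `[a, b]%classic `*` `[0, T]%classic.
have [|||[xm tm]] := @compact_EVT_max _ R h K.
- by exists (x, t); split; rewrite /= in_itv/= ?xab// t0 /T; lra.
- by apply: compact_setX; exact: segment_compact.
- exact: continuous_subspaceT.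
rewrite inE => -[/=]; rewrite !in_itv/= => xmab tmT hmax.
have {}hmax y s : a <= y <= b -> 0 <= s <= T -> h (y, s) <= h (xm, tm).
  by move=> yab sT; apply: hmax; rewrite inE; split; rewrite /= in_itv.
pose m : R := Num.max 0 (h (xm, tm)).
have m0 : 0 <= m by rewrite /m le_max lexx.
have pm (y s : R) : a <= y <= b -> 0 <= s <= T -> - p (y, s) <= m * expR (be * s).
  move=> yab sT; have : h (y, s) <= m by rewrite /m le_max hmax// orbT.
  by rewrite /h /= [- be * s]mulNr expRN ler_pdivrMr// expR_gt0.
pose Gam (s : R) : R := m / 2 * expR (be * s).
pose c (s : R) : R := be / 2 * m * expR (be * s).
have cc : continuous c by move=> s; apply: cvgM; [exact: cvg_cst|exact: ce].
have cG : continuous Gam by move=> s; apply: cvgM; [exact: cvg_cst|exact: ce].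
have dG (s : R) : is_derive s 1 Gam (c s).
  apply: is_derive_eq.
  by rewrite /c /GRing.scale /=; ring.
have sub : subheat a b 0 T (fun z => -1 * p z - Gam z.2).
  apply: solution_subheat => // x' y s r ax xy yb s0 sr rT.
  rewrite -(Rintegral_FTC2 (ltW sr) dG cc).
  apply: Phi_le_time => // z tau zab st tr.
  have tau0 : 0 < tau by exact: le_lt_trans st.
  have tauT : 0 <= tau <= T by rewrite (ltW tau0) (le_trans (ltW tr)).
  have /andP[q1 q2] := q_bound zab tau0.
  have := pm z tau zab tauT; have := vbe tau tauT.
  have := v_ge0 (ltW tau0); rewrite /f /c.
  have : 0 <= m * expR (be * tau) by rewrite mulr_ge0// expR_ge0.
  rewrite -mulrA; move: (m * _) q1 q2 => M q1 q2 M0 v0 vb pM.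
  have q0 : 0 <= q (z, tau) by apply: le_trans q1; rewrite mulr_ge0// ltW.
  have : q (z, tau) * - p (z, tau) <= q (z, tau) * M by exact: ler_wpM2l.
  have : q (z, tau) * M <= be / 2 * M by apply: ler_wpM2r => //; exact: le_trans vb.
  by lra.
have cpg : continuous (fun z => -1 * p z - Gam z.2).
  move=> z; apply: cvgB; first by apply: cvgM; [exact: cvg_cst|exact: cp].
  by apply: (@continuous_comp _ _ _ snd Gam); [exact: cvg_snd|exact: cG].
have bound y s : a <= y <= b -> 0 <= s <= T -> -1 * p (y, s) - Gam s <= 0.
  apply: (subheat_max_le cpg T0 sub) => z zab /=.
  have := p0_ge0 zab; rewrite /Gam mulr0 expR0; lra.
have hm2 : h (xm, tm) <= m / 2.
  have := bound xm tm xmab tmT; rewrite /h /Gam /= [- be * tm]mulNr expRN => hh.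
  by rewrite ler_pdivrMr ?expR_gt0//; move: hh; lra.
have mm : m <= m / 2 by rewrite {1}/m ge_max hm2 andbT; lra.
have mz : m = 0 by lra.
have := pm x t xab; rewrite t0 mz mul0r /T => /(_ ltac:(lra)); lra.
Qed.

Lemma Phi_ge0 (x y s t : R) : a <= x -> x <= y -> y <= b -> 0 <= s -> s < t ->
  0 <= Phi x y s t.
Proof.
move=> ax xy yb s0 st; rewrite -oppr_le0 -mulN1r.
have c00 : continuous (fun _ : R => 0 : R) by move=> x'; exact: cvg_cst.
have := @Phi_le_time (-1) (fun=> 0) x y s t ax xy yb s0 st c00.
rewrite Rintegral_zero mul0r; apply => z tau zab stau _.
have tau0 : 0 < tau by exact: le_lt_trans stau.
have /andP[q1 _] := q_bound zab tau0.
rewrite mulN1r oppr_le0 mulr_ge0 ?p_ge0 ?(ltW tau0)//.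
by apply: le_trans q1; rewrite mulr_ge0 ?(ltW k0)// v_ge0// ltW.
Qed.

Lemma neg_subheat (t0 t1 : R) : 0 <= t0 -> subheat a b t0 t1 (fun z => - p z).
Proof.
move=> t00.
rewrite (_ : (fun z => - p z) = (fun z => -1 * p z - (fun=> 0) z.2)); last first.
  by apply/funext => z /=; ring.
apply: (@solution_subheat (-1) (fun=> 0)) => // [s|x y s t ax xy yb s0 st _].
  exact: cvg_cst.
by rewrite subrr mul0r mulN1r oppr_le0 Phi_ge0// (le_trans _ s0).
Qed.

Lemma U_balance (t : R) : 0 <= t -> U t = U 0 + v 0 - v t.
Proof.
rewrite le_eqVlt => /predU1P[<-|t0]; first by ring.
have [G [Ga Gb _ _ GP]] := pflux (lexx 0) t0.
have := GP a b (lexx a) (ltW ab) (lexx b); rewrite Ga Gb mass//.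
rewrite RintegralB//; last 2 first.
- by apply: continuous_itv_integrable; exact: continuous_slice1.
- by apply: continuous_itv_integrable; exact: continuous_slice1.
rewrite -/(U t) -/(U 0); lra.
Qed.

Lemma Phi_ge (s t : R) : 0 <= s -> s < t ->
  k * (\int[mu]_(tau in `[s, t]) (v tau * U tau)) <= v s - v t.
Proof.
move=> s0 st.
pose g z := - (k * v z.2 * p z).
have cvz : continuous (fun z : R * R => k * v z.2).
  move=> z; apply: cvgM; first exact: cvg_cst.
  by apply: (@continuous_comp _ _ _ snd v); [exact: cvg_snd|exact: cv].
have cg : continuous g.
  by move=> z; apply: cvgN; apply: cvgM; [exact: cvz|exact: cp].
have := @Phi_le (-1) g a b s t (lexx a) (ltW ab) (lexx b) s0 st cg.
rewrite mass// (fubini_continuous (ltW ab) (ltW st) cg).2.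
have -> : \int[mu]_(tau in `[s, t]) \int[mu]_(x in `[a, b]) g (x, tau) =
    - (k * \int[mu]_(tau in `[s, t]) (v tau * U tau)).
  have ip tau : mu.-integrable `[a, b] (EFin \o (fun x => p (x, tau))).
    by apply: continuous_itv_integrable; exact: continuous_slice1.
  have cU : continuous U.
    exact: (continuous_param_integral (ltW ab) (continuous_slices_swap cp)).
  rewrite -mulNr -RintegralZl//; last first.
    by apply: continuous_itv_integrable => tau; apply: cvgM; [exact: cv|exact: cU].
  apply: eq_Rintegral => tau _; rewrite /g /=.
  rewrite /U mulrA -RintegralZl//; apply: eq_Rintegral => x _ /=; ring.
move=> h; rewrite -lerN2 -mulN1r; apply: h => z tau zab stau _.
have tau0 : 0 < tau by exact: le_lt_trans stau.
have /andP[q1 _] := q_bound zab tau0.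
by rewrite mulN1r /g lerN2 /f ler_wpM2r// p_ge0// ltW.
Qed.

Lemma v_nonincreasing (s t : R) : 0 <= s -> s <= t -> v t <= v s.
Proof.
move=> s0; rewrite le_eqVlt => /predU1P[->//|st].
by rewrite -subr_ge0 -mass// Phi_ge0// ltW.
Qed.

Let c0 := k * U 0.

Let c0_gt0 : 0 < c0. Proof. exact: mulr_gt0. Qed.

Lemma integral_v_le (s t : R) : 0 <= s -> s < t ->
  c0 * (\int[mu]_(tau in `[s, t]) v tau) <= v s - v t.
Proof.
move=> s0 st; apply: le_trans (Phi_ge s0 st).
rewrite /c0 -mulrA; apply: ler_wpM2l; first exact: ltW.
have cU : continuous U.
  exact: (continuous_param_integral (ltW ab) (continuous_slices_swap cp)).
rewrite -RintegralZl//; last exact: continuous_itv_integrable.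
apply: le_Rintegral => //.
- by apply: continuous_itv_integrable => tau; apply: cvgM; [exact: cvg_cst|exact: cv].
- by apply: continuous_itv_integrable => tau; apply: cvgM; [exact: cv|exact: cU].
move=> tau /=; rewrite in_itv/= => /andP[stau _].
have tau0 : 0 <= tau by exact: le_trans stau.
rewrite [leRHS]mulrC ler_wpM2r ?v_ge0// (U_balance tau0).
have := v_nonincreasing (lexx 0) tau0; lra.
Qed.

Lemma v_decay (t : R) : 0 < t -> v t <= v 0 / c0 / t.
Proof.
move=> t0; rewrite ler_pdivlMr// ler_pdivlMr//.
have := integral_v_le (lexx 0) t0.
have : v t * (t - 0) <= \int[mu]_(tau in `[0, t]) v tau.
  apply: Rintegral_itv_ge_cst; first exact: ltW.
    exact: continuous_itv_integrable.
  by move=> x /andP[x0 xt]; exact: v_nonincreasing.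
rewrite subr0 => h1 h2; have := v_ge0 (ltW t0).
have : c0 * (v t * t) <= c0 * \int[mu]_(tau in `[0, t]) v tau by rewrite ler_pM2l.
move: h2; rewrite [v t * t * c0]mulrC; lra.
Qed.

Lemma v_small (e : R) : 0 < e -> exists2 t0 : R, 0 < t0 & forall t : R, t0 <= t -> v t <= e.
Proof.
move=> e0; exists (v 0 / c0 / e + 1) => [|t tt].
  apply: ltr_wpDl => //; apply: divr_ge0; last exact: ltW.
  by apply: divr_ge0; [exact: v_ge0|exact: ltW].
have vc : 0 <= v 0 / c0 by rewrite divr_ge0 ?v_ge0// ltW.
have h0 : 0 <= v 0 / c0 / e by rewrite divr_ge0// ltW.
have t0 : 0 < t by move: tt h0; lra.
apply: le_trans (v_decay t0) _.
rewrite ler_pdivrMr// [leRHS]mulrC -ler_pdivrMr//; move: tt; lra.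
Qed.

Let Gam (M t0 t : R) := M / c0 * (v t0 - v t).

Let cGam (M t0 : R) : continuous (Gam M t0).
Proof.
move=> t; apply: cvgM; first exact: cvg_cst.
by apply: cvgB; [exact: cvg_cst|exact: cv].
Qed.

Let cpGam (M t0 : R) : continuous (fun z => p z - Gam M t0 z.2).
Proof.
move=> z; apply: cvgB; first exact: cp.
by apply: (@continuous_comp _ _ _ snd (Gam M t0)); [exact: cvg_snd|exact: cGam].
Qed.

Let Gam_ge0 (M t0 t : R) : 0 <= M -> 0 <= t0 -> t0 <= t -> 0 <= Gam M t0 t.
Proof.
move=> M0 t00 tt; rewrite /Gam mulr_ge0//; first by rewrite divr_ge0// ltW.
by rewrite subr_ge0 v_nonincreasing.
Qed.

Let Gam_le (M t0 t : R) : 0 <= M -> 0 <= t0 -> t0 <= t -> Gam M t0 t <= M / c0 * v t0.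
Proof.
move=> M0 t00 tt; rewrite /Gam ler_wpM2l//; first by rewrite divr_ge0// ltW.
have := @v_ge0 t (le_trans t00 tt); lra.
Qed.

Lemma compensated_subheat (M t0 t1 : R) : 0 <= M -> 0 <= t0 ->
  (forall x t, a <= x <= b -> t0 <= t <= t1 -> p (x, t) <= M) ->
  subheat a b t0 t1 (fun z => p z - Gam M t0 z.2).
Proof.
move=> M0 t00 pM.
rewrite (_ : (fun z => _) = (fun z => 1 * p z - Gam M t0 z.2)); last first.
  by apply/funext => z; rewrite mul1r.
apply: (@solution_subheat 1 (Gam M t0)) => // x y s t ax xy yb t0s st tt1.
have s0 : 0 <= s by exact: le_trans t0s.
have cMv : continuous (fun t => M * v t).
  by move=> ?; apply: cvgM; [exact: cvg_cst|exact: cv].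
have := @Phi_le_time 1 (fun t => M * v t) x y s t ax xy yb s0 st cMv.
move=> h; apply: le_trans (h _) _ => [z tau zab stau taut|].
  have tau0 : 0 < tau by exact: le_lt_trans stau.
  have /andP[q1 q2] := q_bound zab tau0.
  rewrite mul1r /f [M * _]mulrC; apply: ler_pM => //.
  - by apply: le_trans q1; rewrite mulr_ge0 ?(ltW k0)// v_ge0// ltW.
  - by apply: p_ge0 => //; exact: ltW.
  - by apply: pM => //; rewrite (le_trans t0s (ltW stau)) (le_trans (ltW taut)).
apply: ler_wpM2r; first by rewrite subr_ge0.
rewrite RintegralZl//; last exact: continuous_itv_integrable.
have -> : Gam M t0 t - Gam M t0 s = M * ((v s - v t) / c0) by rewrite /Gam; ring.
by apply: ler_wpM2l => //; rewrite ler_pdivlMr// mulrC integral_v_le.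
Qed.

Lemma p_bounded : exists M t0 : R, [/\ 0 <= M, 0 <= t0 &
  forall x t : R, a <= x <= b -> t0 <= t -> p (x, t) <= M].
Proof.
have c02 : 0 < c0 / 2 by rewrite divr_gt0.
have [t0 t00 vt0] := v_small c02.
have [C pC] := continuous_bounded_rectangle (ltW ab) (lexx t0) cp.
have C0 : 0 <= C by apply: le_trans (pC a t0 _ _) => //; rewrite lexx ?ltW.
exists (2 * C), t0; split; [lra|exact: ltW|move=> x t xab tt].
pose T := t + 1; have tT : t0 < T by rewrite /T; lra.
pose K := `[a, b]%classic `*` `[t0, T]%classic.
have [|||[xm tm]] := @compact_EVT_max _ R p K.
- by exists (x, t); split; rewrite /= in_itv/= ?xab// tt /T; lra.
- by apply: compact_setX; exact: segment_compact.
- exact: continuous_subspaceT.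
rewrite inE => -[/=]; rewrite !in_itv/= => xmab tmT pmax.
have {}pmax y s : a <= y <= b -> t0 <= s <= T -> p (y, s) <= p (xm, tm).
  by move=> yab sT; apply: pmax; rewrite inE; split; rewrite /= in_itv.
have [t0m tmT'] := andP tmT.
have m0 : 0 <= p (xm, tm) by apply: p_ge0 => //; apply: le_trans t0m; exact: ltW.
have sub := compensated_subheat m0 (ltW t00) pmax.
have := @subheat_max_le t0 T C _ (@cpGam _ _) tT sub _ xm tm xmab tmT.
move=> /(_ _)/= h.
have {}h : p (xm, tm) - Gam (p (xm, tm)) t0 tm <= C.
  apply: h => y yab /=; rewrite /Gam subrr mulr0 subr0.
  by apply: le_trans (pC y t0 yab _); [exact: ler_norm|rewrite lexx].
have g1 := Gam_le m0 (ltW t00) t0m.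
have g2 : p (xm, tm) / c0 * v t0 <= p (xm, tm) / 2.
  rewrite -mulrA ler_wpM2l// mulrC ler_pdivrMr//.
  by have := vt0 t0 (lexx _); lra.
have : p (x, t) <= p (xm, tm) by apply: pmax => //; rewrite tt /T; lra.
lra.
Qed.

Lemma oscillation_small (e : R) : 0 < e -> exists2 T : R, 0 <= T &
  forall x y t : R, a <= x <= b -> a <= y <= b -> T <= t -> p (y, t) - p (x, t) <= e.
Proof.
move=> e0; pose d := e / 3; have d0 : 0 < d by rewrite divr_gt0.
have [M [t0 [M0 t00 pM]]] := p_bounded.
have [|t0' t0'0 vsm] := @v_small (c0 * d / (M + 1)).
  by rewrite divr_gt0 ?mulr_gt0// ltr_wpDl.
pose t1 := Num.max t0 t0'.
have t01 : t0 <= t1 by rewrite le_max lexx.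
have t10 : 0 <= t1 by exact: le_trans t01.
have vt1 : M / c0 * v t1 <= d.
  have := vsm t1; rewrite le_max lexx orbT => /(_ isT); rewrite ler_pdivlMr ?ltr_wpDl// => h.
  have := v_ge0 t10 => v1.
  by rewrite mulrAC ler_pdivrMr//; move: h; lra.
have [B B0 mod] := @continuous_modulus R _ a b d (continuous_slice1 (t := t1) cp) d0.
pose L := b - a; have L0 : 0 < L by rewrite subr_gt0.
pose A := B / (3 * L); have A0 : 0 < A by rewrite divr_gt0// mulr_gt0.
pose l := 8 / (3 * (b - a) ^+ 2).
have l0 : 0 < l by rewrite divr_gt0// mulr_gt0// exprn_gt0.
have [|S S0 expS] := @expR_small R l (4 * A * L ^+ 2) d l0 _ d0.
  by rewrite mulr_ge0 ?sqr_ge0// mulr_ge0// ltW.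
exists (t1 + S) => [|x y t xab yab tS]; first exact: addr_ge0.
have tt1 : t1 <= t by move: S0 tS; lra.
have sub1 : subheat a b t1 (t + 1) (fun z => p z - Gam M t1 z.2).
  by apply: compensated_subheat => // x' t' xab' /andP[tt' _]; apply: pM => //; exact: le_trans tt'.
have sub2 : subheat a b t1 (t + 1) (fun z => - p z) by exact: neg_subheat.
have cnp : continuous (fun z => - p z) by move=> z; apply: cvgN; exact: cp.
have init x' y' : a <= x' -> x' <= y' -> y' <= b ->
    `|p (y', t1) - p (x', t1)| <=
    d + A * expR (- l * (t1 - t1)) * (4 * (b - a) * (y' - x') - (y' - x') ^+ 2).
  move=> ax xy yb; apply: le_trans (mod _ _ ax xy yb) _.
  rewrite subrr mulr0 expR0 mulr1 lerD2l -/L.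
  have -> : B = A * (3 * L) by rewrite /A divfK// gt_eqF// mulr_gt0.
  rewrite -mulrA ler_pM2l//.
  have : 0 <= (y' - x') * (L - (y' - x')).
    by rewrite mulr_ge0// ?subr_ge0//; rewrite /L; lra.
  by move: (y' - x') => z; rewrite expr2; lra.
have fin x' y' : a <= x' -> x' <= y' -> y' <= b ->
    d + A * expR (- l * (t - t1)) * (4 * (b - a) * (y' - x') - (y' - x') ^+ 2) <= d + d.
  move=> ax xy yb; rewrite lerD2l.
  have tS' : S <= t - t1 by move: tS; lra.
  apply: le_trans (expS _ tS'); rewrite -/L.
  have z0 : 0 <= y' - x' by rewrite subr_ge0.
  have zL : y' - x' <= L by rewrite /L; lra.
  have key : 4 * L * (y' - x') - (y' - x') ^+ 2 <= 4 * L ^+ 2.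
    have := mulr_ge0 z0 z0; have := ler_wpM2l (ltW L0) zL.
    by move: (y' - x') => z; rewrite !expr2; lra.
  have E0 : 0 <= A * expR (- l * (t - t1)) by rewrite mulr_ge0 ?expR_ge0 ?ltW.
  apply: le_trans (ler_wpM2l E0 key) _.
  by rewrite le_eqVlt; apply/orP; left; apply/eqP; ring.
have G0 := Gam_ge0 M0 t10 tt1; have G1 := Gam_le M0 t10 tt1.
have tt : t1 <= t < t + 1 by rewrite tt1; lra.
have [/andP[ax xb] /andP[ay yb]] := (xab, yab).
have [xy|/ltW yx] := leP x y.
- have := @subheat_doubling R a b t1 (t + 1) _ _ A d ab A0 d0 (@cpGam M t1) cnp sub1 sub2.
  rewrite /= => /(_ _ _ x y t ax xy yb tt) h.
  have {}h := le_trans (h _ _) (fin x y ax xy yb).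
  have {}h : p (y, t) - Gam M t1 t + - p (x, t) <= d + d.
    apply: h => [x' y' ax' xy' yb'|x' t' xab' tt'].
      rewrite /Gam subrr mulr0 subr0; apply: le_trans (init x' y' ax' xy' yb').
      exact: ler_norm.
    by have := Gam_ge0 M0 t10 tt'; lra.
  by move: h G1 vt1; rewrite /d; lra.
- have := @subheat_doubling R a b t1 (t + 1) _ _ A d ab A0 d0 cnp (@cpGam M t1) sub2 sub1.
  rewrite /= => /(_ _ _ y x t ay yx xb tt) h.
  have {}h := le_trans (h _ _) (fin y x ay yx xb).
  have {}h : - p (x, t) + (p (y, t) - Gam M t1 t) <= d + d.
    apply: h => [x' y' ax' xy' yb'|x' t' xab' tt'].
      rewrite /Gam subrr mulr0 subr0; apply: le_trans (init x' y' ax' xy' yb').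
      by rewrite distrC addrC; exact: ler_norm.
    by have := Gam_ge0 M0 t10 tt'; lra.
  by move: h G1 vt1; rewrite /d; lra.
Qed.

Lemma uniform_limit (e : R) : 0 < e -> exists2 T : R, 0 <= T &
  forall x t : R, a <= x <= b -> T <= t -> `|p (x, t) - (U 0 + v 0) / (b - a)| <= e.
Proof.
move=> e0; have e2 : 0 < e / 2 by rewrite divr_gt0.
have L0 : 0 < b - a by rewrite subr_gt0.
have [T1 T10 osc] := oscillation_small e2.
have [|T2 T20 vs] := @v_small (e / 2 * (b - a)); first exact: mulr_gt0.
exists (Num.max T1 T2) => [|x t xab]; first by rewrite le_max T10.
rewrite ge_max => /andP[tT1 tT2].
have t0 : 0 <= t by exact: le_trans tT1.
have v1 := vs t tT2; have v2 := v_ge0 t0.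
have ip : mu.-integrable `[a, b] (EFin \o (fun x => p (x, t))).
  by apply: continuous_itv_integrable; exact: continuous_slice1.
have u1 : U t <= (p (x, t) + e / 2) * (b - a).
  apply: Rintegral_itv_le_cst => //; first exact: ltW.
  by move=> y yab; have := osc x y t xab yab tT1; lra.
have u2 : (p (x, t) - e / 2) * (b - a) <= U t.
  apply: Rintegral_itv_ge_cst => //; first exact: ltW.
  by move=> y yab; have := osc y x t yab xab tT1; lra.
move: u1 u2; rewrite (U_balance t0) => u1 u2.
rewrite ler_norml; apply/andP; split.
- suff : (U 0 + v 0) / (b - a) <= p (x, t) + e by lra.
  by rewrite ler_pdivrMr//; lra.
- suff : p (x, t) - e <= (U 0 + v 0) / (b - a) by lra.
  by rewrite ler_pdivlMr//; lra.
Qed.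

End asymptotics.

Lemma within_continuous_comp (X Y Z : topologicalType) (D : set Y) (f : Y -> Z)
    (g : X -> Y) : {within D, continuous f} -> continuous g -> (forall x, D (g x)) ->
  continuous (f \o g).
Proof.
move=> /subspace_continuousP cf cg Dg x.
apply: (@cvg_comp _ _ _ g f _ (within D (nbhs (g x)))); last exact: cf.
move=> P; rewrite /within /= => nP; have := cg x _ nP.
by rewrite /nbhs /=; apply: filterS => y /(_ (Dg y)).
Qed.

Lemma continuous_exhaustion (R : realType) (X Z : topologicalType) (c : X -> R)
    (g : X -> Z) (gT : R -> X -> Z) : continuous c ->
  (forall T : R, 0 < T -> continuous (gT T)) ->
  (forall (T : R) x, 0 < T -> c x <= T -> gT T x = g x) -> continuous g.
Proof.
move=> cc cgT gE x; pose T := Num.max 0 (c x) + 1.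
have T0 : 0 < T by rewrite ltr_wpDl// le_max lexx.
have cT : c x < T by rewrite ltr_pwDr// le_max lexx orbT.
have h := cgT T T0 x.
rewrite /prop_for /continuous_at -(gE T x T0 (ltW cT)); apply: cvg_trans h.
apply: near_eq_cvg.
have : \forall y \near x, c y < T.
  exact: (cvgr_lt _ (cc x)).
by apply: filterS => y /ltW; exact: gE.
Qed.

Lemma continuous_max0 (R : realType) : continuous (fun t : R => Num.max 0 t).
Proof. by move=> t; apply: continuous_max; [exact: cvg_cst|exact: cvg_id]. Qed.

Section C1_global.
Variable R : realType.
Notation mu := (@lebesgue_measure R).
Variables f df : R -> R.
Hypothesis C1f : forall T : R, 0 < T -> C1_with_deriv T f df.

Lemma C1_quotient (t e : R) : 0 <= t -> 0 < e -> exists2 d : R, 0 < d & forall s : R,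
  0 <= s -> s != t -> `|s - t| < d -> `|df t - (f s - f t) / (s - t)| < e.
Proof.
move=> t0 e0; pose T := t + 1; have T0 : 0 < T by rewrite ltr_wpDl.
have [_ /(_ t)] := C1f T0.
have tT : t \in `[0, T] by rewrite in_itv/= t0 lerDl ler01.
move=> /(_ tT) /cvgrPdist_lt /(_ e e0).
move=> /nbhs_ballP[d /= d0 hd].
exists (Num.min d 1) => [|s s0 st]; first by rewrite lt_min d0 ltr01.
rewrite lt_min => /andP[sd s1]; apply: (hd s) => //.
- by rewrite /ball /= distrC.
- rewrite in_itv/= s0 /T; move: s1; rewrite ltr_norml => /andP[_]; lra.
Qed.

Lemma C1_within_continuous (T : R) : 0 < T -> {within `[0, T], continuous f}.
Proof.
move=> T0; apply/subspace_continuousP => t /=; rewrite in_itv/= => /andP[t0 tT].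
apply/cvgrPdist_lt => e e0.
have [d d0 hd] := C1_quotient t0 ltr01.
pose K := `|df t| + 1.
have K0 : 0 < K by rewrite ltr_wpDl.
apply/nbhs_ballP; exists (Num.min d (e / K)) => /=.
  by rewrite lt_min d0 divr_gt0.
move=> s /=; rewrite /ball /= distrC lt_min => /andP[sd se]; rewrite in_itv/= => /andP[s0 _].
have [->|st] := eqVneq s t; first by rewrite subrr normr0.
have := hd s s0 st sd => q1.
have st0 : 0 < `|s - t| by rewrite normr_gt0 subr_eq0.
have : `|(f s - f t) / (s - t)| <= K.
  have -> : (f s - f t) / (s - t) = df t - (df t - (f s - f t) / (s - t)) by ring.
  by apply: le_trans (ler_normB _ _) _; rewrite lerD2l ltW.
rewrite normrM normfV ler_pdivrMr// distrC => h.
by apply: le_lt_trans h _; rewrite mulrC -ltr_pdivlMr.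
Qed.

Let fe (t : R) := f (Num.max 0 t).
Let dfe (t : R) := df (Num.max 0 t).

Let clamp_continuous (g : R -> R) :
  (forall T : R, 0 < T -> {within `[0, T], continuous g}) ->
  continuous (fun t : R => g (Num.max 0 t)).
Proof.
move=> cg; apply: (@continuous_exhaustion R _ _ id _
  (fun T t => g (Num.min T (Num.max 0 t)))) => [t|T T0|T t T0 tT].
- exact: cvg_id.
- have := @within_continuous_comp R R R `[0, T] g (fun t : R => Num.min T (Num.max 0 t)) (cg T T0).
  apply.
  + by move=> t; apply: continuous_min; [exact: cvg_cst|exact: continuous_max0].
  + by move=> t; rewrite /= in_itv/= le_min le_max lexx (ltW T0) ge_min lexx.
- by rewrite (min_idPr _)// ge_max tT ltW.
Qed.

Lemma C1_continuous : continuous fe.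
Proof. by apply: clamp_continuous => T T0; exact: C1_within_continuous. Qed.

Lemma C1_continuous_deriv : continuous dfe.
Proof. by apply: clamp_continuous => T /C1f[]. Qed.

Lemma C1_is_derive (t : R) : 0 < t -> is_derive t 1 fe (df t).
Proof.
move=> t0.
have E : h^-1 *: ((fe \o shift t) (h *: (1 : R)) - fe t) @[h --> 0^'] --> df t.
  apply/cvgrPdist_lt => e e0.
  have [d d0 hd] := C1_quotient (ltW t0) e0.
  apply/nbhs_ballP; exists (Num.min d t) => /=; first by rewrite lt_min d0 t0.
  move=> h /=; rewrite /ball /= sub0r normrN lt_min => /andP[hd' ht] h0.
  have ht0 : 0 <= h + t by move: ht; rewrite ltr_norml => /andP[]; lra.
  have := hd (h + t) ht0; rewrite addrK => /(_ _ hd').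
  rewrite /fe [h *: 1]mulr1 (max_idPr ht0) (max_idPr (ltW t0)).
  rewrite -subr_eq0 addrK /GRing.scale /= [h^-1 * _]mulrC; exact.
apply: DeriveDef; first by apply/cvg_ex; exists (df t).
by rewrite /derive; apply: cvg_lim.
Qed.

Lemma C1_FTC (s t : R) : 0 <= s -> s < t ->
  \int[mu]_(tau in `[s, t]) dfe tau = f t - f s.
Proof.
move=> s0 st; have cf := C1_continuous; have t0 : 0 <= t := le_trans s0 (ltW st).
rewrite /Rintegral (@continuous_FTC2 _ _ fe)//=.
- by rewrite /fe (max_idPr s0) (max_idPr t0).
- by apply: continuous_subspaceT; exact: C1_continuous_deriv.
- split.
  + move=> x; rewrite in_itv/= => /andP[sx _].
    by apply: (@ex_derive _ _ _ _ _ _ _ (C1_is_derive _)); exact: le_lt_trans sx.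
  + by apply: cvg_at_right_filter; exact: cf.
  + by apply: cvg_at_left_filter; exact: cf.
- move=> x; rewrite in_itv/= => /andP[sx _]; have x0 : 0 < x by exact: le_lt_trans sx.
  rewrite derive1E (@derive_val _ _ _ _ _ _ _ (C1_is_derive x0)) /dfe.
  by rewrite (max_idPr (ltW x0)).
Qed.

End C1_global.

Lemma linear_ode_ge0 (R : realType) (z ka : R -> R) (K T : R) : continuous z ->
  (forall t : R, 0 < t -> is_derive t 1 z (ka t * z t)) ->
  (forall t : R, 0 < t < T -> `|ka t| <= K) -> 0 <= z 0 ->
  forall t : R, 0 <= t <= T -> 0 <= z t.
Proof.
move=> cz dz kaK z0 t /andP[t0 tT]; rewrite leNgt; apply/negP => zt.
have [||c /=] := @IVT R z 0 t 0 t0.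
- exact: continuous_subspaceT.
- by rewrite ge_min le_max z0 (ltW zt) orbT.
rewrite in_itv/= => /andP[c0 ct] zc.
pose g (s : R) : R := z s ^+ 2 * expR (- (2 * K) * s).
have dg (s : R) : 0 < s ->
    is_derive s 1 g ((2 * ka s - 2 * K) * (z s ^+ 2 * expR (- (2 * K) * s))).
  move=> s0; have dzs := dz s s0.
  apply: is_derive_eq.
  by rewrite /GRing.scale /=; ring.
have cg : continuous g.
  move=> s; apply: cvgM.
    by under eq_fun do rewrite expr2; rewrite expr2; apply: cvgM; exact: cz.
  apply: (@continuous_comp _ _ _ (fun s => - (2 * K) * s) expR); last exact: continuous_expR.
  by apply: cvgM; [exact: cvg_cst|exact: cvg_id].
have : g t <= g c.
  apply: (@ler0_derive1_nincr _ g c t) => //.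
  - move=> s; rewrite in_itv/= => /andP[cs _].
    by apply: (@ex_derive _ _ _ _ _ _ _ (dg _ _)); exact: le_lt_trans cs.
  - move=> s; rewrite in_itv/= => /andP[cs st].
    have s0 : 0 < s by exact: le_lt_trans cs.
    rewrite derive1E (@derive_val _ _ _ _ _ _ _ (dg s s0)).
    apply: mulr_le0_ge0; last by rewrite mulr_ge0 ?sqr_ge0 ?expR_ge0.
    have := kaK s; rewrite s0 (lt_le_trans st tT) ler_norml => /(_ isT) /andP[_]; lra.
  - exact: continuous_subspaceT.
rewrite /g zc expr0n mul0r => h.
have : 0 < z t ^+ 2 * expR (- (2 * K) * t).
  by rewrite mulr_gt0 ?expR_gt0// exprn_even_gt0//= lt_eqF.
by rewrite ltNge h.
Qed.

Lemma ae_ge0_continuous (R : realType) (g : R -> R) (a b : R) : a < b -> continuous g ->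
  {ae @lebesgue_measure R, forall x, x \in `]a, b[ -> 0 <= g x} ->
  forall x, a <= x <= b -> 0 <= g x.
Proof.
move=> ab cg [N [mN N0 hN]] x /andP[ax xb]; rewrite leNgt; apply/negP => gx.
have /nbhs_ballP[d /= d0 hd] : \forall y \near x, g y < 0 by exact: (cvgr_lt _ (cg x)).
pose l := Num.max a (x - d); pose r := Num.min b (x + d).
have lr : l < r.
  rewrite gt_max !lt_min ab /=; apply/andP; split; first lra.
  apply/andP; split; lra.
have sub : `]l, r[%classic `<=` N.
  move=> y /=; rewrite in_itv/= gt_max lt_min => /andP[/andP[y1 y2] /andP[y3 y4]].
  apply: hN => /= /(_ _)/=; rewrite in_itv/= y1 y3 => /(_ isT).
  rewrite leNgt => /negP; apply; apply: hd; rewrite /ball /= ltr_norml; apply/andP; split; lra.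
have : (lebesgue_measure (`]l, r[%classic : set R) <= lebesgue_measure N)%E.
  by apply: le_measure; rewrite ?inE.
by rewrite N0 lebesgue_measure_itv /= lte_fin lr -EFinB lee_fin leNgt subr_gt0 lr.
Qed.

Section relay_system.
Variable R : realType.
Notation mu := (@lebesgue_measure R).
Variables (a b : R) (r0 u0 : R -> R) (v0 w0 : R) (u : R * R -> R) (v w : R -> R).
Hypotheses (a_gt0 : 0 < a) (lt_ab : a < b) (b_lt : b < 2^-1).
Hypothesis u0_W : W12 a b u0.
Hypothesis u0_ge0 : {ae mu, forall x, x \in `]a, b[ -> 0 <= u0 x}.
Hypothesis u0_neq0 : ~ {ae mu, forall x, x \in `]a, b[ -> u0 x = 0}.
Hypotheses (v0_ge0 : 0 <= v0) (w0_le : `|w0| <= 2^-1).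
Hypothesis r0_pm1 : forall x, x \in `[a, b] -> r0 x = -1 \/ r0 x = 1.
Hypothesis A0_simple : simple_state (state a b r0 (cst w0) 0).
Hypothesis sol : forall T : R, 0 < T -> strong_solution a b r0 u0 v0 w0 T u v w.

Let dv (t : R) : R :=
  - (2^-1 * totalU a b u t + w t * preisachP a b r0 u w t) * v t.
Let dw (t : R) : R := - (2^-1 + w t) * (2^-1 - w t) * preisachP a b r0 u w t.

Let C1v (T : R) : 0 < T -> C1_with_deriv T v dv.
Proof. by move=> /sol[_ [_ [_ []]]]. Qed.

Let C1w (T : R) : 0 < T -> C1_with_deriv T w dw.
Proof. by move=> /sol[_ [_ [_ [_ []]]]]. Qed.

Let v_init : v 0 = v0. Proof. by case: (sol ltr01) => _ [_ [_ [_ [_ []]]]]. Qed.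
Let w_init : w 0 = w0. Proof. by case: (sol ltr01) => _ [_ [_ [_ [_ []]]]]. Qed.

Let pe (z : R * R) : R := u (Num.max a (Num.min b z.1), Num.max 0 z.2).
Let ve (t : R) : R := v (Num.max 0 t).
Let we (t : R) : R := w (Num.max 0 t).
Let rl (z : R * R) : R := relay r0 we z.1 z.2.

Let veE (t : R) : 0 <= t -> ve t = v t. Proof. by move=> t0; rewrite /ve (max_idPr t0). Qed.
Let weE (t : R) : 0 <= t -> we t = w t. Proof. by move=> t0; rewrite /we (max_idPr t0). Qed.

Let peE (x t : R) : a <= x <= b -> 0 <= t -> pe (x, t) = u (x, t).
Proof.
by move=> /andP[ax xb] t0; rewrite /pe /= (min_idPr xb) (max_idPr ax) (max_idPr t0).
Qed.

Let rlE (x t : R) : 0 <= t -> rl (x, t) = relay r0 w x t.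
Proof. by move=> t0; apply: relay_ext => s /andP[s0 _]; exact: weE. Qed.

Let cve : continuous ve. Proof. exact: (C1_continuous C1v). Qed.
Let cwe : continuous we. Proof. exact: (C1_continuous C1w). Qed.

Let cpe : continuous pe.
Proof.
apply: (@continuous_exhaustion R _ _ snd _
  (fun T z => u (Num.max a (Num.min b z.1), Num.min T (Num.max 0 z.2)))).
- by move=> z; exact: cvg_snd.
- move=> T T0; have [cu _] := sol T0.
  have := @within_continuous_comp (R * R)%type (R * R)%type R (`[a, b] `*` `[0, T]) u
   (fun z : R * R => (Num.max a (Num.min b z.1), Num.min T (Num.max 0 z.2))) cu; apply.
    have c1 : continuous (fun z : R * R => Num.max a (Num.min b z.1)).
      move=> z; apply: (@continuous_comp _ _ _ fst (fun x : R => Num.max a (Num.min b x))).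
        exact: cvg_fst.
      apply: continuous_max; first exact: cvg_cst.
      by apply: continuous_min; [exact: cvg_cst|exact: cvg_id].
    have c2 : continuous (fun z : R * R => Num.min T (Num.max 0 z.2)).
      move=> z; apply: (@continuous_comp _ _ _ snd (fun x : R => Num.min T (Num.max 0 x))).
        exact: cvg_snd.
      by apply: continuous_min; [exact: cvg_cst|exact: continuous_max0].
    by move=> z; apply: cvg_to_pair; [exact: c1|exact: c2].
  move=> z; split; rewrite /= in_itv/=.
    by rewrite le_max lexx ge_max (ltW lt_ab) ge_min lexx.
  by rewrite le_min le_max lexx (ltW T0) ge_min lexx.
- by move=> T z T0 zT; rewrite /pe (min_idPr (_ : Num.max 0 z.2 <= T))// ge_max zT ltW.
Qed.

Let rl_norm (x t : R) : a <= x <= b -> `|rl (x, t)| = 1.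
Proof.
by move=> xab; rewrite /rl /=; have [->|->] := relay_pm1 we t r0_pm1 xab;
  rewrite ?normrN normr1.
Qed.

Let mrl (T : R) : measurable_fun (`[a, b] `*` `]0, T[) rl.
Proof. by apply: (measurable_relay a_gt0 cwe _ r0_pm1 A0_simple); rewrite weE. Qed.

Let pe_bound (T : R) : 0 <= T -> exists C : R, forall x t : R,
  a <= x <= b -> 0 <= t <= T -> `|pe (x, t)| <= C.
Proof. by move=> T0; exact: (continuous_bounded_rectangle (ltW lt_ab) T0 cpe). Qed.

Let mpe (D : set (R * R)) : measurable_fun D pe.
Proof. by apply: measurable_funTS; exact: continuous_measurable_plane. Qed.

Let iprl (t : R) : 0 < t -> mu.-integrable `[a, b] (EFin \o (fun x => pe (x, t) * rl (x, t))).
Proof.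
move=> t0; have [|C hC] := @pe_bound (t + 1); first by rewrite addr_ge0// ltW.
apply: (@bounded_integrable_slice1 R `[a, b] `]0, t + 1[ (fun z => pe z * rl z) C) => //.
- exact: lebesgue_measure_itv_lty.
- by apply: measurable_funM; [exact: mpe|exact: mrl].
- move=> [x s] [/=]; rewrite !in_itv/= => xab /andP[s0 s1].
  by rewrite normrM rl_norm// mulr1 hC// (ltW s0) (ltW s1).
- by rewrite /= in_itv/= t0 ltrDl ltr01.
Qed.

Let ip (t : R) : mu.-integrable `[a, b] (EFin \o (fun x => pe (x, t))).
Proof. by apply: continuous_itv_integrable; exact: continuous_slice1. Qed.

Let totalUE (t : R) : 0 <= t -> totalU a b u t = \int[mu]_(x in `[a, b]) pe (x, t).
Proof.
by move=> t0; apply: eq_Rintegral => x; rewrite inE /= in_itv/= => xab; rewrite peE.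
Qed.

Let preisachPE (t : R) : 0 <= t ->
  preisachP a b r0 u w t = \int[mu]_(x in `[a, b]) (pe (x, t) * rl (x, t)).
Proof.
move=> t0; apply: eq_Rintegral => x; rewrite inE /= in_itv/= => xab.
by rewrite peE// rlE.
Qed.

Let UP_bound (T : R) : 0 <= T -> exists2 C : R, 0 <= C & forall t : R, 0 < t <= T ->
  `|totalU a b u t| <= C /\ `|preisachP a b r0 u w t| <= C.
Proof.
move=> T0; have [C hC] := pe_bound T0.
exists (C * (b - a)) => [|t /andP[t0 tT]].
  apply: mulr_ge0; last by rewrite subr_ge0 ltW.
  apply: le_trans (hC a 0 _ _) => //.
  - by rewrite lexx ltW.
  - by rewrite lexx.
rewrite (totalUE (ltW t0)) (preisachPE (ltW t0)); split.
- apply: Rintegral_itv_norm_le => [||x xab]; [exact: ltW|exact: ip|].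
  by apply: hC => //; rewrite (ltW t0).
- apply: Rintegral_itv_norm_le => [||x xab]; [exact: ltW|exact: iprl|].
  by rewrite normrM rl_norm// mulr1 hC// (ltW t0).
Qed.

Let w_bound (T : R) : 0 <= T -> exists2 C : R, 0 <= C & forall t : R, 0 <= t <= T -> `|w t| <= C.
Proof.
move=> T0; have cn : continuous (fun t => `|we t|).
  by move=> t; apply: (@continuous_comp _ _ _ we Num.norm); [exact: cwe|exact: norm_continuous].
have [tm _ hm] := EVT_max T0 (continuous_subspaceT cn).
exists `|we tm| => // t tT; have := hm t; rewrite in_itv/= => /(_ tT).
by rewrite weE//; case/andP: tT.
Qed.

Let derw (t : R) : 0 < t -> is_derive t 1 we (dw t).
Proof. exact: (C1_is_derive C1w). Qed.

Let derv (t : R) : 0 < t -> is_derive t 1 ve (dv t).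
Proof. exact: (C1_is_derive C1v). Qed.

Let w_half (t : R) : 0 <= t -> `|w t| <= 2^-1.
Proof.
move=> t0.
have [C C0 hC] := UP_bound t0; have [W W0 hW] := w_bound t0.
have kb (s sg : R) : `|sg| = 1 -> 0 < s < t ->
    `|sg * (2^-1 + sg * w s) * preisachP a b r0 u w s| <= (2^-1 + W) * C.
  move=> sg1 /andP[s0 st].
  have s0t : 0 < s <= t by rewrite s0 ltW.
  have [_ hP] := hC s s0t.
  rewrite !normrM sg1 mul1r; apply: ler_pM => //.
  apply: le_trans (ler_normD _ _) _; rewrite normrM sg1 mul1r [`|2^-1|]ger0_norm//.
  by apply: lerD => //; apply: hW; rewrite (ltW s0) (ltW st).
move: w0_le; rewrite ler_norml => /andP[wl wu].
have we0 : we 0 = w0 by rewrite weE.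
rewrite ler_norml; apply/andP; split.
- have : 0 <= 2^-1 + we t.
    apply: (@linear_ode_ge0 R (fun s => 2^-1 + we s)
      (fun s => -1 * (2^-1 + -1 * w s) * preisachP a b r0 u w s) ((2^-1 + W) * C) t).
    + by move=> s; apply: cvgD; [exact: cvg_cst|exact: cwe].
    + move=> s s0; have ds := derw s0; apply: is_derive_eq.
      by rewrite scaler0 add0r /dw (weE (ltW s0)); ring.
    + by move=> s st; apply: kb => //; rewrite normrN1.
    + by rewrite we0; move: wl; lra.
    + by rewrite t0 lexx.
  by rewrite weE//; lra.
- have : 0 <= 2^-1 - we t.
    apply: (@linear_ode_ge0 R (fun s => 2^-1 - we s)
      (fun s => 1 * (2^-1 + 1 * w s) * preisachP a b r0 u w s) ((2^-1 + W) * C) t).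
    + by move=> s; apply: cvgB; [exact: cvg_cst|exact: cwe].
    + move=> s s0; have ds := derw s0; apply: is_derive_eq.
      by rewrite scaler0 add0r /dw (weE (ltW s0)); ring.
    + by move=> s st; apply: kb => //; rewrite normr1.
    + by rewrite we0; move: wu; lra.
    + by rewrite t0 lexx.
  by rewrite weE//; lra.
Qed.

Let ve_ge0 (t : R) : 0 <= t -> 0 <= ve t.
Proof.
move=> t0; have [C C0 hC] := UP_bound t0.
apply: (@linear_ode_ge0 R ve
  (fun s => - (2^-1 * totalU a b u s + w s * preisachP a b r0 u w s)) C t).
- exact: cve.
- move=> s s0; have ds := derv s0; apply: is_derive_eq.
  by rewrite /dv veE ?ltW.
- move=> s /andP[s0 st]; have [hU hP] : `|totalU a b u s| <= C /\ `|preisachP a b r0 u w s| <= C.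
    by apply: hC; rewrite s0 ltW.
  rewrite normrN; apply: le_trans (ler_normD _ _) _; rewrite !normrM.
  have h1 : `|2^-1 : R| * `|totalU a b u s| <= 2^-1 * C.
    by rewrite ger0_norm// ler_wpM2l.
  have h2 : `|w s| * `|preisachP a b r0 u w s| <= 2^-1 * C.
    by apply: ler_pM => //; exact: w_half (ltW s0).
  by apply: le_trans (lerD h1 h2) _; rewrite -mulrDl; lra.
- by rewrite veE// v_init.
- by rewrite t0 lexx.
Qed.

Let q (z : R * R) : R := (2^-1 + we z.2 * rl z) * ve z.2.

Let q_bound (x t : R) : a <= x <= b -> 0 < t -> (2^-1 - b) * ve t <= q (x, t) <= ve t.
Proof.
move=> xab t0; have v1 := ve_ge0 (ltW t0).
have r1 := relay_lower we r0_pm1 a_gt0 xab (ltW t0).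
have r2 : we t * rl (x, t) <= 2^-1.
  apply: le_trans (ler_norm _) _; rewrite normrM rl_norm// mulr1 (weE (ltW t0)).
  exact: w_half (ltW t0).
rewrite /q /=; apply/andP; split; first by rewrite ler_wpM2r// lerD2l.
rewrite -[leRHS]mul1r ler_wpM2r//; move: r2; lra.
Qed.

Let mf (T : R) : measurable_fun (`[a, b] `*` `]0, T[) (fun z => q z * pe z).
Proof.
apply: measurable_funM; last exact: mpe.
have msnd (g : R -> R) : continuous g ->
    measurable_fun (`[a, b] `*` `]0, T[) (fun z : R * R => g z.2).
  move=> cg; apply: measurable_funTS; apply: continuous_measurable_plane => z.
  by apply: (@continuous_comp _ _ _ snd g); [exact: cvg_snd|exact: cg].
apply: measurable_funM; last exact: msnd.
apply: measurable_funD; first exact: measurable_cst.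
by apply: measurable_funM; [exact: msnd|exact: mrl].
Qed.

Let f_bound (T : R) : 0 <= T -> exists C : R, forall z : R * R,
  (`[a, b]%classic `*` `]0, T[%classic) z -> `|q z * pe z| <= C.
Proof.
move=> T0; have [C hC] := pe_bound T0.
have [tm _ hm] := EVT_max T0 (continuous_subspaceT cve).
exists (ve tm * C) => -[x t] [/=]; rewrite !in_itv/= => xab /andP[t0 tT].
have /andP[q1 q2] := q_bound xab t0.
rewrite normrM; apply: ler_pM => //; last by apply: hC => //; rewrite (ltW t0) (ltW tT).
rewrite ger0_norm.
  by apply: le_trans q2 _; apply: hm; rewrite in_itv/= (ltW t0) (ltW tT).
by apply: le_trans q1; rewrite mulr_ge0 ?subr_ge0 ?(ltW b_lt)// ve_ge0// ltW.
Qed.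

Let rect_sub (s t : R) : 0 <= s ->
  `]a, b[%classic `*` `]s, t[%classic `<=` `[a, b]%classic `*` `]0, t[%classic.
Proof.
move=> s0 [x r] [/=]; rewrite !in_itv/= => /andP[ax xb] /andP[sr rt].
by rewrite (ltW ax) (ltW xb) rt (le_lt_trans s0 sr).
Qed.

Let mf_rect (s t : R) : 0 <= s ->
  measurable_fun (`]a, b[ `*` `]s, t[) (fun z => q z * pe z).
Proof.
move=> s0; apply: (@measurable_funS _ _ _ _ (`[a, b] `*` `]0, t[)).
- exact: measurableX.
- exact: rect_sub.
- exact: mf.
Qed.

Let fi (T : R) : 0 < T -> (leb2 R).-integrable (QT a b T) (EFin \o (fun z => q z * pe z)).
Proof.
move=> T0; have [C hC] := f_bound (ltW T0).
apply: (@bounded_integrable_rectangle R `]a, b[ `]0, T[ (fun z => q z * pe z) C) => //.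
- exact: lebesgue_measure_itv_lty.
- exact: lebesgue_measure_itv_lty.
- exact: mf_rect.
- by move=> z hz; apply: hC; exact: rect_sub hz.
Qed.

Let slice_integral (t : R) : 0 < t ->
  \int[mu]_(x in `]a, b[) (q (x, t) * pe (x, t)) = - dv t.
Proof.
move=> t0.
have E x : q (x, t) * pe (x, t) = (2^-1 * ve t) * pe (x, t) + (we t * ve t) * (pe (x, t) * rl (x, t)).
  by rewrite /q /=; ring.
have i1 : mu.-integrable `[a, b] (EFin \o (fun x => (2^-1 * ve t) * pe (x, t))).
  by apply: integrable_RZ => //; exact: ip.
have i2 : mu.-integrable `[a, b] (EFin \o (fun x => (we t * ve t) * (pe (x, t) * rl (x, t)))).
  by apply: integrable_RZ => //; exact: iprl.
rewrite Rintegral_itv_oo_cc; last first.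
  rewrite (_ : EFin \o _ = EFin \o (fun x => (2^-1 * ve t) * pe (x, t) + (we t * ve t) * (pe (x, t) * rl (x, t)))).
    exact: integrable_RD.
  by apply/funext => x /=; rewrite E.
under eq_Rintegral do rewrite E.
rewrite RintegralD// !RintegralZl//; last exact: iprl.
rewrite -(totalUE (ltW t0)) -(preisachPE (ltW t0)) /dv veE ?weE ?ltW//; ring.
Qed.

Let mass (s t : R) : 0 <= s -> s < t ->
  \int[leb2 R]_(z in `]a, b[ `*` `]s, t[) (q z * pe z) = ve s - ve t.
Proof.
move=> s0 st; have t0 : 0 <= t := le_trans s0 (ltW st).
have [C hC] := f_bound t0.
rewrite (@fubini_rectangle21 R `]a, b[ `]s, t[ (fun z => q z * pe z) C) //; last 4 first.
- exact: lebesgue_measure_itv_lty.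
- exact: lebesgue_measure_itv_lty.
- exact: mf_rect.
- by move=> z hz; apply: hC; exact: rect_sub hz.
have cdv := C1_continuous_deriv C1v.
transitivity (\int[mu]_(tau in `]s, t[) (-1 * dv (Num.max 0 tau))).
  apply: eq_Rintegral => tau; rewrite inE /= in_itv/= => /andP[stau _].
  have tau0 : 0 < tau by exact: le_lt_trans stau.
  by rewrite slice_integral// (max_idPr (ltW tau0)) mulN1r.
rewrite Rintegral_itv_oo_cc; last first.
  by apply: integrable_RZ => //; exact: continuous_itv_integrable.
rewrite RintegralZl//; last exact: continuous_itv_integrable.
rewrite (C1_FTC C1v s0 st) (veE s0) (veE t0); ring.
Qed.

Let pflux (s t : R) : 0 <= s -> s < t -> exists G : R -> R,
    [/\ G a = 0, G b = 0, mu.-integrable `[a, b] (EFin \o G),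
       (forall x y, a <= x -> x <= y -> y <= b ->
         \int[mu]_(tau in `[s, t]) pe (y, tau) - \int[mu]_(tau in `[s, t]) pe (x, tau) =
         \int[mu]_(z in `[x, y]) G z) &
       (forall x y, a <= x -> x <= y -> y <= b ->
         G y - G x = \int[mu]_(z in `[x, y]) (pe (z, t) - pe (z, s)) -
           \int[leb2 R]_(z in `]x, y[ `*` `]s, t[) (q z * pe z))].
Proof.
move=> s0 st; have t0 : 0 < t := le_lt_trans s0 st.
have [_ [[ux [uxx [ut [Wu ae ta tb]]]] _]] := sol t0.
apply: (solution_flux lt_ab t0 Wu ta tb cpe _ (fi t0) _ s0 st (lexx t)).
  move=> [x r] [/=]; rewrite !in_itv/= => /andP[ax xb] /andP[r0' _].
  by rewrite peE ?(ltW ax) ?(ltW xb)// ltW.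
apply: filterS ae; first exact: (ae_filter_ringOfSetsType (leb2 R)).
move=> [x r] h hQ; rewrite (h hQ); move: hQ => [/=]; rewrite !in_itv/= => /andP[ax xb] /andP[r1 _].
by rewrite /q /= rlE ?weE ?veE ?peE ?(ltW ax) ?(ltW xb) ?(ltW r1).
Qed.

Let u_init : {ae mu, forall x, x \in `]a, b[ -> pe (x, 0) = u0 x}.
Proof.
have [_ [_ [ae _]]] := sol ltr01.
apply: filterS ae; first exact: (ae_filter_ringOfSetsType mu).
move=> x h xab; rewrite -h// peE//.
by move: xab; rewrite in_itv/= => /andP[/ltW -> /ltW ->].
Qed.

Let cpe0 : continuous (fun x => pe (x, 0)). Proof. exact: continuous_slice1. Qed.

Let pe0_ge0 (x : R) : a <= x <= b -> 0 <= pe (x, 0).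
Proof.
apply: (@ae_ge0_continuous R (fun x => pe (x, 0)) a b lt_ab cpe0).
apply: filterS2 u_init u0_ge0; first exact: (ae_filter_ringOfSetsType mu).
by move=> y h1 h2 yab; rewrite h1// h2.
Qed.

Let U0E : \int[mu]_(x in `[a, b]) pe (x, 0) = \int[mu]_(x in `[a, b]) u0 x.
Proof.
have mu0 : measurable_fun `]a, b[ (EFin \o u0).
  by apply/measurable_EFinP; case: u0_W => -[].
have mp0 : measurable_fun `]a, b[ (EFin \o (fun x => pe (x, 0))).
  apply/measurable_EFinP; apply: measurable_funTS; exact: continuous_measurable_fun.
rewrite /Rintegral; congr fine.
rewrite (integral_itv_bndoo true false mp0) (integral_itv_bndoo true false mu0).
apply: ae_eq_integral => //.
apply: filterS u_init; first exact: (ae_filter_ringOfSetsType mu).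
by move=> x h xab /=; rewrite h// inE.
Qed.

Let U0_gt0 : 0 < \int[mu]_(x in `[a, b]) pe (x, 0).
Proof.
have U0 : 0 <= \int[mu]_(x in `[a, b]) pe (x, 0).
  by apply: Rintegral_ge0 => x /=; rewrite in_itv/=; exact: pe0_ge0.
rewrite lt_neqAle U0 andbT; apply/negP => /eqP/esym E; apply: u0_neq0.
have mp0 : measurable_fun `[a, b] (EFin \o (fun x => pe (x, 0))).
  apply/measurable_EFinP; apply: measurable_funTS; exact: continuous_measurable_fun.
have h : (\int[mu]_(x in `[a, b]) `|(pe (x, 0))%:E| = 0)%E.
  transitivity (\int[mu]_(x in `[a, b]) (pe (x, 0))%:E)%E.
    by apply: eq_integral => x; rewrite inE /= in_itv/= => xab; rewrite ger0_norm// pe0_ge0.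
  rewrite -[LHS]fineK; first by rewrite -/(Rintegral _ _ _) E.
  exact: (integrable_fin_num _ (ip 0)).
have {}h := (ae_eq_integral_abs mu (measurable_itv _) mp0).1 h.
have h' : {ae mu, forall x, x \in `]a, b[ -> pe (x, 0) = 0}.
  case: h => N [mN N0 hN]; exists N; split=> // x nx; apply: hN => h1; apply: nx => xab.
  have xab' : (`[a, b]%classic : set R) x.
    by move: xab; rewrite /= !in_itv/= => /andP[/ltW -> /ltW ->].
  by have := h1 xab'; case.
apply: filterS2 h' u_init; first exact: (ae_filter_ringOfSetsType mu).
by move=> x h1 h2 xab; rewrite -h2// h1.
Qed.

Let k0 : 0 < 2^-1 - b. Proof. by rewrite subr_gt0. Qed.

Lemma v_cvg0 : v t @[t --> +oo] --> 0.
Proof.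
apply/cvgrPdist_le => e e0.
have [T T0 hT] := v_small lt_ab k0 cpe cve ve_ge0 q_bound fi pflux mass pe0_ge0 U0_gt0 e0.
near=> t.
have tT : T <= t by near: t; apply: nbhs_pinfty_ge; exact: num_real.
have t0 : 0 <= t by apply: le_trans tT; exact: ltW.
rewrite sub0r normrN -veE// ger0_norm ?ve_ge0//; exact: hT.
Unshelve. all: by end_near. Qed.

Lemma u_cvg_uniform :
  {uniform `[a, b], (fun t x => u (x, t)) @ +oo -->
     cst ((\int[mu]_(x in `[a, b]) u0 x + v0) / (b - a))}.
Proof.
move=> P /uniform_nbhs[E [+ EP]]; rewrite -entourage_ballE => -[e /= e0 eE].
have e2 : 0 < e / 2 by rewrite divr_gt0.
have [T T0 hT] := uniform_limit lt_ab k0 cpe cve ve_ge0 q_bound fi pflux mass pe0_ge0 U0_gt0 e2.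
have : \forall t \near +oo, T <= t by apply: nbhs_pinfty_ge; exact: num_real.
apply: filterS => t tT; apply: EP => x /=; rewrite in_itv/= => xab.
apply: eE; rewrite /= /ball /= distrC -(peE xab (le_trans T0 tT)) -U0E -v_init -(veE (lexx 0)).
by apply: le_lt_trans (hT x t xab tT) _; lra.
Qed.

End relay_system.

Theorem theorem6p1 (R : realType) (a b : R) (r0 u0 : R -> R) (v0 w0 : R)
    (u : R * R -> R) (v w : R -> R)
    (a_gt0 : 0 < a) (lt_ab : a < b) (b_lt : b < 2^-1)
    (u0_W : W12 a b u0)
    (u0_ge0 : {ae @lebesgue_measure R, forall x, x \in `]a, b[ -> 0 <= u0 x})
    (u0_neq0 : ~ {ae @lebesgue_measure R, forall x, x \in `]a, b[ -> u0 x = 0})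
    (v0_ge0 : 0 <= v0) (w0_le : `|w0| <= 2^-1)
    (r0_pm1 : forall x, x \in `[a, b] -> r0 x = -1 \/ r0 x = 1)
    (A0_simple : simple_state (state a b r0 (cst w0) 0))
    (A0_compat : compatible a b w0 (state a b r0 (cst w0) 0))
    (sol : forall T, 0 < T -> strong_solution a b r0 u0 v0 w0 T u v w) :
  v t @[t --> +oo] --> 0 /\
  {uniform `[a, b], (fun t x => u (x, t)) @ +oo -->
     cst ((\int[@lebesgue_measure R]_(x in `[a, b]) u0 x + v0) / (b - a))}.
Proof. by split; [exact: v_cvg0 sol|exact: u_cvg_uniform sol]. Qed.
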